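(* Let $\lambda>-1$, let $\boldsymbol{k}\in\mathbb{Z}_+^m$ be a partition of $n$ with $m\geq 2$ and let $j\in\{1,\dots,m\}$ be given. If $T\in\mathrm{End}_{\mathrm{U}(\boldsymbol{k},j,\mathbb{T})}(\mathcal{A}^2_\lambda(\mathbb{B}^n))$, then, for every $\boldsymbol{\kappa}\in\mathbb{N}^m$, the operator $T$ preserves the decomposition \[ \mathcal{P}_{\boldsymbol{\kappa}}(\mathbb{C}^n) = \bigoplus_{\substack{\alpha\in\mathbb{N}^{n-k_j}\\ |\alpha_{(l)}|=\kappa_l,\ l\neq j}} {z_{\widehat{(j)}}}^{\alpha}\,\mathcal{P}_{\kappa_j}(\mathbb{C}^{k_j}), \] and the induced linear maps acting on the terms of this decomposition do not depend on $\alpha$. More precisely, for every $\boldsymbol{\kappa}\in\mathbb{N}^m$ the following properties hold. (1) For $\alpha,\beta\in\mathbb{N}^n$ such that $|\alpha_{(l)}|=|\beta_{(l)}|=\kappa_l$ for all $l=1,\dots,m$, and satisfying $\alpha_{\widehat{(j)}}\neq\beta_{\widehat{(j)}}$, we have \[ \langle T(z^\alpha),z^\beta\rangle_\lambda = 0, \] and so $T$ preserves the terms of the decomposition \[ \mathcal{P}_{\boldsymbol{\kappa}}(\mathbb{C}^n) = \bigoplus_{\substack{\gamma\in\mathbb{N}^{n-k_j}\\ |\gamma_{(l)}|=\kappa_l,\ l\neq j}} {z_{\widehat{(j)}}}^{\gamma}\,\mathcal{P}_{\kappa_j}(\mathbb{C}^{k_j}). \] (2) For $\alpha,\beta\in\mathbb{N}^{n-k_j}$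 such that $|\alpha_{(l)}|=|\beta_{(l)}|=\kappa_l$ for all $l\neq j$, we have \[ T\circ\iota_{\alpha,\beta} = \iota_{\alpha,\beta}\circ T \quad\text{on } {z_{\widehat{(j)}}}^{\alpha}\,\mathcal{P}_{\kappa_j}(\mathbb{C}^{k_j}), \] where $\iota_{\alpha,\beta}:{z_{\widehat{(j)}}}^{\alpha}\mathcal{P}_{\kappa_j}(\mathbb{C}^{k_j})\to{z_{\widehat{(j)}}}^{\beta}\mathcal{P}_{\kappa_j}(\mathbb{C}^{k_j})$ is the natural isomorphism ${z_{\widehat{(j)}}}^{\alpha}p(z_{(j)})\mapsto{z_{\widehat{(j)}}}^{\beta}p(z_{(j)})$.
   Context: Here $\mathbb{N}=\{0,1,2,\dots\}$ and $\mathbb{Z}_+$ is the set of positive integers. $\mathbb{B}^n$ is the open unit ball of $\mathbb{C}^n$ with Lebesgue measure $v$. For $\lambda>-1$, $dv_\lambda(z) = c_\lambda (1-|z|^2)^\lambda dv(z)$ with $c_\lambda = \frac{\Gamma(n+\lambda+1)}{\pi^n\Gamma(\lambda+1)}$, and $\mathcal{A}^2_\lambda(\mathbb{B}^n)$ is the closed subspace of holomorphic functions in $L^2(\mathbb{B}^n,v_\lambda)$, with inner product $\langle\cdot,\cdot\rangle_\lambda$. $\pi_\lambda$ is the unitary representation of $\mathrm{U}(n)$ on $\mathcal{A}^2_\lambda(\mathbb{B}^n)$ given by $\pi_\lambda(A)f=f\circ A^{-1}$. For a subgroup $H\subset\mathrm{U}(n)$, $\mathrm{End}_H(\mathcal{A}^2_\lambda(\mathbb{B}^n))$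 is the algebra of bounded operators $T$ with $T\pi_\lambda(A)=\pi_\lambda(A)T$ for all $A\in H$. A partition of $n$ is $\boldsymbol{k}=(k_1,\dots,k_m)\in\mathbb{Z}_+^m$ with $k_1+\dots+k_m=n$. It gives $\mathbb{C}^n=\mathbb{C}^{k_1}\times\dots\times\mathbb{C}^{k_m}$, $z=(z_{(1)},\dots,z_{(m)})$ and, for multi-indices, $\alpha=(\alpha_{(1)},\dots,\alpha_{(m)})\in\mathbb{N}^n$ with $\alpha_{(l)}\in\mathbb{N}^{k_l}$. For $j\in\{1,\dots,m\}$, $\mathrm{U}(\boldsymbol{k},j,\mathbb{T}) = \mathrm{U}(k_1)\times\dots\times\mathrm{U}(k_{j-1})\times\mathbb{T}I_{(j)}\times\mathrm{U}(k_{j+1})\times\dots\times\mathrm{U}(k_m)$, embedded block diagonally in $\mathrm{U}(n)$, with $I_{(j)}$ the identity of $\mathbb{C}^{k_j}$. For $\boldsymbol{\kappa}\in\mathbb{N}^m$, $\mathcal{P}_{\boldsymbol{\kappa}}(\mathbb{C}^n)$ is the linear span of the monomials $z^\alpha$ with $|\alpha_{(l)}|=\kappa_l$ for all $l$; $\mathcal{P}_{\kappa}(\mathbb{C}^k)$ is the space of homogeneous holomorphic polynomials of degree $\kappa$ on $\mathbb{C}^k$. For $z\in\mathbb{C}^n$ and $\alpha\in\mathbb{N}^n$, $z_{\widehat{(j)}}=(z_{(1)},\dots,z_{(j-1)},z_{(j+1)},\dots,z_{(m)})\in\mathbb{C}^{n-k_j}$ and $\alpha_{\widehat{(j)}}=(\alpha_{(1)},\dots,\alpha_{(j-1)},\alpha_{(j+1)},\dots,\alpha_{(m)})\in\mathbb{N}^{n-k_j}$.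 Elements $\alpha\in\mathbb{N}^{n-k_j}$ are written $\alpha=(\alpha_{(1)},\dots,\alpha_{(j-1)},\alpha_{(j+1)},\dots,\alpha_{(m)})$ with $\alpha_{(l)}\in\mathbb{N}^{k_l}$, skipping the index $j$. The subspace ${z_{\widehat{(j)}}}^{\alpha}\mathcal{P}_{\kappa_j}(\mathbb{C}^{k_j})$ is the span of the monomials ${z_{\widehat{(j)}}}^{\alpha}{z_{(j)}}^{\alpha'}$ with $\alpha'\in\mathbb{N}^{k_j}$, $|\alpha'|=\kappa_j$. ''$T$ preserves the decomposition'' means that $T$ maps each term into itself. *)

(* Defs.v *)
From HB Require Import structures.
From mathcomp Require Import all_boot all_order all_algebra spectral complex.
From mathcomp Require Import all_classical all_reals all_analysis.
From mathcomp Require Import ring lra.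

Set Implicit Arguments.
Unset Strict Implicit.
Unset Printing Implicit Defensive.

Import Order.TTheory GRing.Theory Num.Theory.
Import numFieldNormedType.Exports.

Local Open Scope classical_set_scope.
Local Open Scope ring_scope.

Section lebesgue_measure_Rn.
Context {R : realType}.

Definition cons_pair N (p : measurableTypeR R * N.-tuple (measurableTypeR R)) :
  N.+1.-tuple (measurableTypeR R) := [tuple of p.1 :: p.2].

Lemma measurable_cons_pair N : measurable_fun setT (@cons_pair N).
Proof. exact: measurable_cons. Qed.

Section step.
Context (N : nat).
Variable mu :
  {sigma_finite_measure set (N.-tuple (measurableTypeR R)) -> \bar R}.

Definition lebesgue_step : set (N.+1.-tuple (measurableTypeR R)) -> \bar R :=
  pushforward (@lebesgue_measure R \x mu)%E (@cons_pair N).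

HB.instance Definition _ := Measure.copy lebesgue_step
  (measure_function_pushforward__canonical__measure_function_Measure
    (@lebesgue_measure R \x mu)%E (@measurable_cons_pair N)).

Let lebesgue_step_sigma_finite : sigma_finite setT lebesgue_step.
Proof.
have /sigma_finiteP[F [FT ndF Foo]] :
  sigma_finite setT (@lebesgue_measure R) by exact: sigma_finiteT.
have /sigma_finiteP[G [GT ndG Goo]] := sigma_finiteT mu.
pose g (x : N.+1.-tuple (measurableTypeR R)) := (thead x, [tuple of behead x]).
have cK p : g (cons_pair p) = p.
  by case: p => a t; congr pair; apply: val_inj.
have mg : measurable_fun setT g.
  apply/measurable_fun_pairP; split; first exact: measurable_tnth.
  exact: measurable_behead.
exists (fun i => g @^-1` (F i `*` G i)).
  apply/esym; rewrite -subTset => x _.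
  have [i _ Fi] : (\bigcup_i F i) (g x).1 by rewrite -FT.
  have [j _ Gj] : (\bigcup_i G i) (g x).2 by rewrite -GT.
  exists (maxn i j) => //; split => /=.
    by move: Fi; exact/subsetPset/ndF/leq_maxl.
  by move: Gj; exact/subsetPset/ndG/leq_maxr.
move=> i; have [mF Fi] := Foo i; have [mG Gi] := Goo i; split.
  by rewrite -[X in measurable X]setTI; apply: mg => //; exact: measurableX.
rewrite /lebesgue_step /pushforward -comp_preimage.
rewrite (_ : g \o _ = id); last by apply/funext => p; exact: cK.
by rewrite preimage_id product_measure1E// lte_mul_pinfty// ge0_fin_numE.
Qed.

HB.instance Definition _ := Measure_isSigmaFinite.Build _ _ _ lebesgue_step
  lebesgue_step_sigma_finite.

End step.

Fixpoint lebesgue_Rn (N : nat) :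
    {sigma_finite_measure set (N.-tuple (measurableTypeR R)) -> \bar R} :=
  match N with
  | 0 => \d_([tuple] : 0.-tuple (measurableTypeR R))
  | N'.+1 => lebesgue_step (lebesgue_Rn N')
  end.

End lebesgue_measure_Rn.

(** Functions on C^n. The regular module [R[i]^o] is used for the values because
    [R[i]] itself carries the structure of an [R]-module. *)
Notation cfun R n := ('cV[R[i]]_n -> R[i]^o).

Section bergman_space.
Context {R : realType} (n : nat).
Implicit Types (lambda : R) (f g : cfun R n) (T : cfun R n -> cfun R n).

(** Identification of [R^(2n)] with [C^n]. *)
Definition cvec_of (x : n.*2.-tuple (measurableTypeR R)) : 'cV[R[i]]_n :=
  \col_i ((nth 0 x (i : nat).*2) +i* (nth 0 x (i : nat).*2.+1))%C.

Definition normc2 (w : R[i]) : R := complex.Re w ^+ 2 + complex.Im w ^+ 2.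

Definition sqnorm (z : 'cV[R[i]]_n) : R := \sum_i normc2 (z i 0).

Definition unit_ball : set 'cV[R[i]]_n := [set z | sqnorm z < 1].

Definition Gamma (s : R) : R :=
  \int[@lebesgue_measure R]_(t in `]0, +oo[%classic)
    (t `^ (s - 1) * expR (- t)).

Definition bergman_const lambda : R :=
  Gamma (n%:R + lambda + 1) / (pi ^+ n * Gamma (lambda + 1)).

(** The density of [v_lambda] with respect to Lebesgue measure on the ball. *)
Definition bergman_density lambda (z : 'cV[R[i]]_n) : R :=
  bergman_const lambda * (1 - sqnorm z) `^ lambda.

(** Integral over the ball against [v_lambda]. *)
Definition bergman_int lambda (h : 'cV[R[i]]_n -> R) : R :=
  \int[lebesgue_Rn n.*2]_(x in cvec_of @^-1` unit_ball)
    (h (cvec_of x) * bergman_density lambda (cvec_of x)).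

Definition bergman_inner lambda f g : R[i] :=
  (bergman_int lambda (fun z => complex.Re (f z * (g z)^*)) +i*
   bergman_int lambda (fun z => complex.Im (f z * (g z)^*)))%C.

Definition bergman_norm lambda f : R :=
  Num.sqrt (bergman_int lambda (fun z => normc2 (f z))).

(** A function on the ball is represented by its extension by [0] to [C^n]. *)
Definition ball_restrict f : cfun R n :=
  fun z => if sqnorm z < 1 then f z else 0.

(** Frechet differentiability over the field [R[i]]. *)
Definition holomorphic_on (U : set 'cV[R[i]]_n) f :=
  forall z : ('cV[R[i]]_n : normedModType R[i]), U z -> differentiable f z.

Definition bergman lambda : set (cfun R n) :=
  [set f | [/\ ball_restrict f = f,
    holomorphic_on unit_ball f &
    (lebesgue_Rn n.*2).-integrable (cvec_of @^-1` unit_ball)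
      (fun x => (normc2 (f (cvec_of x)) *
                 bergman_density lambda (cvec_of x))%:E)]].

(** [T] is only relevant on [bergman lambda]. *)
Record bergman_operator lambda T : Prop := BergmanOperator {
  bergman_operator_stable : forall f, bergman lambda f -> bergman lambda (T f);
  bergman_operator_linear : forall (a : R[i]) f g,
    bergman lambda f -> bergman lambda g -> T (a *: f + g) = a *: T f + T g;
  bergman_operator_bounded : exists M : R, forall f, bergman lambda f ->
    bergman_norm lambda (T f) <= M * bergman_norm lambda f }.

Definition unitary_rep (A : 'M[R[i]]_n) f : cfun R n :=
  fun z => f (invmx A *m z).

Definition bergman_End lambda (H : set 'M[R[i]]_n) : set (cfun R n -> cfun R n) :=
  [set T | bergman_operator lambda T /\
    forall A f, H A -> bergman lambda f ->
      T (unitary_rep A f) = unitary_rep A (T f)].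

End bergman_space.

Section linear_span.
Context {K : pzRingType} {V : lmodType K}.

Definition lspan (S : set V) : set V :=
  [set v | exists N (c : 'I_N -> K) (s : 'I_N -> V),
    (forall i, S (s i)) /\ v = \sum_i c i *: s i].

Definition summands (I : choiceType) (D : set I) (W : I -> set V) :
    set (I -> V) :=
  [set w | [/\ forall i, D i -> W i (w i), forall i, ~ D i -> w i = 0 &
    finite_set [set i | w i <> 0]]].

(** [U] is the internal direct sum of the subspaces [W i], [i] in [D]. *)
Definition is_direct_sum (I : choiceType) (D : set I) (W : I -> set V)
    (U : set V) :=
  U = [set \sum_(i \in D) w i | w in summands D W] /\
  {in summands D W &, injective (fun w => \sum_(i \in D) w i)}.

End linear_span.

Section polynomials.
Context {R : realType}.

Definition mdegree n (a : 'cV[nat]_n) : nat := (\sum_i a i ord0)%N.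

Definition monomial n (a : 'cV[nat]_n) : cfun R n :=
  fun z => \prod_i z i 0 ^+ a i 0.

Definition homog_poly n (d : nat) : set (cfun R n) :=
  lspan [set monomial a | a in [set a : 'cV[nat]_n | mdegree a = d]].

Lemma monomialZ n (a : 'cV[nat]_n) (c : R[i]) (z : 'cV[R[i]]_n) :
  monomial a (c *: z) = c ^+ mdegree a * monomial a z.
Proof.
rewrite /monomial /mdegree -prodrXr -big_split /=.
by apply: eq_bigr => i _; rewrite mxE exprMn.
Qed.

Lemma homog_polyZ n d (p : cfun R n) (c : R[i]) (z : 'cV[R[i]]_n) :
  homog_poly d p -> p (c *: z) = c ^+ d * p z.
Proof.
move=> [N [e [s [hs ->]]]]; rewrite !fct_sumE mulr_sumr.
apply: eq_bigr => i _; have [b /= <- <-] := hs i.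
by rewrite !fctE monomialZ /GRing.scale /= mulrCA.
Qed.

Lemma sqnorm_ge0 n (z : 'cV[R[i]]_n) : 0 <= sqnorm z.
Proof. by apply: sumr_ge0 => i _; rewrite addr_ge0 ?sqr_ge0. Qed.

Lemma sqnormZ n (c : R) (z : 'cV[R[i]]_n) :
  sqnorm (c%:C%C *: z) = c ^+ 2 * sqnorm z.
Proof.
rewrite /sqnorm mulr_sumr; apply: eq_bigr => i _; rewrite mxE /normc2.
by case: (z i 0) => x y /=; ring.
Qed.

Context {m : nat} (k : 'I_m -> nat) (j : 'I_m).

(** [C^n] is [C^(k_1) x ... x C^(k_m)] with [n = \sum_l k l]; the component
    [z_(l)] is [submxcol z l]. The blocks other than [j] are enumerated by
    [lift j : 'I_m.-1 -> 'I_m]. *)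
Definition hat (X : Type) (z : 'cV[X]_(\sum_l k l)) :
    'cV[X]_(\sum_(l < m.-1) k (lift j l)) :=
  \mxcol_(l < m.-1) submxcol z (lift j l).

Definition multideg (kappa : 'I_m -> nat) : set 'cV[nat]_(\sum_l k l) :=
  [set a | forall l, mdegree (submxcol a l) = kappa l].

Definition multideg_hat (kappa : 'I_m -> nat) :
    set 'cV[nat]_(\sum_(l < m.-1) k (lift j l)) :=
  [set a | forall l, mdegree (submxcol a l) = kappa (lift j l)].

(** Polynomials on [C^n] are identified with their restrictions to the ball. *)
Definition ball_monomial n (a : 'cV[nat]_n) : cfun R n :=
  ball_restrict (monomial a).

Definition multihomog_poly (kappa : 'I_m -> nat) :
    set (cfun R (\sum_l k l)) :=
  lspan [set ball_monomial a | a in multideg kappa].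

Definition hat_mul (a : 'cV[nat]_(\sum_(l < m.-1) k (lift j l)))
    (p : cfun R (k j)) : cfun R (\sum_l k l) :=
  ball_restrict (fun z => monomial a (hat z) * p (submxcol z j)).

Definition hat_term (d : nat) (a : 'cV[nat]_(\sum_(l < m.-1) k (lift j l))) :
    set (cfun R (\sum_l k l)) :=
  lspan [set hat_mul a (monomial b)
        | b in [set b : 'cV[nat]_(k j) | mdegree b = d]].

(** [p] is recovered from [z_hat^a p(z_(j))]; see [hat_isoE]. *)
Definition hat_iso (d : nat)
    (a b : 'cV[nat]_(\sum_(l < m.-1) k (lift j l)))
    (f : cfun R (\sum_l k l)) : cfun R (\sum_l k l) :=
  hat_mul b (xget 0 [set p | homog_poly d p /\ f = hat_mul a p]).

Lemma hat_mul_inj d (a : 'cV[nat]_(\sum_(l < m.-1) k (lift j l)))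
    (p q : cfun R (k j)) : homog_poly d p -> homog_poly d q ->
  hat_mul a p = hat_mul a q -> p = q.
Proof.
move=> hp hq pq; apply/funext => w.
pose z0 : 'cV[R[i]]_(\sum_l k l) := \mxcol_l
  (if l == j then conform_mx (const_mx 1) w else const_mx 1).
pose c : R := (1 + sqnorm z0)^-1.
have S0 : 0 < 1 + sqnorm z0 by rewrite ltr_wpDr ?sqnorm_ge0.
have c0 : c%:C%C != 0 :> R[i].
  rewrite -(rmorph0 (real_complex R)) (inj_eq (@complexI R)).
  by rewrite invr_neq0 // gt_eqF.
have zB : sqnorm (c%:C%C *: z0) < 1.
  rewrite sqnormZ /c exprVn ltr_pdivrMl ?exprn_gt0 // mulr1.
  have := sqnorm_ge0 z0; nra.
have zj : submxcol z0 j = w by rewrite mxcolK eqxx conform_mx_id.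
have zh : hat z0 = const_mx 1.
  apply/matrixP => i o; rewrite /hat mxE mxcolK eq_sym (negbTE (neq_lift _ _)).
  by rewrite !mxE.
have /(congr1 (fun f => f (c%:C%C *: z0))) := pq.
rewrite /hat_mul /ball_restrict zB.
have -> : hat (c%:C%C *: z0) = c%:C%C *: hat z0.
  by apply/matrixP => i o; rewrite !mxE.
have -> : submxcol (c%:C%C *: z0) j = c%:C%C *: submxcol z0 j.
  by apply/matrixP => i o; rewrite !mxE.
rewrite zj zh monomialZ !(homog_polyZ _ _ hp) !(homog_polyZ _ _ hq).
have -> : monomial a (const_mx (1:R[i])) = 1.
  by rewrite /monomial big1 // => i _; rewrite mxE expr1n.
rewrite mulr1 => /(mulfI (expf_neq0 _ c0)) /(mulfI (expf_neq0 _ c0)).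
by [].
Qed.

Lemma hat_isoE d (a b : 'cV[nat]_(\sum_(l < m.-1) k (lift j l)))
    (p : cfun R (k j)) : homog_poly d p ->
  hat_iso d a b (hat_mul a p) = hat_mul b p.
Proof.
move=> hp; rewrite /hat_iso; case: xgetP => [q _ [hq pq]|/(_ p)[]//].
by rewrite (hat_mul_inj hp hq pq).
Qed.

Definition block_unitary : set 'M[R[i]]_(\sum_l k l) :=
  [set A | exists B : forall l, 'M[R[i]]_(k l),
    [/\ A = \mxdiag_l B l,
        forall l, l != j -> B l \is unitarymx &
        exists2 t : R[i], `|t| = 1 & B j = t%:M]].

End polynomials.

Arguments multideg {m} k kappa.
Arguments multideg_hat {m} k j kappa.
Arguments multihomog_poly R {m} k kappa.
Arguments hat_term R {m} k j d a.
Arguments block_unitary {R m} k j.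

(* Main.v *)
(** The stabilizer condition contains a torus acting by arbitrary phases on the coordinates
    outside of block [j] and by a common phase on block [j]. Hence [f = T (z^a)] satisfies
    [f (t z) = t^|a| f z] for [|t| = 1], and Euler's relation extends it to a homogeneous
    entire function. A holomorphic function of polynomial growth on [C] is a polynomial: the
    iterated divided differences of an entire function of growth [|s|^d] eventually decay at
    infinity, and Goursat's lemma on a large square shows that such a function vanishes (only
    rectangles and real line integrals are used). So [f] is a polynomial, and the linear
    independence of characters of the torus leaves only the monomials [z^b] with
    [hat b = hat a] and [|b_(j)| = |a_(j)|]. Orthogonality of distinct weights follows from the
    invariance of the Lebesgue measure under rotations of one coordinate, written as products
    of three shears.

    For the independence of [alpha], evaluate [T (F \o A) = T F \o A] for
    [F = z_hat^c p(z_(j))] at a point [z] whose blocks other than [j] are multiples of the first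
    basis vector, where [A] acts on each of these blocks by a real reflection mapping the first
    basis vector to a vector without zero coordinates. In the expansion of [F \o A] only one
    monomial in [z_hat] does not vanish at [z], the same one for all [c] with the given block
    degrees. *)
Require Import Defs.
From HB Require Import structures.
From mathcomp Require Import all_boot all_order all_algebra spectral complex.
From mathcomp Require Import all_classical all_reals all_analysis.
From mathcomp Require Import measurable_realfun qpoly ring lra.

Set Implicit Arguments.
Unset Strict Implicit.
Unset Printing Implicit Defensive.

Import Order.TTheory GRing.Theory Num.Theory.
Import numFieldNormedType.Exports Normc.

Local Open Scope classical_set_scope.
Local Open Scope ring_scope.

(** * Goursat's lemma for rectangles *)

(** The divided difference of an entire function is shown to be continuous, but not derivable, at
    its base point. Each base point of the iteration therefore joins a finite set of exceptional
    points, which is why Goursat's lemma is proved for forms that are closed off a finite set and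
    merely bounded near it.

    [T] is constrained only on the Bergman space, so every function to which its linearity or
    equivariance is applied must be shown to lie there. This is the purpose of the integral
    estimates: for [lambda < 0] the power (1 - |z|^2)^lambda is unbounded near the sphere.
    Integrating out one real coordinate raises the exponent by 1/2, which makes an induction on the
    dimension possible.

    The torus alone would let [T] act on z_(j) differently for each alpha. The reflections are the
    only group elements used that mix coordinates, and they tie these actions together. *)

Section primitive.
Context {R : realType} (B : R).
Implicit Types h : R -> R.

(** With one base point to the left of all rectangles, the integral over a side is a difference of
    two values, and the additivity needed for subdivisions is proved by [ring]. *)
Definition primitive h (x : R) : R :=
  \int[@lebesgue_measure R]_(t in `[- B, x]%classic) h t.

Lemma is_derive_primitive h x : continuous h -> - B < x -> x < B ->
  is_derive x 1 (primitive h) (h x).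
Proof.
move=> ch Bx xB.
have [|||dF <-] := @continuous_FTC1_closed R h (- B) x B xB.
- apply: continuous_compact_integrable; first exact: segment_compact.
  by apply: continuous_subspaceT.
- exact: Bx.
- exact: ch.
by rewrite derive1E; apply: derivableP.
Qed.

(** Mean value theorem for the difference between the primitive of [h] and that of its affine
    approximation. *)
Lemma primitive_bound h (al be e a b : R) :
    continuous h -> - B < a -> a <= b -> b < B ->
    (forall t, a <= t -> t <= b -> `|h t - (al + be * t)| <= e) ->
  `|primitive h b - primitive h a - (al * (b - a) + be * (b ^+ 2 - a ^+ 2) / 2)|
    <= e * (b - a).
Proof.
move=> ch Ba ab bB he.
pose g x := primitive h x - (al * x + be / 2 * x ^+ 2).
have dg x : - B < x -> x < B -> is_derive x 1 g (h x - (al + be * x)).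
  move=> Bx xB; have dp := is_derive_primitive ch Bx xB.
  apply: is_derive_eq; rewrite /GRing.scale /=.
  by field.
have [x||c] := @MVT_segment R g (fun x => h x - (al + be * x)) a b ab.
- by rewrite in_itv /= => /andP[ax xb]; apply: dg; lra.
- apply: derivable_within_continuous => x; rewrite in_itv /= => /andP[ax xb].
  by have [] := dg x ltac:(lra) ltac:(lra).
- rewrite in_itv /= => /andP[ac cb] gE.
  have -> : primitive h b - primitive h a -
     (al * (b - a) + be * (b ^+ 2 - a ^+ 2) / 2) = g b - g a.
    by rewrite /g; field.
  rewrite gE normrM (ger0_norm (_ : 0 <= b - a)) ?subr_ge0 //.
  by rewrite ler_wpM2r ?subr_ge0 // he.
Qed.

Lemma primitive_gt0 h (a b : R) :
    continuous h -> - B < a -> a < b -> b < B ->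
    (forall t, a <= t -> t <= b -> 0 < h t) -> primitive h a < primitive h b.
Proof.
move=> ch Ba ab bB h0.
have [x||c] := @MVT_segment R (primitive h) h a b (ltW ab).
- by rewrite in_itv /= => /andP[ax xb]; apply: is_derive_primitive => //; lra.
- apply: derivable_within_continuous => x; rewrite in_itv /= => /andP[ax xb].
  by have [] := @is_derive_primitive h x ch ltac:(lra) ltac:(lra).
- rewrite in_itv /= => /andP[ac cb] gE.
  by rewrite -subr_gt0 gE mulr_gt0 ?subr_gt0 ?h0.
Qed.

Lemma primitive_lt0 h (a b : R) :
    continuous h -> - B < a -> a < b -> b < B ->
    (forall t, a <= t -> t <= b -> h t < 0) -> primitive h b < primitive h a.
Proof.
move=> ch Ba ab bB h0.
have [x||c] := @MVT_segment R (primitive h) h a b (ltW ab).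
- by rewrite in_itv /= => /andP[ax xb]; apply: is_derive_primitive => //; lra.
- apply: derivable_within_continuous => x; rewrite in_itv /= => /andP[ax xb].
  by have [] := @is_derive_primitive h x ch ltac:(lra) ltac:(lra).
- rewrite in_itv /= => /andP[ac cb] gE.
  by rewrite -subr_lt0 gE nmulr_rlt0 ?subr_gt0 ?h0.
Qed.

End primitive.

Section goursat.
Context {R : realType} (B : R) (P Q : R -> R -> R).
Hypothesis cP : forall y, continuous (P^~ y).
Hypothesis cQ : forall x, continuous (Q x).

Local Notation E h a b := (primitive B h b - primitive B h a).

(** The integral of [P dx + Q dy] along the boundary of [[a, b] x [c, d]]. *)
Definition rect_int (a b c d : R) : R :=
  E (P^~ c) a b + E (Q b) c d - E (P^~ d) a b - E (Q a) c d.

(** Both coefficients are totally differentiable at the point, and the shared [p2] says that dP/dy =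
    dQ/dx there, so that the form P dx + Q dy is closed at this point. *)
Definition closed_at (x y : R) : Prop := exists p1 p2 q2 : R,
  forall e, 0 < e -> exists2 r, 0 < r & forall a b, `|a| < r -> `|b| < r ->
    `|P (x + a) (y + b) - P x y - (p1 * a + p2 * b)| <= e * (`|a| + `|b|) /\
    `|Q (x + a) (y + b) - Q x y - (p2 * a + q2 * b)| <= e * (`|a| + `|b|).

(** The affine part of a closed form integrates to 0 around the rectangle; only the error terms of
    the four sides remain. *)
Lemma rect_int_small (x y e : R) : closed_at x y -> 0 < e ->
  exists2 r, 0 < r & forall a b c d s : R, - B < a -> b < B -> - B < c -> d < B ->
    a <= x -> x <= b -> c <= y -> y <= d -> b - a <= s -> d - c <= s -> s < r ->
    `|rect_int a b c d| <= e * s ^+ 2.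
Proof.
move=> [p1 [p2 [q2 hPQ]]] e0.
(* In the rectangle the two increments add up to at most [2 * s]. So [e / 8] gives an error of
   [e / 4 * s] at each point, hence [e / 4 * s * s] on each side. *)
have [|r r0 hr] := hPQ (e / 8); first lra.
exists r => // a b c d s Ba bB Bc dB ax xb cy yd bas dcs sr.
have ab := le_trans ax xb; have cd := le_trans cy yd.
have hP t z : a <= t -> t <= b -> c <= z -> z <= d ->
    `|P t z - (P x y - p1 * x + p2 * (z - y) + p1 * t)| <= e / 4 * s.
  move=> at_ tb cz zd.
  have t1 : `|t - x| <= s by rewrite ler_norml; lra.
  have z1 : `|z - y| <= s by rewrite ler_norml; lra.
  have [+ _] := hr (t - x) (z - y) (le_lt_trans t1 sr) (le_lt_trans z1 sr).
  rewrite !(addrC x) !(addrC y) !subrK => H.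
  rewrite (_ : _ - _ = P t z - P x y - (p1 * (t - x) + p2 * (z - y))); last ring.
  apply: le_trans H _.
  rewrite (_ : e / 4 * s = e / 8 * (s + s)); last by field.
  by rewrite ler_wpM2l ?lerD // divr_ge0 // ltW.
have hQ t z : a <= t -> t <= b -> c <= z -> z <= d ->
    `|Q t z - (Q x y - q2 * y + p2 * (t - x) + q2 * z)| <= e / 4 * s.
  move=> at_ tb cz zd.
  have t1 : `|t - x| <= s by rewrite ler_norml; lra.
  have z1 : `|z - y| <= s by rewrite ler_norml; lra.
  have [_ +] := hr (t - x) (z - y) (le_lt_trans t1 sr) (le_lt_trans z1 sr).
  rewrite !(addrC x) !(addrC y) !subrK => H.
  rewrite (_ : _ - _ = Q t z - Q x y - (p2 * (t - x) + q2 * (z - y))); last ring.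
  apply: le_trans H _.
  rewrite (_ : e / 4 * s = e / 8 * (s + s)); last by field.
  by rewrite ler_wpM2l ?lerD // divr_ge0 // ltW.
have s0 : 0 <= s by lra.
have bd : e / 4 * s * (b - a) <= e / 4 * s * s.
  by rewrite ler_wpM2l // mulr_ge0 //; lra.
have bd' : e / 4 * s * (d - c) <= e / 4 * s * s.
  by rewrite ler_wpM2l // mulr_ge0 //; lra.
have := @primitive_bound R B (P^~ c) (P x y - p1 * x + p2 * (c - y)) p1 (e / 4 * s)
  a b (@cP c) Ba ab bB (fun t h1 h2 => hP t c h1 h2 (lexx _) cd).
have := @primitive_bound R B (P^~ d) (P x y - p1 * x + p2 * (d - y)) p1 (e / 4 * s)
  a b (@cP d) Ba ab bB (fun t h1 h2 => hP t d h1 h2 cd (lexx _)).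
have := @primitive_bound R B (Q a) (Q x y - q2 * y + p2 * (a - x)) q2 (e / 4 * s)
  c d (@cQ a) Bc cd dB (fun t => hQ a t (lexx _) ab).
have := @primitive_bound R B (Q b) (Q x y - q2 * y + p2 * (b - x)) q2 (e / 4 * s)
  c d (@cQ b) Bc cd dB (fun t => hQ b t ab (lexx _)).
move=> /le_trans/(_ bd') H1 /le_trans/(_ bd') H2 /le_trans/(_ bd) H3 /le_trans/(_ bd) H4.
rewrite /rect_int.
have -> : e * s ^+ 2 = e / 4 * s * s + e / 4 * s * s + e / 4 * s * s + e / 4 * s * s.
  by field.
move: H1 H2 H3 H4; set X := e / 4 * s * s.
set E1 := E (Q b) c d; set E2 := E (Q a) c d.
set E3 := E (P^~ d) a b; set E4 := E (P^~ c) a b.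
rewrite !ler_norml => /andP[H1 H1'] /andP[H2 H2'] /andP[H3 H3'] /andP[H4 H4'].
by apply/andP; split; move: H1 H1' H2 H2' H3 H3' H4 H4'; clear; lra.
Qed.

(** Think of [u n] as the left end of an interval of length [w / 2 ^+ n]; the hypothesis nests each
    interval in the previous one. The supremum of the left ends lies in all of them. *)
Lemma nested_point (u : nat -> R) (w : R) : 0 <= w ->
  (forall n, u n <= u n.+1 /\ u n.+1 <= u n + w / 2 ^+ n.+1) ->
  exists x, forall n, u n <= x /\ x <= u n + w / 2 ^+ n.
Proof.
move=> w0 hu.
have half n : w / 2 ^+ n.+1 + w / 2 ^+ n.+1 = w / 2 ^+ n.
  by rewrite exprS; field; rewrite expf_neq0.
have w2 n : 0 <= w / 2 ^+ n by rewrite divr_ge0 // exprn_ge0.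
have u1 n i : u n <= u (n + i)%N.
  by elim: i => [|i IH]; rewrite ?addn0 // addnS (le_trans IH) //; case: (hu (n + i)%N).
have u2 n i : u (n + i)%N + w / 2 ^+ (n + i) <= u n + w / 2 ^+ n.
  elim: i => [|i IH]; rewrite ?addn0 // addnS (le_trans _ IH) //.
  by have [_] := hu (n + i)%N; rewrite -(half (n + i)%N); lra.
have u3 n i : u i <= u n + w / 2 ^+ n.
  have [ni|/ltnW ni] := leqP n i.
    by rewrite -(subnKC ni); have := u2 n (i - n)%N; have := w2 (n + (i - n))%N; lra.
  by have := u1 i (n - i)%N; rewrite subnKC //; have := w2 n; lra.
have hs : has_sup (range u).
  by split; [exists (u 0%N), 0%N|exists (u 0%N + w / 2 ^+ 0) => _ [i _ <-]].
exists (sup (range u)) => n; split.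
  by apply: sup_upper_bound => //; exists n.
by apply: ge_sup => [|_ [i _ <-]]; [case: hs|].
Qed.

(** Quadrisection: some quarter carries at least a quarter of the integral. Repeating this gives
    nested rectangles, and [rect_int_small] at their common point bounds the integrals too strongly
    if the first one is not 0. *)
Lemma goursat_closed (a b c d : R) : - B < a -> a <= b -> b < B ->
  - B < c -> c <= d -> d < B ->
  (forall x y, a <= x <= b -> c <= y <= d -> closed_at x y) ->
  rect_int a b c d = 0.
Proof.
move=> Ba ab bB Bc cd dB cl.
apply/eqP/negP => /negP; rewrite -normr_gt0; set I0 := `|_| => I00.
pose w := b - a; pose h := d - c.
pose I n (p : R * R) :=
  rect_int p.1 (p.1 + w / 2 ^+ n) p.2 (p.2 + h / 2 ^+ n).
have step n p : exists q : R * R, [/\ `|I n p| <= 4 * `|I n.+1 q|,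
   p.1 <= q.1 <= p.1 + w / 2 ^+ n.+1 & p.2 <= q.2 <= p.2 + h / 2 ^+ n.+1].
  have E1 : w / 2 ^+ n = w / 2 ^+ n.+1 + w / 2 ^+ n.+1.
    by rewrite exprS; field; rewrite expf_neq0.
  have E2 : h / 2 ^+ n = h / 2 ^+ n.+1 + h / 2 ^+ n.+1.
    by rewrite exprS; field; rewrite expf_neq0.
  have w0 : 0 <= w / 2 ^+ n.+1 by rewrite divr_ge0 ?exprn_ge0 // /w; lra.
  have h0 : 0 <= h / 2 ^+ n.+1 by rewrite divr_ge0 ?exprn_ge0 // /h; lra.
  pose q1 := p; pose q2 := (p.1 + w / 2 ^+ n.+1, p.2).
  pose q3 := (p.1, p.2 + h / 2 ^+ n.+1).
  pose q4 := (p.1 + w / 2 ^+ n.+1, p.2 + h / 2 ^+ n.+1).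
  have IE : I n p = I n.+1 q1 + I n.+1 q2 + I n.+1 q3 + I n.+1 q4.
    rewrite /I /q1 /q2 /q3 /q4 /= E1 E2 !addrA /rect_int.
    by clear; move: (w / _) (h / _) => w' h'; move: p.1 p.2 (primitive B) => p1 p2 F; ring.
  have Ile : `|I n p| <= `|I n.+1 q1| + `|I n.+1 q2| + `|I n.+1 q3| + `|I n.+1 q4|.
    rewrite IE; apply: (le_trans (ler_normD _ _)); rewrite lerD2r.
    by apply: (le_trans (ler_normD _ _)); rewrite lerD2r ler_normD.
  have W (s t : R) : 0 <= t -> s <= s <= s + t by move=> t0; rewrite lexx lerDl.
  have W' (s t : R) : 0 <= t -> s <= s + t <= s + t by move=> t0; rewrite lexx lerDl t0.
  have [H1|H1] := leP `|I n p| (4 * `|I n.+1 q1|).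
    by exists q1; split=> //=; exact: W.
  have [H2|H2] := leP `|I n p| (4 * `|I n.+1 q2|).
    by exists q2; split=> //=; [exact: W'|exact: W].
  have [H3|H3] := leP `|I n p| (4 * `|I n.+1 q3|).
    by exists q3; split=> //=; [exact: W|exact: W'].
  exists q4; split=> //=; [|exact: W'|exact: W'].
  move: Ile H1 H2 H3; clear; lra.
pose st n p := sval (cid (step n p)).
pose fix u n : R * R := if n is n'.+1 then st n' (u n') else (a, c).
have uP n : [/\ `|I n (u n)| <= 4 * `|I n.+1 (u n.+1)|,
   (u n).1 <= (u n.+1).1 <= (u n).1 + w / 2 ^+ n.+1 &
   (u n).2 <= (u n.+1).2 <= (u n).2 + h / 2 ^+ n.+1].
  exact: (svalP (cid (step n (u n)))).
have [|n|x hx] := @nested_point (fun n => (u n).1) w; first by rewrite /w; lra.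
  by have [_ /andP[] ? ? _] := uP n.
have [|n|y hy] := @nested_point (fun n => (u n).2) h; first by rewrite /h; lra.
  by have [_ _ /andP[] ? ?] := uP n.
have Iu n : I0 <= 4 ^+ n * `|I n (u n)|.
  elim: n => [|n IH].
    rewrite expr0 mul1r /I0 /I /= !expr0 !divr1 /w /h.
    by rewrite (_ : a + (b - a) = b) 1?(_ : c + (d - c) = d) //; ring.
  have [H _ _] := uP n.
  by rewrite exprSr -mulrA (le_trans IH) // ler_wpM2l ?exprn_ge0.
have ux n : a <= (u n).1 /\ (u n).1 + w / 2 ^+ n <= b.
  elim: n => [|n [IH1 IH2]]; first by rewrite /= expr0 /w; lra.
  have [_ /andP[h1 h2] _] := uP n; split; first lra.
  suff : w / 2 ^+ n = w / 2 ^+ n.+1 + w / 2 ^+ n.+1 by lra.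
  by rewrite exprS; field; rewrite expf_neq0.
have uy n : c <= (u n).2 /\ (u n).2 + h / 2 ^+ n <= d.
  elim: n => [|n [IH1 IH2]]; first by rewrite /= expr0 /h; lra.
  have [_ _ /andP[h1 h2]] := uP n; split; first lra.
  suff : h / 2 ^+ n = h / 2 ^+ n.+1 + h / 2 ^+ n.+1 by lra.
  by rewrite exprS; field; rewrite expf_neq0.
(* [L] bounds both side lengths and is positive even if the rectangle is degenerate. *)
pose L := w + h + 1.
have L0 : 0 < L by rewrite /L /w /h; lra.
have clxy : closed_at x y.
  apply: cl; first by have := hx 0%N; rewrite /= expr0 /w; lra.
  by have := hy 0%N; rewrite /= expr0 /h; lra.
(* Chosen so that [4 ^+ n * (e * (L / 2 ^+ n) ^+ 2)] is [I0 / 2] for every [n], in contradiction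
   with [Iu]. *)
pose e := I0 / (2 * L ^+ 2).
have e0 : 0 < e by rewrite divr_gt0 // mulr_gt0 // exprn_gt0.
have [r r0 hr] := rect_int_small clxy e0.
have [n hn] : exists n, L / 2 ^+ n < r.
  exists (Num.bound (L / r)); rewrite ltr_pdivrMr ?exprn_gt0 // -ltr_pdivrMl //.
  rewrite mulrC.
  have /archi_boundP : 0 <= L / r by rewrite divr_ge0 // ltW.
  move=> /lt_le_trans; apply.
  by rewrite -natrX ler_nat ltnW // ltn_expl.
have p2 : 0 < 2 ^+ n :> R by rewrite exprn_gt0.
have := hr (u n).1 ((u n).1 + w / 2 ^+ n) (u n).2 ((u n).2 + h / 2 ^+ n) (L / 2 ^+ n).
have [ux1 ux2] := ux n; have [uy1 uy2] := uy n; have [hx1 hx2] := hx n; have [hy1 hy2] := hy n.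
have wL : w / 2 ^+ n <= L / 2 ^+ n.
  by rewrite ler_pM2r ?invr_gt0 // /L /w /h; lra.
have hL : h / 2 ^+ n <= L / 2 ^+ n.
  by rewrite ler_pM2r ?invr_gt0 // /L /w /h; lra.
have aa (s t : R) : s + t - s = t by ring.
rewrite !aa => H.
have {}H : `|I n (u n)| <= e * (L / 2 ^+ n) ^+ 2.
  by apply: H => //; move: Ba bB Bc dB ux1 ux2 uy1 uy2; clear; lra.
have := Iu n; rewrite leNgt => /negP; apply.
apply: (@le_lt_trans _ _ (4 ^+ n * (e * (L / 2 ^+ n) ^+ 2))).
  by rewrite ler_wpM2l // exprn_ge0.
have -> : 4 ^+ n * (e * (L / 2 ^+ n) ^+ 2) = e * L ^+ 2 :> R.
  rewrite (_ : 4 ^+ n = 2 ^+ n * 2 ^+ n :> R); last by rewrite -exprMn; congr (_ ^+ _); ring.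
  by field; rewrite expf_neq0.
have -> : e * L ^+ 2 = I0 / 2 by rewrite /e; field; rewrite lt0r_neq0.
lra.
Qed.

End goursat.

(** * Goursat's lemma with finitely many exceptional points *)

Section goursat_removable.
Context {R : realType} (B : R) (P Q : R -> R -> R).
Hypothesis cP : forall y, continuous (P^~ y).
Hypothesis cQ : forall x, continuous (Q x).

Definition bounded_at (x y : R) : Prop := exists M r : R, 0 < r /\
  forall a b, `|a - x| < r -> `|b - y| < r -> `|P a b| <= M /\ `|Q a b| <= M.

Hypothesis bPQ : forall x y, bounded_at x y.

Lemma rect_int_bound (M a b c d : R) : - B < a -> a <= b -> b < B ->
  - B < c -> c <= d -> d < B ->
  (forall x y, a <= x <= b -> c <= y <= d -> `|P x y| <= M /\ `|Q x y| <= M) ->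
  `|rect_int B P Q a b c d| <= 2 * M * ((b - a) + (d - c)).
Proof.
move=> Ba ab bB Bc cd dB hM.
have z0 (A : R) s : A - (0 + 0 * s) = A by ring.
have hP y : c <= y <= d ->
    `|primitive B (P^~ y) b - primitive B (P^~ y) a| <= M * (b - a).
  move=> cyd; have := @primitive_bound R B (P^~ y) 0 0 M a b (@cP y) Ba ab bB.
  rewrite !mul0r addr0 subr0; apply => t ta tb; rewrite z0.
  by have [] := hM t y (introT andP (conj ta tb)) cyd.
have hQ x : a <= x <= b ->
    `|primitive B (Q x) d - primitive B (Q x) c| <= M * (d - c).
  move=> axb; have := @primitive_bound R B (Q x) 0 0 M c d (@cQ x) Bc cd dB.
  rewrite !mul0r addr0 subr0; apply => t tc td; rewrite z0.
  by have [] := hM x t axb (introT andP (conj tc td)).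
have H1 := hP c (introT andP (conj (lexx _) cd)).
have H2 := hP d (introT andP (conj cd (lexx _))).
have H3 := hQ a (introT andP (conj (lexx _) ab)).
have H4 := hQ b (introT andP (conj ab (lexx _))).
rewrite /rect_int; move: H1 H2 H3 H4.
rewrite !ler_norml => /andP[H1 H1'] /andP[H2 H2'] /andP[H3 H3'] /andP[H4 H4'].
by apply/andP; split; move: H1 H1' H2 H2' H3 H3' H4 H4'; clear; lra.
Qed.

(** Each exceptional point is enclosed in a small square, on which the integral
    is at most a constant times the side since [P] and [Q] are bounded there. *)
Lemma goursat_finite (S : seq (R * R)) (a b c d : R) : - B < a -> a <= b -> b < B ->
  - B < c -> c <= d -> d < B ->
  (forall x y, a <= x <= b -> c <= y <= d -> (x, y) \notin S -> closed_at P Q x y) ->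
  rect_int B P Q a b c d = 0.
Proof.
elim: S a b c d => [|[x y] S IH] a b c d Ba ab bB Bc cd dB cl.
  by apply: goursat_closed => // x y ? ?; apply: cl.
(* A subrectangle that misses [(x, y)] is covered by the induction hypothesis. *)
have avoid a1 b1 c1 d1 : a <= a1 -> a1 <= b1 -> b1 <= b -> c <= c1 -> c1 <= d1 ->
    d1 <= d -> [|| b1 < x, x < a1, d1 < y | y < c1] -> rect_int B P Q a1 b1 c1 d1 = 0.
  move=> aa1 a1b1 b1b cc1 c1d1 d1d out; apply: IH => //.
  - exact: lt_le_trans aa1.
  - exact: le_lt_trans b1b _.
  - exact: lt_le_trans cc1.
  - exact: le_lt_trans d1d _.
  move=> s t /andP[as_ sb] /andP[ct td] stS; apply: cl.
  - by rewrite (le_trans aa1) // (le_trans sb).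
  - by rewrite (le_trans cc1) // (le_trans td).
  rewrite inE negb_or stS andbT; apply/eqP => -[sx ty].
  by move: out; rewrite -sx -ty !ltNge as_ sb ct td.
have degx a1 c1 d1 : rect_int B P Q a1 a1 c1 d1 = 0 by rewrite /rect_int; ring.
have degy a1 b1 c1 : rect_int B P Q a1 b1 c1 c1 = 0 by rewrite /rect_int; ring.
have splitx u a1 b1 c1 d1 : rect_int B P Q a1 b1 c1 d1 =
   rect_int B P Q a1 u c1 d1 + rect_int B P Q u b1 c1 d1.
  by rewrite /rect_int; ring.
have splity u a1 b1 c1 d1 : rect_int B P Q a1 b1 c1 d1 =
   rect_int B P Q a1 b1 c1 u + rect_int B P Q a1 b1 u d1.
  by rewrite /rect_int; ring.
have [xa|ax] := ltP x a; first by apply: avoid => //; rewrite xa orbT.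
have [bx|xb] := ltP b x; first by apply: avoid => //; rewrite bx.
have [yc|cy] := ltP y c; first by apply: avoid => //; rewrite yc !orbT.
have [dy|yd] := ltP d y; first by apply: avoid => //; rewrite dy !orbT.
have [M [r [r0 hM]]] := bPQ x y.
have M0 : 0 <= M.
  have [+ _] : `|P x y| <= M /\ `|Q x y| <= M by apply: hM; rewrite subrr normr0.
  exact: le_trans.
have small t : 0 < t -> t < r -> `|rect_int B P Q a b c d| <= 8 * M * t.
  move=> t0 tr.
  (* The square around the point is clipped to the rectangle. Where clipping occurs, the strip cut
     off on that side is degenerate and has integral 0 by [degx] or [degy]. *)
  pose a' := Num.max a (x - t); pose b' := Num.min b (x + t).
  pose c' := Num.max c (y - t); pose d' := Num.min d (y + t).
  have [xt1 xt2] : x - t <= x /\ x <= x + t by split; lra.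
  have [yt1 yt2] : y - t <= y /\ y <= y + t by split; lra.
  have aa' : a <= a' by rewrite le_max lexx.
  have a'x : a' <= x by rewrite ge_max ax.
  have xb' : x <= b' by rewrite le_min xb.
  have b'b : b' <= b by rewrite ge_min lexx.
  have cc' : c <= c' by rewrite le_max lexx.
  have c'y : c' <= y by rewrite ge_max cy.
  have yd' : y <= d' by rewrite le_min yd.
  have d'd : d' <= d by rewrite ge_min lexx.
  have a'b := le_trans a'x xb; have ab' := le_trans ax xb'.
  have a'b' := le_trans a'x xb'; have c'd' := le_trans c'y yd'.
  have c'd := le_trans c'y yd; have cd' := le_trans cy yd'.
  have R1 : rect_int B P Q a a' c d = 0.
    have [ta|ta] := leP (x - t) a.
      by rewrite /a' max_l.
    apply: avoid => //; rewrite /a' max_r; [|exact: ltW].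
    by rewrite (_ : x - t < x) //; lra.
  have R2 : rect_int B P Q b' b c d = 0.
    have [ta|ta] := leP b (x + t).
      by rewrite /b' min_l.
    apply: avoid => //; rewrite /b' min_r; [|exact: ltW].
    by rewrite (_ : x < x + t) ?orbT //; lra.
  have R3 : rect_int B P Q a' b' c c' = 0.
    have [ta|ta] := leP (y - t) c.
      by rewrite /c' max_l.
    apply: avoid => //; rewrite /c' max_r; [|exact: ltW].
    by rewrite (_ : y - t < y) ?orbT //; lra.
  have R4 : rect_int B P Q a' b' d' d = 0.
    have [ta|ta] := leP d (y + t).
      by rewrite /d' min_l.
    apply: avoid => //; rewrite /d' min_r; [|exact: ltW].
    by rewrite (_ : y < y + t) ?orbT //; lra.
  rewrite (splitx a') (splitx b' a') R1 R2 (splity c' a' b' c d) (splity d' a' b' c' d) R3 R4.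
  rewrite add0r addr0 add0r addr0.
  have xt' : x - t <= a' by rewrite le_max lexx orbT.
  have xt'' : b' <= x + t by rewrite ge_min lexx orbT.
  have yt' : y - t <= c' by rewrite le_max lexx orbT.
  have yt'' : d' <= y + t by rewrite ge_min lexx orbT.
  have H : 2 * M * ((b' - a') + (d' - c')) <= 8 * M * t.
    rewrite (_ : 8 * M * t = 2 * M * (4 * t)); last ring.
    rewrite ler_wpM2l ?mulr_ge0 //.
    by move: xt' xt'' yt' yt''; clear; lra.
  apply: le_trans H; apply: rect_int_bound => //.
  - exact: lt_le_trans aa'.
  - exact: le_lt_trans b'b _.
  - exact: lt_le_trans cc'.
  - exact: le_lt_trans d'd _.
  move=> u v /andP[u1 u2] /andP[v1 v2]; apply: hM; rewrite ltr_norml.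
    by apply/andP; split; move: u1 u2 xt' xt'' tr; clear; lra.
  by apply/andP; split; move: v1 v2 yt' yt'' tr; clear; lra.
apply/eqP/negP => /negP; rewrite -normr_gt0; set I0 := `|rect_int B P Q a b c d| in small * => I00.
(* This gives [16 * M * t + t <= I0], so the bound [8 * M * t] is below [I0]; the summand 1 keeps
   the denominator positive when [M = 0]. *)
pose t := Num.min (r / 2) (I0 / (16 * M + 1)).
have M1 : 0 < 16 * M + 1 by lra.
have t0 : 0 < t by rewrite lt_min !divr_gt0.
have tr : t < r by rewrite gt_min; apply/orP; left; lra.
have tI : t * (16 * M + 1) <= I0 by rewrite -ler_pdivlMr // ge_min lexx orbT.
have := small _ t0 tr.
have Mt : 0 <= M * t by rewrite mulr_ge0 // ltW.
nra.
Qed.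

End goursat_removable.

(** * Entire functions of polynomial growth *)

Section complex_derivative.
Context {R : realType}.
Local Notation C := (R[i]).
Implicit Types (s t w x : C) (h g : C^o -> C^o).

Lemma normrE_normc t : `|t| = (normc t)%:C%C.
Proof. by []. Qed.

Lemma normc_ge0 t : 0 <= normc t.
Proof. by case: t => a b; exact: sqrtr_ge0. Qed.

Lemma ler_Re_normc t : `|complex.Re t| <= normc t.
Proof. by case: t => a b /=; rewrite -sqrtr_sqr ler_wsqrtr // lerDl sqr_ge0. Qed.

Lemma ler_Im_normc t : `|complex.Im t| <= normc t.
Proof. by case: t => a b /=; rewrite -sqrtr_sqr ler_wsqrtr // lerDr sqr_ge0. Qed.

Lemma normc_le_ReIm t : normc t <= `|complex.Re t| + `|complex.Im t|.
Proof.
case: t => a b /=; rewrite -[leRHS]ger0_norm ?addr_ge0 // -sqrtr_sqr.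
rewrite ler_wsqrtr // sqrrD !real_normK ?num_real // -addrA.
by rewrite lerD2l lerDr mulrn_wge0 // mulr_ge0.
Qed.

Lemma normc_lt t (e : R) : (`|t| < e%:C%C) = (normc t < e).
Proof. by rewrite normrE_normc ltcR. Qed.

(** The norm of [C] and the radii in its filters take values in [C] itself. This lemma and the next
    one pass to real radii, using that a positive complex number has imaginary part 0. *)
Lemma continuous_normcP h s : {for s, continuous h} <->
  forall e : R, 0 < e -> exists2 r, 0 < r &
    forall t, normc t < r -> normc (h (s + t) - h s) < e.
Proof.
split.
  move=> /cvgrPdist_lt H e e0.
  have /H/nbhs_normP[[r ri]] : 0 < e%:C%C :> C by rewrite ltcR.
  rewrite /= ltcE /= => /andP[/eqP ri0 r0] hr; exists r => // t tr.
  rewrite -normc_lt distrC; apply: hr => /=.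
  by rewrite opprD addrA subrr sub0r normrN normrE_normc ltcE /= ri0 eqxx.
move=> H; apply/(@cvgrPdist_lt _ C^o C^o (nbhs (s : C^o))) => -[e ei]; rewrite ltcE /= => /andP[/eqP ei0 e0].
have [r r0 hr] := H _ e0.
apply/(@nbhs_normP _ C^o); exists r%:C%C => /=; first by rewrite ltcR.
move=> t /= tr; have := hr (t - s).
rewrite (addrC s) subrK distrC normrE_normc ltcE /= ei0 eqxx; apply.
by rewrite -normc_lt distrC.
Qed.

Lemma derivable_normcP h s : derivable h s 1 <-> exists l : C,
  forall e : R, 0 < e -> exists2 r, 0 < r &
    forall t, normc t < r -> normc (h (s + t) - h s - l * t) <= e * normc t.
Proof.
split.
  move=> /cvg_ex[l /cvgrPdist_lt H]; exists l => e e0.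
  have := H e%:C%C; rewrite ltcR => /(_ e0).
  rewrite near_withinE => /nbhs_normP[[r ri]].
  rewrite /= ltcE /= => /andP[/eqP ri0 r0] hr; exists r => // t tr.
  have [->|t0] := eqVneq t 0.
    by rewrite addr0 subrr mulr0 subrr normc0 mulr0.
  have := hr t; rewrite /= sub0r normrN normrE_normc ltcE /= ri0 eqxx tr.
  move=> /(_ isT t0); rewrite normc_lt => /ltW.
  rewrite /GRing.scale /= mulr1 (addrC t) => /(ler_wpM2r (normc_ge0 t)).
  rewrite -normcM mulrBl mulrAC mulVf // mul1r.
  by rewrite -normcN opprB.
move=> [l H]; apply/cvg_ex; exists l; apply/cvgrPdist_lt => -[e ei].
rewrite ltcE /= => /andP[/eqP ei0 e0].
have [|r r0 hr] := H (e / 2); first by rewrite divr_gt0.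
rewrite near_withinE; apply/(@nbhs_normP _ C^o); exists r%:C%C => /=; first by rewrite ltcR.
move=> t /=; rewrite sub0r normrN normc_lt => /hr {}hr t0.
have nt0 : 0 < normc t.
  rewrite lt_def normc_ge0 andbT; apply: contra t0 => /eqP/eq0_normc ->.
  by rewrite eqxx.
rewrite /GRing.scale /= mulr1 (addrC t) normrE_normc ltcE /= ei0 eqxx /=.
rewrite -(ltr_pM2r nt0) -normcM mulrBl mulrAC mulVf // mul1r.
rewrite -normcN opprB; apply: le_lt_trans hr _.
by rewrite ltr_pM2r // ltr_pdivrMr // ltr_pMr // ltr1n.
Qed.

Lemma derivable_continuous_normc h s : derivable h s 1 -> {for s, continuous h}.
Proof. by move=> /derivable1_diffP; exact: differentiable_continuous. Qed.

Definition divdiff h x s : C :=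
  if s == x then 'D_1 h x else (h s - h x) / (s - x).

Lemma divdiffE h x s : h s = h x + (s - x) * divdiff h x s.
Proof.
rewrite /divdiff; have [->|sx] := eqVneq s x; first by rewrite subrr mul0r addr0.
by rewrite mulrCA mulfV ?subr_eq0 // mulr1 addrC subrK.
Qed.

Lemma near_neq s x : s != x -> \forall t \near (s : C^o), t != x.
Proof.
move=> sx; apply/(@nbhs_normP _ C^o); exists `|s - x| => /=; first by rewrite normr_gt0 subr_eq0.
by move=> t /= tx; apply: contraTneq tx => ->; rewrite ltxx.
Qed.

Lemma divdiff_near h x s : s != x ->
  \forall t \near (s : C^o), (h t - h x) * (t - x)^-1 = divdiff h x t.
Proof.
move=> /near_neq; apply: filterS => t /negbTE tx.
by rewrite /divdiff tx.
Qed.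

Lemma divdiff_derivable h x s : s != x -> derivable h s 1 ->
  derivable (divdiff h x : C^o -> C^o) s 1.
Proof.
move=> sx dh; apply: near_eq_derivable (divdiff_near h sx) _.
apply: (@derivableM C C^o (fun t => h t - h x) (fun t => (t - x)^-1)).
  exact: (@derivableB C C^o C^o h (cst (h x)) s 1 dh (derivable_cst _ _ _)).
apply: (@derivableV C C^o (fun t => t - x)); first by rewrite subr_eq0.
have := @derivableB C C^o C^o (idfun : C^o -> C^o) (cst x) s 1.
by apply; [exact: derivable_id|exact: derivable_cst].
Qed.

(** At [s = x] this is the definition of the derivative. Derivability is obtained only for [s != x],
    so [x] becomes an exceptional point of the divided difference. *)
Lemma divdiff_continuous h x s : (forall t, {for t, continuous h}) ->
  derivable h x 1 -> {for s, continuous (divdiff h x : C^o -> C^o)}.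
Proof.
move=> ch dh; have [->|sx] := eqVneq s x.
  apply/continuous_normcP => e e0.
  have /cvgrPdist_lt H : derivable h x 1 := dh.
  have := H e%:C%C; rewrite ltcR => /(_ e0).
  rewrite near_withinE => /nbhs_normP[[r ri]].
  rewrite /= ltcE /= => /andP[/eqP ri0 r0] hr; exists r => // t tr.
  rewrite /divdiff eqxx; have [/eqP|xtx] := eqVneq (x + t) x.
    by rewrite subrr normc0.
  have t0 : t != 0 by apply: contraNneq xtx => ->; rewrite addr0.
  have := hr t; rewrite /= sub0r normrN normrE_normc ltcE /= ri0 eqxx tr.
  move=> /(_ isT t0); rewrite normc_lt.
  rewrite /GRing.scale /= mulr1 (addrC t) => H1.
  by rewrite -normcN opprB (addrC x t) addrK (addrC t) mulrC.
rewrite /prop_for /continuous_at; have /= <- := nbhs_singleton (divdiff_near h sx).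
apply: cvg_trans (near_eq_cvg (divdiff_near h sx)) _.
apply: (@cvgM C C^o (nbhs (s : C^o)) _ (fun t => h t - h x) (fun t => (t - x)^-1)).
  by apply: (@cvgB C C^o); [exact: ch|exact: cvg_cst].
apply: (@cvgV C C^o); first by rewrite subr_eq0.
by apply: (@cvgB C C^o); [exact: cvg_id|exact: cvg_cst].
Qed.

End complex_derivative.

(** * Vanishing by decay at infinity, and polynomial growth *)

Section decay.
Context {R : realType}.
Local Notation C := (R[i]).
Implicit Types (s t w x : C) (h g : C^o -> C^o).

Lemma normc_real (a : R) : normc (a +i* 0)%C = `|a|.
Proof. by rewrite /= expr0n addr0 sqrtr_sqr. Qed.

Lemma normc_imag (a : R) : normc (0 +i* a)%C = `|a|.
Proof. by rewrite /= expr0n add0r sqrtr_sqr. Qed.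

Lemma normc_complex_le (a b : R) : normc (a +i* b)%C <= `|a| + `|b|.
Proof. exact: normc_le_ReIm. Qed.

Lemma ReB s t : complex.Re (s - t) = complex.Re s - complex.Re t.
Proof. by case: s t => [a b] [c d]. Qed.

Lemma ImB s t : complex.Im (s - t) = complex.Im s - complex.Im t.
Proof. by case: s t => [a b] [c d]. Qed.

Lemma continuous_Im_horizontal h (y : R) : (forall s, {for s, continuous h}) ->
  continuous (fun x : R => complex.Im (h (x +i* y)%C)).
Proof.
move=> ch x; apply/cvgrPdist_lt => e e0.
have [r r0 hr] := (continuous_normcP h (x +i* y)%C).1 (ch _) e e0.
apply/nbhs_normP; exists r => //= t xt.
have := hr (Complex (t - x) 0); rewrite normc_real distrC => /(_ xt).
rewrite [X in h X](_ : _ = (t +i* y)%C); last first.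
  by apply/eqP; rewrite eq_complex /= addr0 addrC subrK !eqxx.
by rewrite distrC -ImB; apply: le_lt_trans; exact: ler_Im_normc.
Qed.

Lemma continuous_Re_vertical h (x : R) : (forall s, {for s, continuous h}) ->
  continuous (fun y : R => complex.Re (h (x +i* y)%C)).
Proof.
move=> ch y; apply/cvgrPdist_lt => e e0.
have [r r0 hr] := (continuous_normcP h (x +i* y)%C).1 (ch _) e e0.
apply/nbhs_normP; exists r => //= t yt.
have := hr (Complex 0 (t - y)); rewrite normc_imag distrC => /(_ yt).
rewrite [X in h X](_ : _ = (x +i* t)%C); last first.
  by apply/eqP; rewrite eq_complex /= addr0 (addrC y) subrK !eqxx.
by rewrite distrC -ReB; apply: le_lt_trans; exact: ler_Re_normc.
Qed.

(** Im h dx + Re h dy is the imaginary part of h(s) ds, and the Cauchy-Riemann equations make it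
    closed. *)
Lemma derivable_closed_at h (x y : R) : derivable h (x +i* y)%C 1 ->
  closed_at (fun a b => complex.Im (h (a +i* b)%C))
            (fun a b => complex.Re (h (a +i* b)%C)) x y.
Proof.
move=> /derivable_normcP[[l1 l2] hl]; exists l2, l1, (- l2) => e e0.
have [r r0 hr] := hl e e0; exists (r / 2); first by rewrite divr_gt0.
move=> a b ar br.
have ab : normc (a +i* b)%C < r.
  by apply: le_lt_trans (normc_complex_le _ _) _; move: ar br; clear; lra.
have abe : e * normc (a +i* b)%C <= e * (`|a| + `|b|).
  by rewrite ler_pM2l // normc_complex_le.
have := le_trans (hr _ ab) abe.
rewrite [X in h X](_ : _ = Complex (x + a) (y + b)) // => H.
split.
  apply: le_trans H; apply: le_trans (ler_Im_normc _).
  by rewrite !ImB /= (addrC (l2 * a)).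
apply: le_trans H; apply: le_trans (ler_Re_normc _).
by rewrite !ReB /= mulNr.
Qed.

Lemma continuous_bounded_at h (x y : R) : {for (x +i* y)%C, continuous h} ->
  bounded_at (fun a b => complex.Im (h (a +i* b)%C))
             (fun a b => complex.Re (h (a +i* b)%C)) x y.
Proof.
move=> /continuous_normcP/(_ 1 ltr01)[r r0 hr].
exists (normc (h (x +i* y)%C) + 1), (r / 2); split; first by rewrite divr_gt0.
move=> a b ax b_y.
have : normc (Complex (a - x) (b - y)) < r.
  by apply: le_lt_trans (normc_complex_le _ _) _; move: ax b_y; clear; lra.
move=> /hr; rewrite [X in h X](_ : _ = (a +i* b)%C); last first.
  by apply/eqP; rewrite eq_complex /= !(addrC _ (_ - _)) !subrK !eqxx.
move=> H; have {}H : normc (h (a +i* b)%C) <= normc (h (x +i* y)%C) + 1.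
  rewrite -[h (a +i* b)%C](subrK (h (x +i* y)%C)) addrC.
  by apply: le_trans (le_normcD _ _) _; rewrite lerD2l ltW.
by split; apply: le_trans H; [exact: ler_Im_normc|exact: ler_Re_normc].
Qed.

(** Around a large square centred at [w], the imaginary part of the integral of
    [(h s / h w - 1) / (s - w)] would be negative on each side. *)
Lemma decay_eq0 h (S : seq C) w : (forall s, {for s, continuous h}) ->
  (forall s, s \notin S -> derivable h s 1) -> w \notin S ->
  (forall e : R, 0 < e -> exists M, forall s, M <= normc s -> normc (h s) <= e) ->
  h w = 0.
Proof.
move=> ch dh wS decay; apply/eqP/negP => /negP hw0.
(* [G] vanishes at [w] and is close to -1 where [h] is small. So the divided difference [F] of [G]
   at [w] behaves like - 1 / (s - w) on a large square. *)
pose G : C^o -> C^o := (h w)^-1 *: h - cst 1.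
have GE s : G s = (h w)^-1 * h s - 1 by [].
have Gw : G w = 0 by rewrite GE mulVf ?subrr //; apply/negP.
have cG s : {for s, continuous G}.
  have H : (h w)^-1 *: h @ (s : C^o) --> (h w)^-1 *: h s.
    by apply: (@cvgZ C C^o C^o (nbhs (s : C^o)) _ (cst (h w)^-1) h); [exact: cvg_cst|exact: ch].
  by apply: (@cvgB C C^o C^o (nbhs (s : C^o)) _ ((h w)^-1 *: h) (cst 1) _ _ H (cvg_cst _)).
have dG s : s \notin S -> derivable G s 1.
  by move=> sS; apply: derivableB; [exact/derivableZ/dh|exact: derivable_cst].
pose F : C^o -> C^o := divdiff G w.
have cF s : {for s, continuous F}.
  by apply: divdiff_continuous => //; exact: dG.
have dF s : s \notin w :: S -> derivable F s 1.
  by rewrite inE negb_or => /andP[sw sS]; apply: divdiff_derivable => //; exact: dG.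
have [|M hM] := decay (normc (h w) / 4).
  rewrite divr_gt0 // lt_def normc_ge0 andbT; apply: contra hw0 => /eqP/eq0_normc ->.
  by rewrite eqxx.
pose w1 := complex.Re w; pose w2 := complex.Im w.
have wE : w = (w1 +i* w2)%C by rewrite /w1 /w2; case: (w).
(* Every point of the boundary of the square with centre [w] and half-side [L] has modulus at least
   [M], where [hM] applies. *)
pose L := `|M| + `|w1| + `|w2| + 1.
have L0 : 0 < L by rewrite /L !ltr_wpDl // addr_ge0 // ?addr_ge0.
pose B := L + `|w1| + `|w2| + 1.
have w1B := ler_norm w1; have w2B := ler_norm w2.
have w1B' := lerNnormlW (lexx `|w1|); have w2B' := lerNnormlW (lexx `|w2|).
(* These are the parts of (u + i v) / (a + i b), where u + i v = h s / h w - 1. Since |v| < - u, the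
   term with [u] and the coordinate equal to [L] or [- L] decides the sign on each side. *)
have FE a b : `|a| = L \/ `|b| = L -> exists u v D : R,
   [/\ `|v| < - u, 0 < D, complex.Im (F (Complex (w1 + a) (w2 + b)))
    = (v * a - u * b) / D &
    complex.Re (F (Complex (w1 + a) (w2 + b))) = (u * a + v * b) / D].
  move=> abL; set s := Complex _ _.
  have swE : s - w = Complex a b.
    by rewrite [w]wE; apply/eqP; rewrite eq_complex /= !(addrC _ a) !(addrC _ b) !addrK !eqxx.
  have D0 : 0 < a ^+ 2 + b ^+ 2.
    have L2 : 0 < L ^+ 2 by rewrite exprn_gt0.
    rewrite -(real_normK (num_real a)) -(real_normK (num_real b)).
    by case: abL => ->; [rewrite ltr_pwDl|rewrite ltr_wpDl] => //; rewrite exprn_ge0.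
  have sw : s != w.
    rewrite -subr_eq0 swE eq_complex /=; apply: contraL D0 => /andP[/eqP-> /eqP->].
    by rewrite expr0n /= addr0 ltxx.
  have Ms : M <= normc s.
    apply: le_trans (ler_norm _) _.
    case: abL => abL.
      apply: le_trans (ler_Re_normc s); rewrite /=.
      have := lerB_dist a (- w1); rewrite opprK (addrC a) normrN abL /L => H.
      by apply: le_trans H; move: (normr_ge0 w2); clear; lra.
    apply: le_trans (ler_Im_normc s); rewrite /=.
    have := lerB_dist b (- w2); rewrite opprK (addrC b) normrN abL /L => H.
    by apply: le_trans H; move: (normr_ge0 w1); clear; lra.
  pose q := (h w)^-1 * h s.
  have qle : normc q <= 1 / 4.
    rewrite /q normcM normcV.
    have hwp : 0 < normc (h w).
      rewrite lt_def normc_ge0 andbT; apply: contra hw0 => /eqP/eq0_normc ->.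
      by rewrite eqxx.
    by rewrite mulrC ler_pdivrMr // mul1r mulrC hM.
  exists (complex.Re q - 1), (complex.Im q), (a ^+ 2 + b ^+ 2); split => //.
  - have := le_trans (ler_Im_normc q) qle.
    have := le_trans (ler_norm _) (le_trans (ler_Re_normc q) qle).
    by clear; lra.
  - rewrite /F /divdiff (negbTE sw) Gw subr0 GE -/q swE.
    by case: (q) => q1 q2 /=; field; rewrite lt0r_neq0.
  - rewrite /F /divdiff (negbTE sw) Gw subr0 GE -/q swE.
    by case: (q) => q1 q2 /=; field; rewrite lt0r_neq0.
have uv (u v c : R) : `|v| < - u -> - L <= c <= L ->
    v * c < - u * L /\ - (v * c) < - u * L.
  move=> vu cL; have : `|v * c| < - u * L.
    have cL' : `|c| <= L by rewrite ler_norml.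
    rewrite normrM; apply: le_lt_trans (_ : `|v| * L < _).
      by rewrite ler_wpM2l.
    by rewrite ltr_pM2r.
  by rewrite ltr_norml => /andP[? ?]; split; lra.
have B1 : - B < w1 - L by move: (normr_ge0 w2) w1B'; rewrite /B; clear; lra.
have B2 : w1 + L < B by move: (normr_ge0 w2) w1B; rewrite /B; clear; lra.
have B3 : - B < w2 - L by move: (normr_ge0 w1) w2B'; rewrite /B; clear; lra.
have B4 : w2 + L < B by move: (normr_ge0 w1) w2B; rewrite /B; clear; lra.
have LL1 : w1 - L < w1 + L by move: L0; clear; lra.
have LL2 : w2 - L < w2 + L by move: L0; clear; lra.
have := @goursat_finite R B (fun a b => complex.Im (F (a +i* b)%C))
  (fun a b => complex.Re (F (a +i* b)%C))
  (fun y => @continuous_Im_horizontal F y cF) (fun a => @continuous_Re_vertical F a cF)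
  (fun a b => @continuous_bounded_at F a b (cF _))
  [seq (complex.Re s, complex.Im s) | s <- w :: S]
  (w1 - L) (w1 + L) (w2 - L) (w2 + L) B1 (ltW LL1) B2 B3 (ltW LL2) B4.
have cl : forall x y : R, w1 - L <= x <= w1 + L -> w2 - L <= y <= w2 + L ->
    (x, y) \notin [seq (complex.Re s, complex.Im s) | s <- w :: S] ->
    closed_at (fun a b => complex.Im (F (a +i* b)%C))
      (fun a b => complex.Re (F (a +i* b)%C)) x y.
  move=> x y _ _ xyS; apply/derivable_closed_at/dF.
  by apply: contra xyS => xyS; apply/mapP; exists (x +i* y)%C.
move=> /(_ cl); rewrite /rect_int.
have nL : `|L| = L by rewrite gtr0_norm.
have itv (c t : R) : c - L <= t -> t <= c + L -> - L <= t - c <= L.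
  by move=> ? ?; apply/andP; split; lra.
have H1 : primitive B (fun x : R => complex.Im (F (x +i* (w2 - L)%R)%C)) (w1 + L)
    < primitive B (fun x : R => complex.Im (F (x +i* (w2 - L)%R)%C)) (w1 - L).
  apply: primitive_lt0 => //; first exact: continuous_Im_horizontal.
  move=> t t1 t2.
  have [|u [v [D [vu D0 + _]]]] := FE (t - w1) (- L); first by right; rewrite normrN.
  rewrite (addrC w1) subrK => ->; rewrite pmulr_llt0 ?invr_gt0 //.
  by have [] := uv _ _ _ vu (itv _ _ t1 t2); clear; lra.
have H2 : primitive B (fun x : R => complex.Im (F (x +i* (w2 + L)%R)%C)) (w1 - L)
    < primitive B (fun x : R => complex.Im (F (x +i* (w2 + L)%R)%C)) (w1 + L).
  apply: primitive_gt0 => //; first exact: continuous_Im_horizontal.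
  move=> t t1 t2.
  have [|u [v [D [vu D0 + _]]]] := FE (t - w1) L; first by right.
  rewrite (addrC w1) subrK => ->; rewrite pmulr_lgt0 ?invr_gt0 //.
  by have [] := uv _ _ _ vu (itv _ _ t1 t2); clear; lra.
have H3 : primitive B (fun y => complex.Re (F ((w1 + L)%R +i* y)%C)) (w2 + L)
    < primitive B (fun y => complex.Re (F ((w1 + L)%R +i* y)%C)) (w2 - L).
  apply: primitive_lt0 => //; first exact: continuous_Re_vertical.
  move=> t t1 t2.
  have [|u [v [D [vu D0 _ +]]]] := FE L (t - w2); first by left.
  rewrite (addrC w2) subrK => ->; rewrite pmulr_llt0 ?invr_gt0 //.
  by have [] := uv _ _ _ vu (itv _ _ t1 t2); clear; lra.
have H4 : primitive B (fun y => complex.Re (F ((w1 - L)%R +i* y)%C)) (w2 - L)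
    < primitive B (fun y => complex.Re (F ((w1 - L)%R +i* y)%C)) (w2 + L).
  apply: primitive_gt0 => //; first exact: continuous_Re_vertical.
  move=> t t1 t2.
  have [|u [v [D [vu D0 _ +]]]] := FE (- L) (t - w2); first by left; rewrite normrN.
  rewrite (addrC w2) subrK => ->; rewrite pmulr_lgt0 ?invr_gt0 //.
  by have [] := uv _ _ _ vu (itv _ _ t1 t2); clear; lra.
have sum0 (x1 x2 y1 y2 z1 z2 t1 t2 : R) : x2 < x1 -> y1 < y2 -> z2 < z1 -> t1 < t2 ->
  (x2 - x1) + (z2 - z1) - (y2 - y1) - (t2 - t1) = 0 -> False by clear; lra.
exact: sum0.
Qed.

(** Division by s - x gains one power of |s|, because |s| <= 2 |s - x| far out. The factor [normc s]
    stays on the left so that [e = 0] is included, where it expresses decay. *)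
Lemma divdiff_growth h x (e : nat) (A M : R) :
  (forall s, M <= normc s -> normc (h s) <= A * normc s ^+ e) ->
  exists A' M' : R, 0 < M' /\ forall s, M' <= normc s ->
    normc (divdiff h x s) * normc s <= A' * normc s ^+ e.
Proof.
move=> hM; exists (2 * (A + normc (h x))), (`|M| + 2 * normc x + 1).
have x0 := normc_ge0 x; have hx0 := normc_ge0 (h x).
split=> [|s Ms]; first by have := normr_ge0 M; lra.
have s1 : 1 <= normc s by have := normr_ge0 M; lra.
have s2 : 2 * normc x + 1 <= normc s by have := normr_ge0 M; lra.
have sM : M <= normc s by have := ler_norm M; lra.
have sx : normc s <= normc (s - x) + normc x.
  by rewrite -{1}(subrK x s) le_normcD.
have sx2 : normc s <= 2 * normc (s - x) by lra.
have sx0 : s != x by apply: contraTneq s2 => ->; rewrite -ltNge; lra.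
have E : normc (h s - h x) = normc (s - x) * normc (divdiff h x s).
  by rewrite -normcM {1}(divdiffE h x s) addrC addKr.
have e1 : 1 <= normc s ^+ e by rewrite exprn_ege1.
have H : normc (h s - h x) <= (A + normc (h x)) * normc s ^+ e.
  apply: le_trans (le_normcD _ _) _; rewrite normcN mulrDl lerD ?hM //.
  by rewrite ler_peMr.
have d0 := normc_ge0 (divdiff h x s).
rewrite -mulrA; apply: le_trans (_ : 2 * normc (h s - h x) <= _).
  by rewrite E mulrA mulrC ler_wpM2r.
by rewrite ler_wpM2l.
Qed.

Lemma fresh_complex (S : seq C) : exists x, x \notin S.
Proof.
pose a : R := 1 + \sum_(s <- S) normc s.
exists a%:C%C; apply/negP => aS.
have a0 : 0 <= \sum_(s <- S) normc s by apply: sumr_ge0 => s _; exact: normc_ge0.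
have : normc a%:C%C <= \sum_(s <- S) normc s.
  rewrite (big_rem _ aS) /= lerDl; apply: sumr_ge0 => s _; exact: normc_ge0.
rewrite [normc _]normc_real ger0_norm /a; last by rewrite addr_ge0.
by lra.
Qed.

(** Each divided difference lowers the exponent by one; for [e = 0] it decays and vanishes by
    [decay_eq0], so [h] is constant. The conclusion is restricted to points off [S] because
    [decay_eq0] needs derivability at the point where it evaluates. *)
Lemma polynomial_growth h (S : seq C) (e : nat) (A M : R) :
  (forall s, {for s, continuous h}) ->
  (forall s, s \notin S -> derivable h s 1) ->
  (forall s, M <= normc s -> normc (h s) <= A * normc s ^+ e) ->
  exists2 p : {poly C}, (size p <= e.+1)%N & forall s, s \notin S -> h s = p.[s].
Proof.
elim: e h S A M => [|e IH] h S A M ch dh hM; have [x xS] := fresh_complex S;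
  have cF s : {for s, continuous (divdiff h x : C^o -> C^o)} :=
    @divdiff_continuous R h x s ch (dh x xS);
  have dF s : s \notin x :: S -> derivable (divdiff h x : C^o -> C^o) s 1
    by [rewrite inE negb_or => /andP[sx sS]; apply: divdiff_derivable => //; exact: dh];
  have [A' [M' [M'0 hA]]] := divdiff_growth x hM.
  exists (h x)%:P; first by rewrite size_polyC; case: eqP.
  move=> s sS; rewrite hornerC [LHS](divdiffE h x).
  have [->|sx] := eqVneq s x; first by rewrite subrr mul0r addr0.
  rewrite (decay_eq0 cF dF) ?mulr0 ?addr0 // ?inE ?negb_or ?sx // => eps eps0.
  (* For [e = 0], [divdiff_growth] bounds the divided difference at [t] by [A' / normc t], which is
     at most [eps] from here on. *)
  exists (Num.max M' (`|A'| / eps)) => t; rewrite ge_max => /andP[M't At].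
  have t0 : 0 < normc t by exact: lt_le_trans M't.
  rewrite -(ler_pM2r t0); apply: le_trans (hA _ M't) _; rewrite expr0 mulr1.
  by apply: le_trans (ler_norm _) _; rewrite mulrC -ler_pdivrMr.
have [|p sp hp] := IH _ (x :: S) A' M' cF dF.
  move=> s M's; have s0 : 0 < normc s by exact: lt_le_trans M's.
  by rewrite -(ler_pM2r s0) -mulrA -exprSr hA.
exists ((h x)%:P + ('X - x%:P) * p).
  apply: leq_trans (size_polyD _ _) _; rewrite geq_max.
  rewrite (leq_trans (size_polyC_leq1 _)) //=.
  by apply: leq_trans (size_polyMleq _ _) _; rewrite size_XsubC.
move=> s sS; rewrite [LHS](divdiffE h x) !hornerE.
have [->|sx] := eqVneq s x; first by rewrite subrr !mul0r.
by rewrite hp // inE negb_or sx.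
Qed.

End decay.

(** * Linear spans, characters and polynomials *)

Section spans.
Context {K : pzRingType} {V : lmodType K}.
Implicit Types (S : set V) (u v : V).

(** Lists of pairs, unlike families indexed by ['I_N], can be concatenated and allow induction. *)
Lemma lspanP S v : lspan S v <-> exists2 s : seq (K * V),
  (forall p, p \in s -> S p.2) & v = \sum_(p <- s) p.1 *: p.2.
Proof.
split=> [[N [c [s [hs ->]]]]|[s hs ->]].
  exists [seq (c i, s i) | i <- index_enum 'I_N]; last by rewrite big_map.
  by move=> p /mapP[i _ ->]; exact: hs.
exists (size s), (fun i => (tnth (in_tuple s) i).1), (fun i => (tnth (in_tuple s) i).2).
split=> [i|]; first by apply: hs; exact: mem_tnth.
by rewrite big_tnth.
Qed.

Lemma lspan_sub S v : S v -> lspan S v.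
Proof.
move=> Sv; apply/lspanP; exists [:: (1, v)]; last by rewrite big_seq1 scale1r.
by move=> p; rewrite inE => /eqP ->.
Qed.

Lemma lspan0 S : lspan S 0.
Proof. by apply/lspanP; exists [::]; rewrite ?big_nil. Qed.

Lemma lspanD S u v : lspan S u -> lspan S v -> lspan S (u + v).
Proof.
move=> /lspanP[s hs ->] /lspanP[t ht ->]; apply/lspanP; exists (s ++ t).
  by move=> p; rewrite mem_cat => /orP[/hs|/ht].
by rewrite big_cat.
Qed.

Lemma lspanZ S c v : lspan S v -> lspan S (c *: v).
Proof.
move=> /lspanP[s hs ->]; apply/lspanP; exists [seq (c * p.1, p.2) | p <- s].
  by move=> p /mapP[q /hs ? ->].
by rewrite big_map scaler_sumr; apply: eq_bigr => p _; rewrite scalerA.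
Qed.

Lemma lspan_sum (I : Type) (r : seq I) (P : pred I) S (F : I -> V) :
  (forall i, P i -> lspan S (F i)) -> lspan S (\sum_(i <- r | P i) F i).
Proof.
move=> hF; elim/big_ind : _ => //; first exact: lspan0.
by move=> x y; exact: lspanD.
Qed.

Lemma lspan_ind S (P : V -> Prop) : P 0 ->
  (forall c u v, S u -> P v -> P (c *: u + v)) -> forall v, lspan S v -> P v.
Proof.
move=> P0 PD v /lspanP[s + ->]; elim: s => [_|p s IH hs]; first by rewrite big_nil.
rewrite big_cons; apply: PD; first by apply: hs; rewrite inE eqxx.
by apply: IH => q qs; apply: hs; rewrite inE qs orbT.
Qed.

Lemma lspan_min S (S' : set V) v : (forall u, S u -> lspan S' u) ->
  lspan S v -> lspan S' v.
Proof.
move=> SS'; apply: lspan_ind => [|c u w /SS' Su Sw]; first exact: lspan0.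
by apply: lspanD => //; exact: lspanZ.
Qed.

End spans.

Section characters.
Context {K : idomainType} {E : eqType} {G Z : Type}.
Variables (act : G -> Z -> Z) (chi : E -> G -> K).

(** Applying [t] and subtracting [chi e t] times the relation removes the term of
    [e], as in the proof of Dedekind's lemma. *)
Lemma characters_independent (s : seq E) (u : E -> Z -> K) : uniq s ->
  (forall e e', e != e' -> exists t, chi e t != chi e' t) ->
  (forall e t z, e \in s -> u e (act t z) = chi e t * u e z) ->
  (forall z, \sum_(e <- s) u e z = 0) -> forall e z, e \in s -> u e z = 0.
Proof.
elim: s u => [//|e0 s IH] u /= /andP[e0s us] sep hu sum0.
have us0 e z : e \in s -> u e z = 0.
  move=> es; have e0e : e != e0 by apply: contraNneq e0s => <-.
  have [t ht] := sep _ _ e0e.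
  suff : (chi e t - chi e0 t) * u e z = 0.
    by move=> /eqP; rewrite mulf_eq0 subr_eq0 (negbTE ht) => /eqP.
  apply: (IH (fun e z => (chi e t - chi e0 t) * u e z)) => // [e' t' z' es'|z'].
    by rewrite hu ?inE ?es' ?orbT // mulrCA.
  have := sum0 (act t z'); rewrite big_cons hu ?inE ?eqxx //.
  have := sum0 z'; rewrite big_cons => /eqP; rewrite addr_eq0 => /eqP ->.
  rewrite mulrN mulr_sumr addrC => H; rewrite -[RHS]H.
  rewrite -sumrB big_seq [RHS]big_seq; apply: eq_bigr => e' es'.
  by rewrite hu ?inE ?es' ?orbT // mulrBl.
move=> e z; rewrite inE => /orP[/eqP ->|]; last exact: us0.
have := sum0 z; rewrite big_cons big1_seq ?addr0 // => e' /andP[_ es']; exact: us0.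
Qed.

End characters.

(** Sort a linear combination that represents [f] by weights. Since [f] has weight [e0],
    independence of characters identifies it with the part of weight [e0]. *)
Lemma lspan_weight (K : idomainType) (E : eqType) (I G Z : Type) (act : G -> Z -> Z)
    (chi : E -> G -> K) (m : I -> Z -> K^o) (wt : I -> E) (S : set I) (e0 : E)
    (f : Z -> K^o) :
  (forall e e', e != e' -> exists t, chi e t != chi e' t) ->
  (forall i t z, m i (act t z) = chi (wt i) t * m i z) ->
  (forall t z, f (act t z) = chi e0 t * f z) ->
  lspan [set m i | i in S] f -> lspan [set m i | i in S `&` [set i | wt i = e0]] f.
Proof.
move=> sep hm hf [N [c [s [hs fE]]]].
have /choice[a ha] i : exists j, S j /\ m j = s i by have [j] := hs i; exists j.
have fz z : f z = \sum_i c i * m (a i) z.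
  rewrite fE fct_sumE; apply: eq_bigr => i _.
  by have [_ ->] := ha i.
(* With [f] subtracted in weight [e0], the functions [u e] have weight [e] and add up to 0, so each
   of them vanishes. *)
pose u e z := \sum_(i | wt (a i) == e) c i * m (a i) z - (e == e0)%:R * f z.
have u0 z : u e0 z = 0.
  (* [e0] is added because no monomial of the combination need have this weight. *)
  pose r := undup (e0 :: [seq wt (a i) | i <- enum 'I_N]).
  have e0r : e0 \in r by rewrite mem_undup inE eqxx.
  apply: (@characters_independent K E G Z act chi r u) => // [|e t z' er|z'].
  - exact: undup_uniq.
  - rewrite /u hf mulrBr mulr_sumr; congr (_ - _).
      by apply: eq_bigr => i /eqP <-; rewrite hm mulrCA.
    by case: eqVneq => [->|_]; rewrite ?mul0r ?mulr0 // !mul1r.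
  rewrite /u sumrB -mulr_suml.
  have -> : \sum_(e <- r) ((e == e0)%:R : K) = 1.
    rewrite (bigD1_seq e0) ?undup_uniq //= eqxx big1 ?addr0 // => e /negbTE ->.
    by [].
  rewrite mul1r (exchange_big_dep xpredT) //= fz.
  apply/eqP; rewrite subr_eq0; apply/eqP; apply: eq_bigr => i _.
  have air : wt (a i) \in r.
    by rewrite mem_undup inE; apply/orP; right; apply/mapP; exists i; rewrite ?mem_enum.
  rewrite -big_filter (_ : [seq _ <- r | _] = [:: wt (a i)]) ?big_seq1 //.
  rewrite (eq_filter (a2 := pred1 (wt (a i)))) ?filter_pred1_uniq ?undup_uniq //.
  by move=> e /=; rewrite eq_sym.
have -> : f = \sum_(i | wt (a i) == e0) c i *: (m (a i) : Z -> K^o).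
  apply/funext => z; have := u0 z; rewrite /u eqxx mul1r => /eqP.
  by rewrite subr_eq0 => /eqP <-; rewrite fct_sumE; apply: eq_bigr.
apply: lspan_sum => i /eqP wi; apply/lspanZ/lspan_sub; exists (a i) => //.
by split=> //; case: (ha i).
Qed.

(** * Functions that are polynomial along coordinate lines *)

Section line_polynomials.
Context {R : realType} (n : nat).
Local Notation C := (R[i]).
Implicit Types (z v : 'cV[C]_n) (f g : cfun R n) (i : 'I_n).

Definition polynomial_fun : set (cfun R n) := lspan (range (@monomial R n)).

Lemma monomial0 z : monomial (0 : 'cV_n) z = 1.
Proof. by rewrite /monomial big1 // => i _; rewrite mxE expr0. Qed.

Lemma monomialM (a b : 'cV[nat]_n) z :
  monomial a z * monomial b z = monomial (\col_i (a i ord0 + b i ord0)%N) z.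
Proof.
by rewrite /monomial -big_split /=; apply: eq_bigr => i _; rewrite mxE exprD.
Qed.

Lemma monomial_delta i z : monomial (\col_l (l == i : nat)) z = z i 0.
Proof.
rewrite /monomial (bigD1 i) //= mxE eqxx expr1 big1 ?mulr1 // => l /negbTE li.
by rewrite mxE li expr0.
Qed.

Lemma polynomial_fun1 (c : C) : polynomial_fun (fun=> c).
Proof.
rewrite (_ : (fun=> c) = c *: (monomial 0 : cfun R n)).
  by apply/lspanZ/lspan_sub; exists 0.
by apply/funext => z; rewrite fctE monomial0 /GRing.scale /= mulr1.
Qed.

Lemma polynomial_fun_coord i : polynomial_fun (fun z => z i 0).
Proof.
apply: lspan_sub; exists (\col_l (l == i : nat)) => //.
by apply/funext => z; rewrite monomial_delta.
Qed.

Lemma polynomial_funM f g : polynomial_fun f -> polynomial_fun g ->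
  polynomial_fun (fun z => f z * g z).
Proof.
move=> hf hg.
have cv0 : polynomial_fun (fun=> 0) by exact: polynomial_fun1.
have cvD (c : C) (v w : cfun R n) : polynomial_fun v -> polynomial_fun w ->
    polynomial_fun (fun z => c * v z + w z).
  by move=> hv hw; apply: lspanD => //; exact: lspanZ.
apply: (lspan_ind (P := fun f => polynomial_fun (fun z => f z * g z))) hf.
  by rewrite (_ : (fun _ => _) = fun=> 0) //; apply/funext => z; exact: mul0r.
move=> c _ f' [a _ <-] hf'.
have {}hg : polynomial_fun (fun z => monomial a z * g z).
  apply: (lspan_ind (P := fun g => polynomial_fun (fun z => monomial a z * g z))) hg.
    by rewrite (_ : (fun _ => _) = fun=> 0) //; apply/funext => z; exact: mulr0.
  move=> d _ g' [b _ <-] hg'.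
  rewrite (_ : (fun _ => _) = fun z =>
    d * monomial (\col_i (a i ord0 + b i ord0)%N) z + monomial a z * g' z).
    by apply: cvD => //; apply: lspan_sub; eexists.
  by apply/funext => z; rewrite !fctE /GRing.scale /= mulrDr -monomialM mulrCA.
rewrite (_ : (fun _ => _) = fun z => c * (monomial a z * g z) + f' z * g z).
  exact: cvD.
by apply/funext => z; rewrite !fctE /GRing.scale /= mulrDl mulrA.
Qed.

Lemma polynomial_fun_sum (I : Type) (r : seq I) (P : pred I) (F : I -> cfun R n) :
  (forall k, P k -> polynomial_fun (F k)) ->
  polynomial_fun (fun z => \sum_(k <- r | P k) F k z).
Proof.
move=> hF; rewrite (_ : (fun _ => _) = \sum_(k <- r | P k) F k).
  exact: lspan_sum.
by apply/funext => z; rewrite fct_sumE.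
Qed.

Lemma polynomial_fun_prod (I : Type) (r : seq I) (P : pred I) (F : I -> cfun R n) :
  (forall k, P k -> polynomial_fun (F k)) ->
  polynomial_fun (fun z => \prod_(k <- r | P k) F k z).
Proof.
move=> hF; elim: r => [|i r IH].
  by under eq_fun => z do [rewrite big_nil]; exact: polynomial_fun1.
under eq_fun => z do [rewrite big_cons].
case Pi : (P i) => //; apply: polynomial_funM => //; exact: hF.
Qed.

Lemma polynomial_fun_exp (f : cfun R n) e : polynomial_fun f ->
  polynomial_fun (fun z => f z ^+ e).
Proof.
move=> hf; elim: e => [|e IH]; first exact: polynomial_fun1.
by under eq_fun => z do [rewrite exprS]; exact: polynomial_funM.
Qed.

Lemma polynomial_fun_horner (p : {poly C}) (f : cfun R n) : polynomial_fun f ->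
  polynomial_fun (fun z => p.[f z]).
Proof.
move=> hf; under eq_fun => z do [rewrite horner_coef].
apply: polynomial_fun_sum => i _; apply: polynomial_funM; first exact: polynomial_fun1.
exact: polynomial_fun_exp.
Qed.

Definition coord_subst i (c : C) z : 'cV[C]_n := z + (c - z i 0) *: delta_mx i 0.

Lemma coord_substE i c z l : coord_subst i c z l 0 = if l == i then c else z l 0.
Proof.
rewrite /coord_subst !mxE eqxx andbT; case: eqVneq => [->|_].
  by rewrite mulr1 addrC subrK.
by rewrite mulr0 addr0.
Qed.

Lemma cV_eq z v : (forall i, z i 0 = v i 0) -> z = v.
Proof. by move=> zv; apply/matrixP => i o; rewrite (ord1 o). Qed.

(** The degree bound is uniform in the line, so the same [d.+1] interpolation nodes serve all
    lines. *)
Definition line_polynomial d f := forall v i, exists2 p : {poly C},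
  (size p <= d.+1)%N & forall s, f (v + s *: delta_mx i 0) = p.[s].

Lemma line_polynomial_subst d f i c : line_polynomial d f ->
  line_polynomial d (f \o coord_subst i c).
Proof.
move=> hf v l; have [->|li] := eqVneq l i.
  exists (f (coord_subst i c v))%:P.
    by rewrite (leq_trans (size_polyC_leq1 _)).
  move=> s; rewrite hornerC /=; congr f; apply: cV_eq => l'.
  by rewrite !coord_substE !mxE; case: eqVneq; rewrite ?andFb ?mulr0 ?addr0.
have [p sp hp] := hf (coord_subst i c v) l; exists p => // s.
rewrite -hp /=; congr f; apply: cV_eq => l'.
rewrite [RHS]mxE !coord_substE !mxE; case: eqVneq => [->|//].
by rewrite eq_sym (negbTE li) mulr0 addr0.
Qed.

(** Induction on the number [e] of leading coordinates on which [f] depends, removing one coordinate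
    at a time by Lagrange interpolation. *)
Lemma line_polynomialP d f : line_polynomial d f -> polynomial_fun f.
Proof.
pose trunc e z : 'cV[C]_n := \col_i (if (i < e)%N then z i 0 else 0).
suff H e : (e <= n)%N -> forall f, line_polynomial d f ->
    (forall z, f z = f (trunc e z)) -> polynomial_fun f.
  move=> hf; apply: (H n) => // z; congr f; apply: cV_eq => i.
  by rewrite mxE ltn_ord.
elim: e => [_|e IH en] {}f hf htr.
  rewrite (_ : f = fun=> f 0); first exact: polynomial_fun1.
  by apply/funext => z; rewrite htr; congr f; apply: cV_eq => i; rewrite !mxE.
pose i := Ordinal en.
have xinj : injective (fun k : nat => k%:R : C) by move=> a b /eqP; rewrite eqr_nat => /eqP.
have [l hl] : exists l : 'I_d.+1 -> {poly C}, forall p : {poly C}, (size p <= d.+1)%N ->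
    p = \sum_(k < d.+1) p.[k%:R]%:P * l k.
  by exists (fun k => tnth (lagrange d.+1 (fun k : nat => k%:R)) k) => p; exact: lagrange_gen.
(* Interpolation in the coordinate [i] at the nodes 0, ..., [d]. Fixing this coordinate leaves
   functions of the first [e] coordinates only. *)
have -> : f = fun z => \sum_(k < d.+1) (l k).[z i 0] * f (coord_subst i k%:R z).
  apply/funext => z; have [p sp hp] := hf z i.
  have hq c : f (coord_subst i c z) = (p \Po ('X - (z i 0)%:P)).[c].
    by rewrite horner_comp !hornerE -hp.
  rewrite -[in LHS](_ : coord_subst i (z i 0) z = z); last first.
    by rewrite /coord_subst subrr scale0r addr0.
  rewrite hq {1}(hl (p \Po _)).
    rewrite horner_sum; apply: eq_bigr => k _.
    by rewrite hornerM hornerC -hq mulrC.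
  by rewrite size_comp_poly2 // size_XsubC.
apply: polynomial_fun_sum => k _; apply: polynomial_funM.
  exact/polynomial_fun_horner/polynomial_fun_coord.
apply: (IH (ltnW en) (f \o coord_subst i k%:R)); first exact: line_polynomial_subst.
move=> z /=; rewrite htr [RHS]htr; congr f; apply: cV_eq => l'.
rewrite [LHS]mxE [RHS]mxE ltnS leq_eqVlt !coord_substE [in RHS]mxE -val_eqE /=.
by case: eqVneq => //= _; case: ltnP.
Qed.

End line_polynomials.

(** * Homogeneous holomorphic functions on the ball *)

Lemma derive0_constant (R : realType) (g : R -> R) (a b : R) : a <= b ->
  (forall x, a <= x <= b -> forall e : R, 0 < e -> exists2 r, 0 < r &
    forall t : R, `|t| < r -> `|g (x + t) - g x| <= e * `|t|) -> g a = g b.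
Proof.
move=> ab hg.
have dg x : a <= x <= b -> is_derive x 1 g 0.
  move=> xab.
  have H : (fun h => h^-1 *: ((g \o shift x) (h *: 1) - g x)) @ 0^' --> (0 : R).
    apply/cvgrPdist_le => e e0; have [r r0 hr] := hg x xab e e0.
    rewrite near_withinE; apply/nbhs_normP; exists r => //= t.
    move=> tr t0; have H := hr t; move: tr; rewrite /= !sub0r !normrN => /H {}H.
    rewrite /GRing.scale /= mulr1 (addrC t) normrM normfV.
    by rewrite mulrC ler_pdivrMr ?normr_gt0.
  by apply: DeriveDef; [apply/cvg_ex; exists 0|exact: cvg_lim].
have [x||c cab] := @MVT_segment R g (fun=> 0) a b ab.
- by rewrite in_itv /= => /andP[/ltW ? /ltW ?]; apply: dg; apply/andP.
- apply: derivable_within_continuous => x; rewrite in_itv /= => /dg[].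
  by [].
- by rewrite mul0r => /eqP; rewrite subr_eq0 => /eqP.
Qed.

Section circle.
Context {R : realType}.
Local Notation C := (R[i]).
Implicit Types (s t w : C) (h g : C^o -> C^o).

Lemma normr1_normc t : `|t| = 1 <-> normc t = 1.
Proof. by rewrite normrE_normc; split=> [/complexI|->]. Qed.

Lemma normc_gt0 t : (0 < normc t) = (t != 0).
Proof.
rewrite lt_def normc_ge0 andbT; congr negb; apply/eqP/eqP => [/eq0_normc //|->].
exact: normc0.
Qed.

(** The Cayley transform gives points of the unit circle algebraically: arbitrarily close to 1 for
    small [x], and pairwise distinct. *)
Definition cayley (x : R) : C := Complex 1 x / Complex 1 (- x).

Lemma cayley_norm (x : R) : normc (cayley x) = 1.
Proof.
rewrite /cayley normcM normcV /= sqrrN divff // gt_eqF // sqrtr_gt0 expr1n.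
by rewrite ltr_pwDl // sqr_ge0.
Qed.

Lemma cayleyB1 (x : R) : cayley x - 1 = Complex 0 (2 * x) / Complex 1 (- x).
Proof.
have n0 : Complex 1 (- x) != 0 by rewrite eq_complex /= oner_eq0.
apply: (mulIf n0); rewrite mulrBl mul1r !divfK //.
by apply/eqP; rewrite eq_complex /= subrr opprK; apply/andP; split=> //; apply/eqP; ring.
Qed.

Lemma circle_near1 (e : R) : 0 < e -> exists t, [/\ normc t = 1, t != 1 & normc (t - 1) < e].
Proof.
move=> e0; pose x := e / 3; have x0 : 0 < x by rewrite divr_gt0.
exists (cayley x); split; first exact: cayley_norm.
  rewrite -subr_eq0 cayleyB1 mulf_eq0 invr_eq0 negb_or !eq_complex /= oner_eq0 eqxx andbT.
  by rewrite mulf_neq0 ?gt_eqF.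
rewrite cayleyB1 normcM normcV normc_imag.
apply: (@le_lt_trans _ _ (2 * x)); last by rewrite /x; lra.
have d1 : 1 <= normc (Complex 1 (- x)).
  by apply: le_trans (ler_Re_normc _); rewrite /= normr1.
rewrite gtr0_norm ?mulr_gt0 // ler_pdivrMr; last exact: lt_le_trans d1.
by rewrite ler_peMr // mulr_ge0 // ltW.
Qed.

(** Otherwise the nonzero polynomial ['X^a - 'X^b] would have as many distinct roots [cayley k%:R]
    as its size. *)
Lemma circle_injective_power (a b : nat) : a != b ->
  exists t, normc t = 1 /\ t ^+ a != t ^+ b.
Proof.
move=> ab; apply: contrapT => /forallNP H.
have {}H t : normc t = 1 -> t ^+ a = t ^+ b.
  by move=> t1; apply/eqP/negP => /negP nab; apply: (H t).
pose p : {poly C} := 'X^a - 'X^b.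
have p0 : p != 0.
  apply/eqP => /(congr1 (fun p : {poly C} => p`_a)).
  rewrite coefB !coefXn eqxx (negbTE ab) subr0 coef0 => /eqP.
  by rewrite oner_eq0.
pose rs := [seq cayley k%:R | k <- iota 0 (size p)].
have := max_poly_roots p0 (rs := rs); rewrite size_map size_iota ltnn => H1.
suff : false by [].
apply: H1.
  apply/allP => t /mapP[k _ ->]; rewrite /root /p !hornerE.
  by rewrite H ?subrr // cayley_norm.
rewrite map_inj_uniq ?iota_uniq // => k l kl.
have n0 x : Complex 1 (- x) != 0 :> C by rewrite eq_complex /= oner_eq0.
move: kl => /(congr1 (fun t => t * Complex 1 (- k%:R) * Complex 1 (- l%:R))).
rewrite /cayley divfK // [RHS]mulrAC divfK // => /(congr1 (@complex.Im R)) /=.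
move=> H2; apply/eqP; rewrite -(eqr_nat R); apply/eqP.
by move: H2; clear; lra.
Qed.

(** A nonzero derivative [l] would contradict its linear approximation with error |l| / 2 at a point
    [t * s] close to [s], where [g] takes the same value. *)
Lemma circle_invariant_derive0 g s : s != 0 -> derivable g s 1 ->
  (forall t, normc t = 1 -> g (t * s) = g s) ->
  forall e : R, 0 < e -> exists2 r, 0 < r &
    forall t, normc t < r -> normc (g (s + t) - g s) <= e * normc t.
Proof.
move=> s0 /derivable_normcP[l hl] inv.
suff l0 : l = 0.
  by move=> e /hl[r r0 hr]; exists r => // t /hr; rewrite l0 mul0r subr0.
apply/eqP; rewrite -[l == 0]negbK -normc_gt0; apply/negP => lp.
have [|r r0 hr] := hl (normc l / 2); first by rewrite divr_gt0.
have sp : 0 < normc s by rewrite normc_gt0.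
have [|t [t1 tn1 tr]] := @circle_near1 (r / normc s); first by rewrite divr_gt0.
have tsE : (t - 1) * s = t * s - s by rewrite mulrBl mul1r.
have tsp : 0 < normc (t * s - s) by rewrite -tsE normcM mulr_gt0 // normc_gt0 subr_eq0.
have := hr (t * s - s); rewrite -{1}tsE normcM -ltr_pdivlMr // => /(_ tr).
rewrite (addrC s) subrK inv // subrr sub0r normcN normcM leNgt => /negP; apply.
by rewrite ltr_pM2r // ltr_pdivrMr // ltr_pMr // ltr1n.
Qed.

(** A complex derivative that vanishes along circles vanishes radially as well. The condition
    [0 < a] keeps the radial path away from 0, where the circles degenerate. *)
Lemma circle_invariant_constant g (a : R) : 0 < a -> a <= 1 ->
  (forall x : R, a <= x <= 1 -> derivable g x%:C%C 1) ->
  (forall x : R, a <= x <= 1 -> forall t, normc t = 1 -> g (t * x%:C%C) = g x%:C%C) ->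
  g a%:C%C = g 1.
Proof.
move=> a0 a1 dg inv.
have H (x : R) : a <= x <= 1 -> forall e : R, 0 < e -> exists2 r, 0 < r &
    forall t : R, `|t| < r -> normc (g (x + t)%:C%C - g x%:C%C) <= e * `|t|.
  move=> xa e e0.
  have x0 : x%:C%C != 0 :> C.
    rewrite eq_complex /= eqxx andbT gt_eqF //.
    by apply: lt_le_trans a0 _; case/andP: xa.
  have [r r0 hr] := circle_invariant_derive0 x0 (dg x xa) (inv x xa) e0.
  exists r => // t tr; have := hr t%:C%C.
  by rewrite [normc _]normc_real -rmorphD => /(_ tr).
apply/eqP; rewrite eq_complex; apply/andP; split; apply/eqP.
  apply: (@derive0_constant R (fun x : R => complex.Re (g x%:C%C)) a 1) => //.
  move=> x xa e e0; have [r r0 hr] := H x xa e e0; exists r => // t /hr.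
  by apply: le_trans; rewrite -ReB ler_Re_normc.
apply: (@derive0_constant R (fun x : R => complex.Im (g x%:C%C)) a 1) => //.
move=> x xa e e0; have [r r0 hr] := H x xa e e0; exists r => // t /hr.
by apply: le_trans; rewrite -ImB ler_Im_normc.
Qed.

End circle.

(** * Extension of circle-homogeneous holomorphic functions to polynomials *)

Section circle_homogeneous.
Context {R : realType} (n : nat).
Local Notation C := (R[i]).
Implicit Types (s t c : C) (z v b : 'cV[C]_n).

Lemma normc2_normc t : normc2 t = normc t ^+ 2.
Proof.
by case: t => x y; rewrite /normc2 /= sqr_sqrtr // addr_ge0 // sqr_ge0.
Qed.

Lemma sqnormZc c z : sqnorm (c *: z) = normc c ^+ 2 * sqnorm z.
Proof.
rewrite /sqnorm mulr_sumr; apply: eq_bigr => i _.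
by rewrite mxE !normc2_normc normcM exprMn.
Qed.

Lemma sqnormD_le z v : sqnorm (z + v) <= 2 * sqnorm z + 2 * sqnorm v.
Proof.
rewrite /sqnorm !mulr_sumr -big_split /=; apply: ler_sum => i _.
rewrite mxE /normc2; case: (z i 0) (v i 0) => [x y] [x' y'] /=.
have := sqr_ge0 (x - x'); have := sqr_ge0 (y - y'); nra.
Qed.

Lemma holomorphic_line_derivable (f : cfun R n) v b s : holomorphic_on (@unit_ball R n) f ->
  sqnorm (v + s *: b) < 1 -> derivable (fun s : C^o => f (v + s *: b)) s 1.
Proof.
move=> hf vsb; apply/derivable1_diffP.
apply: (@differentiable_comp C C^o ('cV[C]_n) C^o (fun s => v + s *: b) f).
  apply: (@differentiableD C C^o 'cV[C]_n (cst v) (fun s => s *: b)).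
    exact: differentiable_cst.
  by apply: (@differentiableZl C C^o 'cV[C]_n (fun s => s) b).
exact: hf.
Qed.

Section extension.
Variables (f : cfun R n) (K : nat).
Hypothesis hf : holomorphic_on (@unit_ball R n) f.
Hypothesis fK : forall t z, normc t = 1 -> f (t *: z) = t ^+ K * f z.

(** By [fK] the quotient f (s z) / s^K is invariant under the circle, hence constant on the radius
    from [a] to 1. *)
Lemma radial_homogeneous z (a : R) : 0 < a -> a <= 1 -> sqnorm z < 1 ->
  f (a%:C%C *: z) = a%:C%C ^+ K * f z.
Proof.
move=> a0 a1 zB.
pose g : C^o -> C^o := fun s => f (0 + s *: z) * (s ^+ K)^-1.
have x0 (x : R) : a <= x <= 1 -> x%:C%C != 0 :> C.
  move=> /andP[ax _]; rewrite eq_complex /= eqxx andbT gt_eqF //.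
  exact: lt_le_trans ax.
have : g a%:C%C = g 1.
  apply: circle_invariant_constant => // x xa.
    apply: (@derivableM C C^o (fun s => f (0 + s *: z)) (fun s => (s ^+ K)^-1)).
      apply: holomorphic_line_derivable => //; rewrite add0r sqnormZc.
      rewrite [normc _]normc_real real_normK ?num_real //.
      apply: le_lt_trans zB; rewrite ler_piMl ?sqnorm_ge0 //.
      by case/andP: xa => ax x1; rewrite expr_le1 // (le_trans _ ax) // ltW.
    apply: (@derivableV C C^o (fun s => s ^+ K)); first by rewrite expf_neq0 // x0.
    exact: exprn_derivable.
  move=> t t1; rewrite /g !add0r -scalerA fK // exprMn invfM.
  rewrite mulrACA mulfV ?mul1r // expf_neq0 // -normc_gt0 t1 //.
rewrite /g expr1n invr1 mulr1 scale1r !add0r => <-.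
by rewrite mulrCA mulfV ?mulr1 // expf_neq0 // x0 // lexx.
Qed.

Let c0 z : R := (1 + sqnorm z)^-1.

(** The factor [c0 z] moves any [z] into the ball. By [homogeneous_extensionE] every other positive
    factor that does so gives the same value. *)
Definition homogeneous_extension : cfun R n :=
  fun z => ((c0 z)%:C%C ^+ K)^-1 * f ((c0 z)%:C%C *: z).
Local Notation F := homogeneous_extension.

Let c0_gt0 z : 0 < c0 z.
Proof. by rewrite invr_gt0 ltr_wpDr // sqnorm_ge0. Qed.

Let sqnorm_real (c : R) z : sqnorm (c%:C%C *: z) = c ^+ 2 * sqnorm z.
Proof. exact: sqnormZ. Qed.

Let realC_neq0 (c : R) : 0 < c -> c%:C%C != 0 :> C.
Proof. by move=> cp; rewrite eq_complex /= eqxx andbT gt_eqF. Qed.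

Lemma homogeneous_extensionE z (c : R) : 0 < c -> sqnorm (c%:C%C *: z) < 1 ->
  f (c%:C%C *: z) = c%:C%C ^+ K * F z.
Proof.
move=> c_gt0 zB; rewrite /F; set d := c0 z; have d0 : 0 < d := c0_gt0 z.
have dB : sqnorm (d%:C%C *: z) < 1.
  rewrite sqnorm_real /d /c0 exprVn ltr_pdivrMl ?exprn_gt0 ?ltr_wpDr ?sqnorm_ge0 //.
  by rewrite mulr1; have := sqnorm_ge0 z; nra.
(* [radial_homogeneous] only shrinks a vector, so it is applied to the one of the two scaled vectors
   that is longer. *)
clearbody d; have [cd|/ltW dc] := leP c d.
  have := @radial_homogeneous (d%:C%C *: z) (c / d).
  rewrite divr_gt0 // ler_pdivrMr // mul1r => /(_ isT cd dB).
  rewrite scalerA -rmorphM divfK ?gt_eqF // => ->.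
  rewrite mulrA; congr (_ * _).
  by rewrite rmorphM fmorphV exprMn exprVn.
have := @radial_homogeneous (c%:C%C *: z) (d / c).
rewrite divr_gt0 // ler_pdivrMr // mul1r => /(_ isT dc zB).
rewrite scalerA -rmorphM divfK ?gt_eqF // => ->.
have E (a b u : C) : a != 0 -> b != 0 -> u = a ^+ K * ((b ^+ K)^-1 * ((b / a) ^+ K * u)).
  move=> a0 b0; rewrite expr_div_n !mulrA divfK ?expf_neq0 //.
  by rewrite mulfV ?expf_neq0 // mul1r.
have dcE : (d / c)%:C%C = d%:C%C / c%:C%C :> C by rewrite rmorphM fmorphV.
by rewrite dcE; apply: E; exact: realC_neq0.
Qed.

Lemma homogeneous_extension_ball z : sqnorm z < 1 -> F z = f z.
Proof.
move=> zB; have := @homogeneous_extensionE z 1 ltr01.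
by rewrite rmorph1 scale1r expr1n mul1r => ->.
Qed.

(** In the polar decomposition of [t], the phase is handled by [fK] and the modulus by
    [homogeneous_extensionE]. *)
Lemma homogeneous_extensionZ t z : t != 0 -> F (t *: z) = t ^+ K * F z.
Proof.
rewrite -normc_gt0 => t0.
pose u := t / (normc t)%:C%C.
have u1 : normc u = 1.
  by rewrite /u normcM normcV [normc _%:C%C]normc_real gtr0_norm // mulfV // gt_eqF.
have tE : t = u * (normc t)%:C%C by rewrite /u divfK // realC_neq0.
pose c := c0 (t *: z); have c_gt0 : 0 < c := c0_gt0 _.
have B1 : sqnorm (c%:C%C *: (t *: z)) < 1.
  rewrite sqnorm_real /c /c0 exprVn ltr_pdivrMl ?exprn_gt0 ?ltr_wpDr ?sqnorm_ge0 //.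
  by rewrite mulr1; have := sqnorm_ge0 (t *: z); nra.
have H1 := homogeneous_extensionE c_gt0 B1.
have cK : c%:C%C ^+ K != 0 :> C by rewrite expf_neq0 // realC_neq0.
apply: (mulfI cK); rewrite -H1.
rewrite [in LHS]tE scalerA mulrCA -scalerA fK // -rmorphM.
rewrite homogeneous_extensionE ?mulr_gt0 //; last first.
  by move: B1; rewrite !sqnorm_real sqnormZc exprMn mulrA.
by rewrite [t in RHS]tE rmorphM !exprMn; ring.
Qed.

(** The factor [c0] is not holomorphic, but one constant [c] scales all points of the line with
    parameter [t] in the unit disc around [s] into the ball. There the extension is a fixed multiple
    of [f]. *)
Lemma homogeneous_extension_derivable v b s :
  derivable (fun s : C^o => F (v + s *: b) : C^o) s 1.
Proof.
pose S := normc s + 1; have S0 : 0 <= S by rewrite addr_ge0 // normc_ge0.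
pose Q := 2 * sqnorm v + 2 * (S ^+ 2 * sqnorm b).
have Q0 : 0 <= Q by rewrite addr_ge0 // !mulr_ge0 ?exprn_ge0 ?sqnorm_ge0.
pose c := (1 + Q)^-1; have c_gt0 : 0 < c by rewrite invr_gt0 ltr_wpDr.
have cB t : normc t <= S -> sqnorm (c%:C%C *: (v + t *: b)) < 1.
  move=> tS; rewrite sqnorm_real /c exprVn ltr_pdivrMl ?exprn_gt0 ?ltr_wpDr //.
  rewrite mulr1; apply: (@le_lt_trans _ _ Q); last by nra.
  apply: le_trans (sqnormD_le _ _) _; rewrite lerD2l ler_wpM2l // sqnormZc.
  by rewrite ler_wpM2r ?sqnorm_ge0 // ler_pXn2r // nnegrE normc_ge0.
have cK : c%:C%C ^+ K != 0 :> C by rewrite expf_neq0 // realC_neq0.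
pose h : C^o -> C^o := fun t => f (c%:C%C *: v + t *: (c%:C%C *: b)).
have hE t : normc t <= S -> (c%:C%C ^+ K)^-1 *: h t = F (v + t *: b).
  move=> tS; rewrite /h scalerA (mulrC t) -scalerA -scalerDr.
  by rewrite homogeneous_extensionE ?cB // /GRing.scale /= mulKf.
apply: (near_eq_derivable (f := (c%:C%C ^+ K)^-1 *: h)).
  apply/(@nbhs_normP _ C^o); exists 1 => //= t st; apply: hE.
  have : normc (s - t) < 1 by rewrite -normc_lt.
  rewrite -{2}(subrK s t) => st1; apply: le_trans (le_normcD _ _) _.
  by rewrite addrC lerD2l -normcN opprB ltW.
apply: derivableZ; apply: holomorphic_line_derivable => //.
rewrite scalerA (mulrC s) -scalerA -scalerDr cB //.
by rewrite lerDl.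
Qed.

(** Homogeneity gives F (v + s b) = s^K F (b + v / s), and the second factor is bounded for large
    [s] by continuity at [b]. So the growth along every coordinate line has exponent [K]. *)
Lemma homogeneous_extension_polynomial : polynomial_fun F.
Proof.
apply: (@line_polynomialP R n K) => v i; set b := delta_mx i 0.
pose h : C^o -> C^o := fun s => F (v + s *: b).
have dh s : derivable h s 1 := @homogeneous_extension_derivable v b s.
have [r r0 hr] := (continuous_normcP (fun s : C^o => F (b + s *: v) : C^o) 0).1
  (derivable_continuous_normc (@homogeneous_extension_derivable b v 0)) 1 ltr01.
have [||p sp hp] := @polynomial_growth R h [::] K (normc (F b) + 1) (r^-1 + 1) _
  (fun s _ => dh s).
- by move=> s; exact: derivable_continuous_normc.
- move=> s sr; have s0 : 0 < normc s.
    by apply: lt_le_trans sr; rewrite addr_gt0 // invr_gt0.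
  have sn0 : s != 0 by rewrite -normc_gt0.
  have -> : h s = s ^+ K * F (b + s^-1 *: v).
    have E : v + s *: b = s *: (b + s^-1 *: v).
      by rewrite scalerDr scalerA mulfV // scale1r addrC.
    by rewrite /h E; exact: homogeneous_extensionZ.
  have nX : normc (s ^+ K) = normc s ^+ K.
    by elim: (K) => [|e IH]; rewrite ?normc1 // !exprS normcM IH.
  rewrite normcM mulrC nX ler_wpM2r ?exprn_ge0 ?normc_ge0 //.
  have := hr s^-1; rewrite normcV scale0r addr0 add0r => H.
  rewrite -(subrK (F b) (F (b + s^-1 *: v))) addrC.
  apply: le_trans (le_normcD _ _) _; rewrite lerD2l ltW // H //.
  rewrite invf_plt ?posrE //; apply: lt_le_trans sr; by rewrite ltrDl.
- by exists p => // s; exact: hp.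
Qed.

End extension.

End circle_homogeneous.

(** * Integrability of the Bergman density *)

Section one_dim.
Context {R : realType}.
Local Notation mu := (@lebesgue_measure R).

(** Monotone convergence over increasing compact intervals, for integrands that may be singular at
    the ends of the union. *)
Lemma ge0_FTC_bigcup_le (k F : R -> R) (u v : nat -> R) (M : R) :
  (forall n, u n < v n) -> (forall n, u n.+1 <= u n) -> (forall n, v n <= v n.+1) ->
  (forall n x, u n <= x <= v n ->
    [/\ is_derive x 1 F (k x), {for x, continuous k} & 0 <= k x]) ->
  (forall n, F (v n) - F (u n) <= M) ->
  (\int[mu]_(x in \bigcup_n `[u n, v n]%classic) (k x)%:E <= M%:E)%E.
Proof.
move=> uv u_dec v_inc kF FM.
have ck n : {within `[u n, v n], continuous k}.
  apply: continuous_in_subspaceT => x; rewrite inE /= in_itv /= => /kF[_ + _].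
  by [].
have intE n : (\int[mu]_(x in `[u n, v n]%classic) (k x)%:E = (F (v n) - F (u n))%:E)%E.
  rewrite EFinB; apply: continuous_FTC2 => //.
    have dF x : u n <= x <= v n -> derivable F x 1 by move=> /kF[[]].
    have cF x : u n <= x <= v n -> {for x, continuous F}.
      by move=> /dF/derivable1_diffP; exact: differentiable_continuous.
    split.
    - by move=> x; rewrite in_itv /= => /andP[/ltW ux /ltW xv]; apply: dF; rewrite ux.
    - by apply: cvg_at_right_filter; apply: cF; rewrite lexx ltW.
    - by apply: cvg_at_left_filter; apply: cF; rewrite lexx ltW.
  move=> x; rewrite in_itv /= => /andP[/ltW ux /ltW xv].
  by have [dF _ _] := kF n x (introT andP (conj ux xv)); rewrite derive1E derive_val.
have H : (\int[mu]_(x in `[u n, v n]%classic) (k x)%:E @[n --> \oo] -->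
    \int[mu]_(x in \bigcup_n `[u n, v n]%classic) (k x)%:E)%E.
  apply: ge0_nondecreasing_set_cvg_integral.
  - apply/nondecreasing_seqP => n; apply/subsetPset => x /=; rewrite !in_itv /=.
    by move=> /andP[ux xv]; rewrite (le_trans (u_dec n)) // (le_trans xv).
  - by move=> n; exact: measurable_itv.
  - move=> n; apply/measurable_EFinP; apply: subspace_continuous_measurable_fun => //.
  - by move=> n x /=; rewrite in_itv /= => /kF[_ _]; rewrite lee_fin.
rewrite -(cvg_lim _ H) //; apply: lime_le; first by apply/cvg_ex; eexists; exact: H.
apply: nearW => n.
by rewrite intE lee_fin.
Qed.

(** [powR] takes the value [1] at negative bases. *)
Definition pospow (lambda s : R) : R := if 0 < s then s `^ lambda else 0.

Lemma pospow_ge0 lambda s : 0 <= pospow lambda s.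
Proof. by rewrite /pospow; case: ifP => // _; exact: powR_ge0. Qed.

Lemma measurable_pospow lambda : measurable_fun setT (pospow lambda).
Proof.
by apply: measurable_fun_ifT => //; exact: measurable_fun_ltr.
Qed.

(** With r^2 = s, the constant comes from integrating [k] below over (-r, r), which gives 2 r^lambda
    (2 r)^(lambda + 1) / (lambda + 1). The powers of r combine to s^(lambda + 1/2). *)
Lemma integral_pospow_sub_sqr lambda s : - 1 < lambda -> lambda <= 0 ->
  (\int[mu]_x (pospow lambda (s - x ^+ 2))%:E <=
    (2 * (2 `^ (lambda + 1)) / (lambda + 1) * pospow (lambda + 1 / 2) s)%:E)%E.
Proof.
move=> l1 l0; have l10 : 0 < lambda + 1 by rewrite -ltrBlDr sub0r.
have [s0|s0] := ltP 0 s; last first.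
  rewrite integral0_eq ?lee_fin => [|x _].
    by rewrite mulr_ge0 ?pospow_ge0 // divr_ge0 ?mulr_ge0 ?powR_ge0 // ltW.
  by rewrite /pospow ifF //; apply/negbTE; rewrite -leNgt; have := sqr_ge0 x; lra.
pose r := Num.sqrt s; have r0 : 0 < r by rewrite sqrtr_gt0.
have rs : r ^+ 2 = s by rewrite sqr_sqrtr // ltW.
(* One of r - x and r + x is at least r, and [lambda <= 0], so (r^2 - x^2)^lambda is bounded by one
   of the two summands. [F] is a primitive of [k]. *)
pose k x := r `^ lambda * ((r - x) `^ lambda + (r + x) `^ lambda).
pose F x := r `^ lambda * (- ((r - x) `^ (lambda + 1)) + (r + x) `^ (lambda + 1)) / (lambda + 1).
(* The intervals stay away from the ends, where [k] is singular for negative [lambda]; the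
   denominator starts at 2 so that [e n < r]. *)
pose e n : R := r / n.+2%:R.
have e0 n : 0 < e n by rewrite divr_gt0.
have er n : e n < r by rewrite ltr_pdivrMr // ltr_pMr // ltr1n.
have kF n x : - r + e n <= x <= r - e n ->
    [/\ is_derive x 1 F (k x), {for x, continuous k} & 0 <= k x].
  move=> /andP[xl xr].
  have p1 : 0 < r - x by move: xr (e0 n); clear; lra.
  have p2 : 0 < r + x by move: xl (e0 n); clear; lra.
  have D a (g : R -> R) (dg : R) : 0 < g x -> is_derive x 1 g dg ->
      is_derive x 1 (fun y => g y `^ a) (a * g x `^ (a - 1) * dg).
    by move=> g0 Dg; exact: (@is_derive1_comp R (fun y => y `^ a) g x _ _ (is_derive1_powR a g0) Dg).
  have D1 a : is_derive x 1 (fun y => (r - y) `^ a) (a * (r - x) `^ (a - 1) * (0 - 1)).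
    exact: (D a (fun y => r - y)).
  have D2 a : is_derive x 1 (fun y => (r + y) `^ a) (a * (r + x) `^ (a - 1) * (0 + 1)).
    exact: (D a (fun y => r + y)).
  split.
  - have -> : F = (r `^ lambda / (lambda + 1)) *:
        (- (fun y => (r - y) `^ (lambda + 1)) + (fun y => (r + y) `^ (lambda + 1))).
      by apply/funext => y; rewrite /F !fctE /GRing.scale /=; ring.
    have D1' := D1 (lambda + 1); have D2' := D2 (lambda + 1).
    apply: is_derive_eq; rewrite /k /GRing.scale /= !addrK.
    by field; rewrite gt_eqF.
  - apply/differentiable_continuous/derivable1_diffP.
    have -> : k = (r `^ lambda) *:
        ((fun y => (r - y) `^ lambda) + (fun y => (r + y) `^ lambda)).
      by apply/funext => y.
    have D1' := D1 lambda; have D2' := D2 lambda.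
    by apply: derivableZ; apply: derivableD.
  - by rewrite mulr_ge0 ?addr_ge0 ?powR_ge0.
pose D := \bigcup_n `[- r + e n, r - e n]%classic.
have mD : measurable D by apply: bigcup_measurable => n _; exact: measurable_itv.
have anti (a b : R) : 0 < a -> a <= b -> b `^ lambda <= a `^ lambda.
  move=> a0 ab; have b0 := lt_le_trans a0 ab.
  rewrite -[lambda]opprK (powRN b (- lambda)) (powRN a (- lambda)) lef_pV2 ?posrE ?powR_gt0 //.
  by rewrite ge0_ler_powR ?nnegrE ?oppr_ge0 // ltW.
have fk x : pospow lambda (s - x ^+ 2) != 0 -> D x /\ pospow lambda (s - x ^+ 2) <= k x.
  rewrite /pospow; case: ifPn => [|_]; last by rewrite eqxx.
  rewrite -rs subr_sqr => rx _.
  have /andP[p1 p2] : (0 < r - x) && (0 < r + x).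
    have [p1|p1] := ltP 0 (r - x); first by rewrite -(pmulr_rgt0 _ p1).
    have : (r - x) * (r + x) <= 0 by rewrite mulr_le0_ge0 //; move: p1 r0; clear; lra.
    by rewrite leNgt rx.
  split.
    pose m := Num.min (r - x) (r + x).
    have m0 : 0 < m by rewrite lt_min p1.
    exists (Num.bound (r / m)) => //=; rewrite in_itv /=.
    have em : e (Num.bound (r / m)) <= m.
      rewrite /e ler_pdivrMr // mulrC -ler_pdivrMr //.
      have /archi_boundP/ltW : 0 <= r / m by rewrite divr_ge0 // ltW.
      by move=> /le_trans; apply; rewrite ler_nat ltnW.
    have m1 : m <= r - x by rewrite ge_min lexx.
    have m2 : m <= r + x by rewrite ge_min lexx orbT.
    by apply/andP; split; move: em m1 m2; clear; lra.
  rewrite powRM ?(ltW p1) ?(ltW p2) // /k mulrDr.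
  have [x0|/ltW x0] := leP 0 x.
    apply: (@le_trans _ _ (r `^ lambda * (r - x) `^ lambda)).
      by rewrite mulrC ler_wpM2r ?powR_ge0 ?anti // lerDl.
    by rewrite lerDl mulr_ge0 ?powR_ge0.
  apply: (@le_trans _ _ (r `^ lambda * (r + x) `^ lambda)).
    by rewrite ler_wpM2r ?powR_ge0 ?anti // lerDl oppr_ge0.
  by rewrite lerDr mulr_ge0 ?powR_ge0.
have kD x : D x -> 0 <= k x by move=> [n _ /=]; rewrite in_itv /= => /kF[].
have mk : measurable_fun setT k.
  by apply: measurable_funM => //; apply: measurable_funD;
    apply: (measurableT_comp (measurable_powR _)) => //;
    [exact: measurable_funB|exact: measurable_funD].
have mf : measurable_fun setT (fun x : R => pospow lambda (s - x ^+ 2)).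
  apply: (measurableT_comp (measurable_pospow _)) => //.
  by apply: measurable_funB => //; exact: exprn_measurable.
rewrite (_ : (\int[mu]_x (pospow lambda (s - x ^+ 2))%:E =
    \int[mu]_(x in D) (pospow lambda (s - x ^+ 2))%:E)%E); last first.
  rewrite [RHS]integral_mkcond; apply: eq_integral => x _; rewrite patchE.
  case: ifPn => // /negP xD; apply/eqP; rewrite eqe; apply: contra_notT xD.
  by move=> /fk[xD _]; rewrite inE.
apply: (@le_trans _ _ (\int[mu]_(x in D) (k x)%:E)%E).
  apply: ge0_le_integral => //.
  - by move=> x _; rewrite lee_fin pospow_ge0.
  - by apply/measurable_EFinP; exact: measurable_funTS.
  - by apply/measurable_EFinP; exact: measurable_funTS.
  - move=> x Dx; rewrite lee_fin.
    by have [->|/fk[]//] := eqVneq (pospow lambda (s - x ^+ 2)) 0; exact: kD.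
have en n : e n.+1 <= e n.
  by rewrite ler_pM2l // lef_pV2 ?posrE // ler_nat.
apply: (@ge0_FTC_bigcup_le k F) => // [n|n|n|n].
- by move: (er n) (e0 n); clear; lra.
- by rewrite lerD2l.
- by rewrite lerD2l lerN2.
rewrite /F (_ : r - (r - e n) = e n); last by ring.
rewrite (_ : r + (r - e n) = 2 * r - e n); last by ring.
rewrite (_ : r - (- r + e n) = 2 * r - e n); last by ring.
rewrite (_ : r + (- r + e n) = e n); last by ring.
have H1 : (2 * r - e n) `^ (lambda + 1) <= (2 * r) `^ (lambda + 1).
  rewrite ge0_ler_powR ?nnegrE ?(ltW l10) //; move: (e0 n) (er n) r0; clear; lra.
have H2 := powR_ge0 (e n) (lambda + 1).
have H3 := powR_ge0 r lambda.
have -> : pospow (lambda + 1 / 2) s = r `^ lambda * r `^ (lambda + 1).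
  rewrite /pospow s0 -powRD; last by apply/implyP => _; rewrite gt_eqF.
  rewrite /r -powR12_sqrt ?(ltW s0) // -powRrM; congr (_ `^ _).
  by field.
move: H1; rewrite powRM ?(ltW r0) // => H1.
set X := (2 * r - e n) `^ _ in H1 *; set Y := e n `^ _ in H2 *.
set A := r `^ lambda in H3 *; set B := r `^ _ in H1 *; set E := 2 `^ _ in H1 *.
have : A * (X - Y) / (lambda + 1) <= A * (E * B) / (lambda + 1).
  rewrite ler_pM2r ?invr_gt0 // ler_wpM2l //.
  by move: H1 H2; clear; lra.
by set L := (lambda + 1)^-1; clear; lra.
Qed.

End one_dim.

Section n_dim.
Context {R : realType}.
Local Notation mu := (@lebesgue_measure R).

Lemma ge0_integral_cons_pair2 N (f : N.+1.-tuple (measurableTypeR R) -> \bar R) :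
  measurable_fun setT f -> (forall x, 0 <= f x)%E ->
  (\int[lebesgue_Rn N.+1]_x f x = \int[lebesgue_Rn N]_y \int[mu]_a f (cons_pair (a, y)))%E.
Proof.
move=> mf f0.
transitivity (\int[pushforward (mu \x lebesgue_Rn N)%E (@cons_pair R N)]_x f x)%E => //.
rewrite ge0_integral_pushforward //; last exact: measurable_cons_pair.
rewrite preimage_setT; apply: fubini_tonelli2 => [|x].
  exact: (measurableT_comp mf (@measurable_cons_pair R N)).
exact: f0.
Qed.

Definition sqsum N (x : N.-tuple (measurableTypeR R)) : R := \sum_(i < N) tnth x i ^+ 2.

Lemma sqsum_ge0 N (x : N.-tuple (measurableTypeR R)) : 0 <= sqsum x.
Proof. by apply: sumr_ge0 => i _; exact: sqr_ge0. Qed.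

Lemma sqsum_cons N a (x : N.-tuple (measurableTypeR R)) :
  sqsum (cons_pair (a, x)) = a ^+ 2 + sqsum x.
Proof.
rewrite /sqsum big_ord_recl; congr (_ ^+ _ + _); apply: eq_bigr => i _.
by rewrite tnthS.
Qed.

Lemma measurable_sqsum N : measurable_fun setT (@sqsum N).
Proof.
apply: measurable_sum => i.
by apply: (measurableT_comp (exprn_measurable 2)); exact: measurable_tnth.
Qed.

Lemma measurable_pospow_sqsum N lambda s :
  measurable_fun setT (fun x : N.-tuple (measurableTypeR R) => pospow lambda (s - sqsum x)).
Proof.
apply: (measurableT_comp (measurable_pospow _)).
by apply: measurable_funB => //; exact: measurable_sqsum.
Qed.

Lemma pospow_anti lambda mu' s : lambda <= mu' -> s <= 1 ->
  pospow mu' s <= pospow lambda s :> R.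
Proof.
move=> lm s1; rewrite /pospow; case: ifP => // s0.
by apply: ger_powR => //; rewrite s0.
Qed.

(** Induction on [N], integrating out one coordinate by [integral_pospow_sub_sqr]. Positive
    exponents reduce to 0, since the base is at most 1. *)
Lemma integral_pospow_Rn N lambda : - 1 < lambda ->
  (\int[lebesgue_Rn N]_x (pospow lambda (1 - sqsum x))%:E < +oo)%E.
Proof.
suff H l : - 1 < l -> l <= 0 ->
    (\int[lebesgue_Rn N]_x (pospow l (1 - sqsum x))%:E < +oo)%E.
  move=> l1; have [l0|l0] := leP lambda 0; first exact: H.
  apply: le_lt_trans (H 0 _ _) => //.
  apply: ge0_le_integral => //.
  - by move=> x _; rewrite lee_fin pospow_ge0.
  - by apply/measurable_EFinP; exact: measurable_pospow_sqsum.
  - by apply/measurable_EFinP; exact: measurable_pospow_sqsum.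
  - move=> x _; rewrite lee_fin pospow_anti ?(ltW l0) //.
    by rewrite gerBl sqsum_ge0.
elim: N l => [|N IH] l l1 l0.
  rewrite integral_dirac //; last first.
    by apply/measurable_EFinP; exact: measurable_pospow_sqsum.
  by rewrite diracT mul1e ltry.
rewrite ge0_integral_cons_pair2; last 2 first.
- by apply/measurable_EFinP; exact: measurable_pospow_sqsum.
- by move=> x; rewrite lee_fin pospow_ge0.
(* The new exponent is capped at 0 to stay in the range of the induction; this only enlarges the
   integrand. *)
pose l' := Num.min (l + 1 / 2) 0.
pose C := 2 * (2 `^ (l + 1)) / (l + 1).
have C0 : 0 <= C.
  by rewrite divr_ge0 ?mulr_ge0 ?powR_ge0 // ltW // -ltrBlDr sub0r.
have l'1 : - 1 < l' by rewrite lt_min; apply/andP; split; move: l1; clear; lra.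
have l'0 : l' <= 0 by rewrite ge_min lexx orbT.
apply: (@le_lt_trans _ _ (\int[lebesgue_Rn N]_y (C%:E * (pospow l' (1 - sqsum y))%:E))%E).
  apply: ge0_le_integral => //.
  - by move=> y _; apply: integral_ge0 => a _; rewrite lee_fin pospow_ge0.
  - apply: (@measurable_fun_fubini_tonelli_G _ _ _ _ R mu
      (fun p => (pospow l (1 - sqsum (cons_pair p)))%:E)).
      apply/measurable_EFinP.
      exact: (measurableT_comp (measurable_pospow_sqsum l 1) (@measurable_cons_pair R N)).
    by move=> x; rewrite lee_fin pospow_ge0.
  - apply/measurable_EFinP; apply: measurable_funM => //.
    exact: measurable_pospow_sqsum.
  move=> y _; under eq_integral => a _ do rewrite sqsum_cons opprD addrA addrAC.
  apply: le_trans (integral_pospow_sub_sqr _ l1 l0) _.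
  rewrite -EFinM lee_fin -/C ler_wpM2l //; apply: pospow_anti.
    by rewrite ge_min lexx.
  by rewrite gerBl sqsum_ge0.
rewrite ge0_integralZl_EFin //.
- by rewrite lte_mul_pinfty ?lee_fin ?fin_numE //; exact: IH.
- by move=> y _; rewrite lee_fin pospow_ge0.
- by apply/measurable_EFinP; exact: measurable_pospow_sqsum.
Qed.

End n_dim.

(** * Rotation invariance *)

Section invariance.
Context {R : realType}.
Local Notation mu := (@lebesgue_measure R).
Local Notation tup N := (N.-tuple (measurableTypeR R)).

Lemma lebesgue_measure_translate (c : R) (A : set R) : measurable A ->
  pushforward mu ((fun x => x + c) : _ -> measurableTypeR R) A = mu A.
Proof.
move=> mA; apply/esym.
have mt : measurable_fun setT ((fun x => x + c) : measurableTypeR R -> measurableTypeR R).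
  exact: measurable_funD.
pose nu : {measure set (measurableTypeR R) -> \bar R} := pushforward mu ((fun x => x + c) : _ -> measurableTypeR R).
change (mu A = nu mt A).
apply: lebesgue_measure_unique => // _ [[a b]] _ <-.
rewrite /nu /= /pushforward.
rewrite (_ : _ @^-1` _ = `]a - c, b - c]%classic); last first.
  by apply/seteqP; split=> x /=; rewrite !in_itv /= ltrBlDr lerBrDr.
by rewrite !lebesgue_measure_itv /= !lte_fin ltrD2r -!EFinB opprB addrA subrK.
Qed.

Lemma ge0_integral_translate (c : R) (f : R -> \bar R) :
  measurable_fun setT f -> (forall x, 0 <= f x)%E ->
  (\int[mu]_x f (x + c)%R = \int[mu]_x f x)%E.
Proof.
move=> mf f0.
have mt : measurable_fun setT ((fun x => x + c) : measurableTypeR R -> measurableTypeR R).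
  exact: measurable_funD.
rewrite -[LHS](@ge0_integral_pushforward _ _ _ _ R _ mt mu setT f) //.
by apply: eq_measure_integral => A mA _; exact: lebesgue_measure_translate.
Qed.

Lemma ge0_integral_cons_pair1 N (f : tup N.+1 -> \bar R) :
  measurable_fun setT f -> (forall x, 0 <= f x)%E ->
  (\int[lebesgue_Rn N.+1]_x f x = \int[mu]_a \int[lebesgue_Rn N]_y f (cons_pair (a, y)))%E.
Proof.
move=> mf f0.
transitivity (\int[pushforward (mu \x lebesgue_Rn N)%E (@cons_pair R N)]_x f x)%E => //.
rewrite ge0_integral_pushforward //; last exact: measurable_cons_pair.
rewrite preimage_setT; apply: fubini_tonelli1 => [|x].
  exact: (measurableT_comp mf (@measurable_cons_pair R N)).
exact: f0.
Qed.

Definition preserves_integral N (phi : tup N -> tup N) : Prop :=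
  measurable_fun setT phi /\ forall f : tup N -> \bar R, measurable_fun setT f ->
  (forall x, 0 <= f x)%E ->
  (\int[lebesgue_Rn N]_x f (phi x) = \int[lebesgue_Rn N]_x f x)%E.

Lemma preserves_integralE N (phi : tup N -> tup N) (f : tup N -> \bar R) :
  preserves_integral phi -> measurable_fun setT f ->
  (\int[lebesgue_Rn N]_x f (phi x) = \int[lebesgue_Rn N]_x f x)%E.
Proof.
move=> [mphi hphi] mf; rewrite [RHS]integralE.
rewrite -(hphi (f^\+)%E (measurable_funepos mf)); last by move=> x; exact: funepos_ge0.
rewrite -(hphi (f^\-)%E (measurable_funeneg mf)); last by move=> x; exact: funeneg_ge0.
by rewrite [LHS]integralE; congr (_ - _)%E; apply: eq_integral => x _; rewrite ?funeposE ?funenegE.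
Qed.

Lemma preserves_integral_comp N (phi psi : tup N -> tup N) :
  preserves_integral phi -> preserves_integral psi -> preserves_integral (phi \o psi).
Proof.
move=> [mphi hphi] [mpsi hpsi]; split; first exact: measurableT_comp.
move=> f mf f0; have mfp := measurableT_comp mf mphi.
by rewrite -(hphi f mf f0) -(hpsi (f \o phi) mfp) // => x; exact: f0.
Qed.

Definition tuple_upd N (x : tup N) (l : 'I_N) (v : R) : tup N :=
  [tuple (if i == l then v else tnth x i) | i < N].

Lemma tuple_updE N (x : tup N) l v i :
  tnth (tuple_upd x l v) i = if i == l then v else tnth x i.
Proof. by rewrite tnth_mktuple. Qed.

Lemma measurable_tuple_upd N l (tau : tup N -> R) : measurable_fun setT tau ->
  measurable_fun setT (fun x : tup N => tuple_upd x l (tau x)).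
Proof.
move=> mtau; apply/measurable_fun_tnthP => i.
rewrite (_ : _ \o _ = fun x => if i == l then tau x else tnth x i); last first.
  by apply/funext => x /=; rewrite tuple_updE.
by case: eqP => _ //; exact: measurable_tnth.
Qed.

(** For the first coordinate, Tonelli with this coordinate innermost reduces the claim to a
    translation of the line, as [tau] is constant there. For the others, the first coordinate is put
    outermost and the induction applies to the rest. *)
Lemma preserves_integral_upd N l (tau : tup N -> R) : measurable_fun setT tau ->
  (forall x v, tau (tuple_upd x l v) = tau x) ->
  preserves_integral (fun x : tup N => tuple_upd x l (tnth x l + tau x)).
Proof.
move=> mtau htau.
have mphi N' (l' : 'I_N') (tau' : tup N' -> R) : measurable_fun setT tau' ->
    measurable_fun setT (fun x : tup N' => tuple_upd x l' (tnth x l' + tau' x)).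
  move=> mtau'; apply: measurable_tuple_upd.
  by apply: measurable_funD => //; exact: measurable_tnth.
split; first exact: mphi.
elim: N l tau mtau htau => [[]//|N IH] l tau mtau htau f mf f0.
have mfphi := measurableT_comp mf (mphi _ l _ mtau).
have [l0|[l' ll']] : l = ord0 \/ exists l', l = lift ord0 l'.
  by case: (unliftP ord0 l) => [l' ->|->]; [right; exists l'|left].
  rewrite [LHS](ge0_integral_cons_pair2 mfphi (fun x => f0 _)) [RHS](ge0_integral_cons_pair2 mf f0).
  apply: eq_integral => y _.
  rewrite -(@ge0_integral_translate (tau (cons_pair (0, y)))
    (fun a => f (cons_pair (a, y)))) //.
    apply: eq_integral => a _; congr f; apply: eq_from_tnth => i.
    rewrite tuple_updE l0; case: eqVneq => [->|i0].
      congr (_ + _); rewrite -(htau _ 0); congr tau; apply: eq_from_tnth => i'.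
      rewrite tuple_updE l0; case: eqVneq => [->//|].
      by case: (unliftP ord0 i') => [i'' ->|->]; rewrite ?eqxx // !tnthS.
    move: i0; case: (unliftP ord0 i) => [i'' ->|->]; rewrite ?eqxx // => _.
    by rewrite !tnthS.
  apply: (measurableT_comp mf); apply: (measurableT_comp (@measurable_cons_pair R N)).
  exact: measurable_fun_pair.
rewrite [LHS](ge0_integral_cons_pair1 mfphi (fun x => f0 _)) [RHS](ge0_integral_cons_pair1 mf f0).
apply: eq_integral => a _.
have mcons : measurable_fun setT (fun y : tup N => cons_pair (a, y)).
  apply: (measurableT_comp (@measurable_cons_pair R N)).
  exact: measurable_fun_pair.
rewrite -[RHS](IH l' (fun y => tau (cons_pair (a, y)))) //.
- apply: eq_integral => y _; congr f; apply: eq_from_tnth => i.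
  rewrite tuple_updE ll' tnthS.
  case: (unliftP ord0 i) => [i' ->|->]; last by rewrite (negbTE (neq_lift _ _)).
  by rewrite !tnthS tuple_updE (inj_eq lift_inj).
- exact: (measurableT_comp mtau mcons).
- move=> y v; rewrite -[RHS](htau _ v); congr tau; apply: eq_from_tnth => i.
  rewrite tuple_updE ll'.
  case: (unliftP ord0 i) => [i' ->|->]; last by rewrite (negbTE (neq_lift _ _)).
  by rewrite !tnthS tuple_updE (inj_eq lift_inj).
- exact: (measurableT_comp mf mcons).
Qed.

Definition tuple_rot N (p q : 'I_N) (c s : R) (x : tup N) : tup N :=
  tuple_upd (tuple_upd x p (c * tnth x p - s * tnth x q)) q (s * tnth x p + c * tnth x q).

Lemma preserves_integral_shear N (p q : 'I_N) (c : R) : p != q ->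
  preserves_integral (fun x : tup N => tuple_upd x p (tnth x p + c * tnth x q)).
Proof.
move=> pq; apply: preserves_integral_upd.
  by apply: measurable_funM => //; exact: measurable_tnth.
by move=> x v; rewrite tuple_updE eq_sym (negbTE pq).
Qed.

(** A rotation is a product of three shears. *)
Lemma preserves_integral_rot N (p q : 'I_N) (c s : R) : p != q -> c ^+ 2 + s ^+ 2 = 1 ->
  preserves_integral (tuple_rot p q c s).
Proof.
move=> pq cs1; have qp : q != p by rewrite eq_sym.
have gen (c' s' : R) : s' != 0 -> c' ^+ 2 + s' ^+ 2 = 1 ->
    preserves_integral (tuple_rot p q c' s').
  (* For a rotation by the angle theta this is - tan (theta / 2), so the decomposition requires
     [s' != 0]. *)
  move=> s0 cs; pose t := (c' - 1) / s'.
  have H1 := preserves_integral_shear t pq; have H2 := preserves_integral_shear s' qp.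
  rewrite [tuple_rot _ _ _ _](_ : _ =
      (fun x : tup N => tuple_upd x p (tnth x p + t * tnth x q)) \o
      (fun x : tup N => tuple_upd x q (tnth x q + s' * tnth x p)) \o
      (fun x : tup N => tuple_upd x p (tnth x p + t * tnth x q))).
    by apply: preserves_integral_comp => //; exact: preserves_integral_comp.
  have st : s' * t = c' - 1 by rewrite /t mulrC divfK.
  have ct : t * (1 + c') = - s'.
    apply: (mulIf s0); rewrite mulrAC (mulrC t) st.
    by move: cs; clear; nra.
  apply/funext => x /=; apply: eq_from_tnth => i.
  rewrite /tuple_rot !tuple_updE !eqxx (negbTE pq) (negbTE qp).
  have [->|iq] := eqVneq i q.
    rewrite (negbTE qp) [RHS](_ : _ =
      s' * tnth x p + (1 + s' * t) * tnth x q); last by ring.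
    by rewrite st; ring.
  case: eqVneq => // _.
  rewrite [RHS](_ : _ = (1 + s' * t) * tnth x p + (t + t * (1 + s' * t)) * tnth x q); last by ring.
  have -> : t + t * (1 + s' * t) = - s' by rewrite -ct st; ring.
  by rewrite st; ring.
(* What remains is the identity and the half turn, which is the square of a quarter turn. *)
have [s0|] := eqVneq s 0; last by move=> s0; exact: gen.
have rot_id x : tuple_rot p q 1 0 x = x.
  apply: eq_from_tnth => i; rewrite /tuple_rot !tuple_updE.
  case: eqVneq => [->|_]; first by ring.
  by case: eqVneq => [->|//]; ring.
move: cs1; rewrite s0 expr0n addr0 => /eqP; rewrite sqrf_eq1 => /orP[] /eqP ->.
  split; first by rewrite (_ : tuple_rot p q 1 0 = id) //; apply/funext.
  by move=> f mf f0; under eq_integral do rewrite rot_id.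
have H := gen 0 1 (oner_neq0 _).
rewrite (_ : tuple_rot p q (-1) 0 = tuple_rot p q 0 1 \o tuple_rot p q 0 1).
  by apply: preserves_integral_comp; apply: H; rewrite expr0n expr1n add0r.
apply/funext => x /=; apply: eq_from_tnth => i.
rewrite /tuple_rot !tuple_updE !eqxx (negbTE pq).
by case: eqVneq => _; [ring|case: eqVneq => _ //; ring].
Qed.

End invariance.

Section complex_rotation.
Context {R : realType} (n : nat).
Local Notation C := (R[i]).
Local Notation tup N := (N.-tuple (measurableTypeR R)).
Implicit Types (x : tup n.*2) (i : 'I_n).

Lemma sqnorm_cvec_of x : sqnorm (cvec_of x) = sqsum x.
Proof.
have H m (F : nat -> R) : \sum_(i < m.*2) F i = \sum_(i < m) (F i.*2 + F i.*2.+1).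
  elim: m => [|m IH]; first by rewrite !big_ord0.
  by rewrite doubleS !big_ord_recr /= IH addrA.
rewrite /sqsum; under [RHS]eq_bigr => i _ do rewrite (tnth_nth 0).
by rewrite (H n (fun k => nth 0 x k ^+ 2)); apply: eq_bigr => i _; rewrite mxE.
Qed.

Lemma double_ltn i : (i.*2 < n.*2)%N.
Proof. by rewrite ltn_double. Qed.

Lemma doubleS_ltn i : (i.*2.+1 < n.*2)%N.
Proof. by rewrite ltn_Sdouble. Qed.

Definition coord_rot i (t : C) (z : 'cV[C]_n) : 'cV[C]_n :=
  \col_l (if l == i then t * z l 0 else z l 0).

Lemma cvec_of_rot i (t : C) x :
  cvec_of (tuple_rot (Ordinal (double_ltn i)) (Ordinal (doubleS_ltn i))
    (complex.Re t) (complex.Im t) x) = coord_rot i t (cvec_of x).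
Proof.
apply/matrixP => l o; rewrite !mxE.
have tnthE (y : tup n.*2) k (kn : (k < n.*2)%N) : nth 0 y k = tnth y (Ordinal kn).
  by rewrite (tnth_nth 0).
rewrite !(tnthE _ _ (double_ltn l)) !(tnthE _ _ (doubleS_ltn l)) !tuple_updE.
rewrite -!val_eqE /= eqSS !(inj_eq double_inj).
have od : (l.*2 == i.*2.+1) = false.
  by apply/negbTE/eqP => /(congr1 odd) /=; rewrite !odd_double.
have odS : (l.*2.+1 == i.*2) = false.
  by apply/negbTE/eqP => /(congr1 odd) /=; rewrite !odd_double.
rewrite od odS; case: eqVneq => [/val_inj ->|//].
case: t => c s /=; apply/eqP; rewrite eq_complex /=.
by rewrite (addrC (s * _)) !eqxx.
Qed.

Lemma measurable_unit_ball : measurable (@cvec_of R n @^-1` @unit_ball R n : set (tup n.*2)).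
Proof.
rewrite (_ : _ @^-1` _ = [set x | sqsum x < 1]).
  rewrite -[X in measurable X]setTI.
  have := @measurable_fun_ltr _ (tup n.*2) R setT (@sqsum R n.*2) (cst 1)
    (@measurable_sqsum R _) (@measurable_cst _ _ _ _ _ _).
  move=> /(_ measurableT [set true]) H; rewrite (_ : [set x | _] =
    (fun x : tup n.*2 => sqsum x < cst 1 x) @^-1` [set true]); first exact: H.
  by apply/seteqP; split=> x /= ->.
by apply/seteqP; split=> x; rewrite /unit_ball /= sqnorm_cvec_of.
Qed.

Lemma measurable_bergman_density lambda :
  measurable_fun setT (fun x : tup n.*2 => bergman_density lambda (cvec_of x)).
Proof.
apply: measurable_funM => //.
apply: (measurableT_comp (measurable_powR _)).
under eq_fun do rewrite sqnorm_cvec_of.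
by apply: measurable_funB => //; exact: measurable_sqsum.
Qed.

(** The ball and the density depend only on the norm, which the rotation preserves. The domain is
    moved into the integrand because rotation invariance concerns integrals over the whole space. *)
Lemma bergman_int_rot lambda i (t : C) (h : 'cV[C]_n -> R) :
  (complex.Re t) ^+ 2 + (complex.Im t) ^+ 2 = 1 ->
  measurable_fun setT (fun x : tup n.*2 => h (cvec_of x)) ->
  bergman_int lambda (h \o coord_rot i t) = bergman_int lambda h.
Proof.
move=> t1 mh; rewrite /bergman_int /Rintegral; congr fine.
rewrite [LHS]integral_mkcond [RHS]integral_mkcond.
set S := @cvec_of R n @^-1` @unit_ball R n.
set G := (fun x : tup n.*2 => (h (cvec_of x) * bergman_density lambda (cvec_of x))%:E) \_ S.
have pq : Ordinal (double_ltn i) != Ordinal (doubleS_ltn i).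
  by rewrite -val_eqE /= -[X in X == _]addn0 -addn1 eqn_add2l.
have hphi := preserves_integral_rot pq t1.
set phi := tuple_rot _ _ _ _ in hphi.
have sq x : sqnorm (coord_rot i t (cvec_of x)) = sqnorm (cvec_of x).
  apply: eq_bigr => l _; rewrite mxE; case: eqVneq => // ->.
  rewrite /normc2; case: (t) (cvec_of x i 0) t1 => [c s] [u v] /= t1.
  rewrite -[RHS]mul1r -t1; ring.
have mG : measurable_fun setT G.
  apply/(measurable_restrictT _ measurable_unit_ball)/measurable_funTS.
  apply/measurable_EFinP; apply: measurable_funM => //.
  exact: measurable_bergman_density.
transitivity (\int[lebesgue_Rn n.*2]_x G (phi x))%E.
  apply: eq_integral => x _; rewrite /G !patchE.
  have -> : (phi x \in S) = (x \in S).
    by apply/idP/idP; rewrite !inE /S /unit_ball /= /phi cvec_of_rot sq.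
  by case: ifP => // _; rewrite /phi cvec_of_rot /bergman_density sq.
exact: preserves_integralE.
Qed.

End complex_rotation.

(** * Polynomials in the Bergman space *)

(** Used to pass from a polynomial to its extension by 0, with which it agrees only near points of
    the ball. *)
Lemma near_eq_differentiable (K : numFieldType) (V W : normedModType K) (f g : V -> W)
    (x : V) : {near x, f =1 g} -> differentiable f x -> differentiable g x.
Proof.
move=> fg df; have cdf := diff_continuous df.
have H : g \o shift x = cst (g x) + 'd f x +o_ 0 id.
  apply/eqaddoP => e e0.
  have /eqaddoP/(_ e e0) Hf := diff_locally df.
  have Hn : \forall h \near (0 : V), f (h + x) = g (h + x).
    have := fg; rewrite (near_shift 0) /= subr0.
    by apply: filterS => h; rewrite /= /shift.
  apply: filterS2 Hf Hn => h + E.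
  have fgx := nbhs_singleton fg.
  suff -> : (g \o shift x - (cst (g x) + 'd f x)) h =
    (f \o shift x - (cst (f x) + 'd f x)) h by [].
  by rewrite !fctE /= -E fgx.
apply/diff_locallyP; have dgE : 'd g x = 'd f x :> (V -> W) by exact: diff_unique.
by rewrite dgE.
Unshelve. all: by end_near. Qed.

Section polynomial_bergman.
Context {R : realType} (n : nat).
Local Notation C := (R[i]).
Local Notation tup N := (N.-tuple (measurableTypeR R)).
Implicit Types (z v : 'cV[C]_n) (f g : cfun R n).

Lemma conjE (t : C) : t^* = Complex (complex.Re t) (- complex.Im t).
Proof. by case: t. Qed.

Lemma polynomial_fun_closed (P : cfun R n -> Prop) :
  (forall c : C, P (fun=> c)) -> (forall i, P (fun z => z i 0)) ->
  (forall f g, P f -> P g -> P (fun z => f z + g z)) ->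
  (forall f g, P f -> P g -> P (fun z => f z * g z)) ->
  forall f, polynomial_fun f -> P f.
Proof.
move=> Pc Px PD PM; apply: lspan_ind; first exact: Pc.
move=> c _ f [a _ <-] Pf.
have PX i e : P (fun z => z i 0 ^+ e).
  elim: e => [|e IH]; first exact: Pc.
  rewrite (_ : (fun _ => _) = fun z => z i 0 * z i 0 ^+ e); first exact: PM.
  by apply/funext => z; rewrite exprS.
have Pm (r : seq 'I_n) : P (fun z => \prod_(i <- r) z i 0 ^+ a i 0).
  elim: r => [|i r IH].
    by rewrite (_ : (fun _ => _) = fun=> 1) //; apply/funext => z; rewrite big_nil.
  rewrite (_ : (fun _ => _) = fun z => z i 0 ^+ a i 0 * \prod_(i <- r) z i 0 ^+ a i 0).
    exact: PM.
  by apply/funext => z; rewrite big_cons.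
exact: (PD _ _ (PM _ _ (Pc c) (Pm _)) Pf).
Qed.

Lemma measurable_polynomial_fun f : polynomial_fun f ->
  measurable_fun setT (fun x : tup n.*2 => complex.Re (f (cvec_of x))) /\
  measurable_fun setT (fun x : tup n.*2 => complex.Im (f (cvec_of x))).
Proof.
apply: (polynomial_fun_closed (P := fun f =>
  measurable_fun setT (fun x : tup n.*2 => complex.Re (f (cvec_of x))) /\
  measurable_fun setT (fun x : tup n.*2 => complex.Im (f (cvec_of x))))).
- by move=> c; split; exact: measurable_cst.
- move=> i; split.
    rewrite (_ : (fun _ => _) = fun x : tup n.*2 => tnth x (Ordinal (double_ltn i))).
      exact: measurable_tnth.
    by apply/funext => x; rewrite mxE (tnth_nth 0).
  rewrite (_ : (fun _ => _) = fun x : tup n.*2 => tnth x (Ordinal (doubleS_ltn i))).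
    exact: measurable_tnth.
  by apply/funext => x; rewrite mxE (tnth_nth 0).
- move=> g h [g1 g2] [h1 h2]; split.
    rewrite (_ : (fun _ => _) = fun x : tup n.*2 =>
      complex.Re (g (cvec_of x)) + complex.Re (h (cvec_of x))).
      exact: measurable_funD.
    by apply/funext => x; case: (g _) (h _) => [? ?] [? ?].
  rewrite (_ : (fun _ => _) = fun x : tup n.*2 =>
    complex.Im (g (cvec_of x)) + complex.Im (h (cvec_of x))).
    exact: measurable_funD.
  by apply/funext => x; case: (g _) (h _) => [? ?] [? ?].
move=> g h [g1 g2] [h1 h2]; split.
  rewrite (_ : (fun _ => _) = fun x : tup n.*2 =>
    complex.Re (g (cvec_of x)) * complex.Re (h (cvec_of x)) -
    complex.Im (g (cvec_of x)) * complex.Im (h (cvec_of x))).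
    by apply: measurable_funB; exact: measurable_funM.
  by apply/funext => x; case: (g _) (h _) => [? ?] [? ?].
rewrite (_ : (fun _ => _) = fun x : tup n.*2 =>
  complex.Re (g (cvec_of x)) * complex.Im (h (cvec_of x)) +
  complex.Im (g (cvec_of x)) * complex.Re (h (cvec_of x))).
  by apply: measurable_funD; exact: measurable_funM.
by apply/funext => x; case: (g _) (h _) => [? ?] [? ?].
Qed.

Lemma normc_coord_le z i : normc (z i 0) ^+ 2 <= sqnorm z.
Proof.
rewrite /sqnorm (bigD1 i) //= normc2_normc lerDl; apply: sumr_ge0 => l _.
by rewrite normc2_normc sqr_ge0.
Qed.

Lemma bounded_polynomial_fun f : polynomial_fun f ->
  exists M : R, forall z, sqnorm z < 1 -> normc (f z) <= M.
Proof.
apply: (polynomial_fun_closed (P := fun f =>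
  exists M : R, forall z, sqnorm z < 1 -> normc (f z) <= M)).
- by move=> c; exists (normc c).
- move=> i; exists 1 => z /ltW zB.
  rewrite -(ler_pXn2r (_ : 0 < 2)%N) ?nnegrE ?normc_ge0 // expr1n.
  exact: le_trans (normc_coord_le z i) zB.
- move=> g h [M hM] [M' hM']; exists (M + M') => z zB.
  by apply: le_trans (le_normcD _ _) _; rewrite lerD ?hM ?hM'.
- move=> g h [M hM] [M' hM']; exists (M * M') => z zB.
  by rewrite normcM ler_pM ?normc_ge0 ?hM ?hM'.
Qed.

Lemma differentiable_polynomial_fun f : polynomial_fun f ->
  forall z : ('cV[C]_n : normedModType C), differentiable f z.
Proof.
apply: (polynomial_fun_closed (P := fun f =>
  forall z : ('cV[C]_n : normedModType C), differentiable f z)).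
- by move=> c z; exact: differentiable_cst.
- by move=> i z; exact: differentiable_coord.
- by move=> g h dg dh z; exact: (@differentiableD C _ _ g h).
- by move=> g h dg dh z; exact: (@differentiableM C _ g h).
Qed.

Lemma unit_ball_nbhs z : sqnorm z < 1 ->
  \forall v \near (z : 'cV[C]_n : normedModType C), sqnorm v < 1.
Proof.
move=> zB; pose d := (1 - sqnorm z) / (3 * n%:R + 1); have d0 : 0 < d.
  by rewrite divr_gt0 ?subr_gt0 // ltr_wpDl // mulr_ge0.
pose e := Num.min d 1; have e0 : 0 < e by rewrite lt_min d0 ltr01.
apply/nbhs_ballP; exists e%:C%C => /=; first by rewrite ltcR.
move=> v /= [_ zv].
have {}zv i : normc (v i 0 - z i 0) <= e.
  by have := zv i 0; rewrite /ball /= normc_lt -normcN opprB => /ltW.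
have e1 : e <= 1 by rewrite ge_min lexx orbT.
apply: (@le_lt_trans _ _ (\sum_(i < n) (normc2 (z i 0) + 3 * e))).
  apply: ler_sum => i _; rewrite !normc2_normc.
  have z1 : normc (z i 0) <= 1.
    rewrite -(ler_pXn2r (_ : 0 < 2)%N) ?nnegrE ?normc_ge0 // expr1n.
    exact: le_trans (normc_coord_le z i) (ltW zB).
  have H : normc (v i 0) <= normc (z i 0) + e.
    rewrite -{1}(subrK (z i 0) (v i 0)) addrC.
    by apply: le_trans (le_normcD _ _) _; rewrite lerD2l.
  have := normc_ge0 (v i 0); have := normc_ge0 (z i 0).
  move: z1 H e1 e0; clear; nra.
rewrite big_split /= -/(sqnorm z) sumr_const card_ord -mulr_natl.
have : e * (3 * n%:R + 1) <= 1 - sqnorm z.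
  by rewrite -ler_pdivlMr ?ge_min ?lexx // ltr_wpDl // mulr_ge0.
by move: e0; clear; lra.
Qed.

Lemma holomorphic_ball_restrict f : polynomial_fun f ->
  holomorphic_on (@unit_ball R n) (ball_restrict f).
Proof.
move=> hf z zB.
apply: near_eq_differentiable (differentiable_polynomial_fun hf z).
by apply: filterS (unit_ball_nbhs zB) => v; rewrite /ball_restrict => ->.
Qed.

(** On the ball the density is a constant times [pospow], whose integral over the whole space is
    finite. *)
Lemma integrable_ball_bounded lambda (h : 'cV[C]_n -> R) (M : R) : - 1 < lambda ->
  measurable_fun setT (fun x : tup n.*2 => h (cvec_of x)) ->
  (forall z, sqnorm z < 1 -> `|h z| <= M) ->
  (lebesgue_Rn n.*2).-integrable (@cvec_of R n @^-1` @unit_ball R n)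
    (fun x => (h (cvec_of x) * bergman_density lambda (cvec_of x))%:E).
Proof.
move=> l1 mh hM; apply/integrableP.
have mS := @measurable_unit_ball R n.
have mf : measurable_fun setT (fun x : tup n.*2 => h (cvec_of x) * bergman_density lambda (cvec_of x)).
  by apply: measurable_funM => //; exact: measurable_bergman_density.
split; first by apply/measurable_EFinP; exact: measurable_funTS.
pose c := `|M| * `|bergman_const n lambda|.
have c0 : 0 <= c by rewrite mulr_ge0.
apply: (@le_lt_trans _ _ (\int[lebesgue_Rn n.*2]_(x in @cvec_of R n @^-1` @unit_ball R n)
   (c%:E * (pospow lambda (1 - sqsum x))%:E))%E).
  apply: ge0_le_integral => //.
  - apply: measurableT_comp => //; apply/measurable_EFinP; exact: measurable_funTS.
  - apply: measurable_funTS; apply/measurable_EFinP; apply: measurable_funM => //.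
    exact: measurable_pospow_sqsum.
  - move=> x xS; rewrite -EFinM lee_fin /bergman_density mulrA 2!normrM.
    have xB : sqnorm (cvec_of x) < 1 := xS.
    rewrite (ger0_norm (powR_ge0 _ _)) sqnorm_cvec_of /pospow subr_gt0.
    rewrite -sqnorm_cvec_of xB ler_wpM2r ?powR_ge0 // ler_wpM2r //.
    by apply: le_trans (hM _ xB) (ler_norm _).
rewrite ge0_integralZl_EFin //.
- rewrite lte_mul_pinfty ?lee_fin ?fin_numE //.
  apply: le_lt_trans (integral_pospow_Rn n.*2 l1).
  apply: ge0_subset_integral => //.
    by apply/measurable_EFinP; exact: measurable_pospow_sqsum.
  by move=> x _; rewrite lee_fin pospow_ge0.
- by move=> x _; rewrite lee_fin pospow_ge0.
- by apply: measurable_funTS; apply/measurable_EFinP; exact: measurable_pospow_sqsum.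
Qed.

Lemma ball_restrict_idem f : ball_restrict (ball_restrict f) = ball_restrict f.
Proof. by apply/funext => z; rewrite /ball_restrict; case: (sqnorm z < 1). Qed.

Lemma normc2_ball_restrict f x : sqnorm (cvec_of x) < 1 ->
  normc2 (ball_restrict f (cvec_of x)) = normc2 (f (cvec_of x)).
Proof. by rewrite /ball_restrict => ->. Qed.

Lemma bergman_polynomial lambda f : - 1 < lambda -> polynomial_fun f ->
  bergman lambda (ball_restrict f).
Proof.
move=> l1 hf; split; first exact: ball_restrict_idem.
  exact: holomorphic_ball_restrict.
have [M hM] := bounded_polynomial_fun hf.
have [m1 m2] := measurable_polynomial_fun hf.
apply: (eq_integrable _ (fun x => (normc2 (f (cvec_of x)) *
    bergman_density lambda (cvec_of x))%:E)) => //.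
- exact: measurable_unit_ball.
- by move=> x; rewrite inE => xB; rewrite normc2_ball_restrict.
apply: (integrable_ball_bounded (h := fun z => normc2 (f z)) (M := M ^+ 2)) => //.
  by apply: measurable_funD; exact: measurable_funX.
move=> z zB; rewrite normc2_normc ger0_norm ?sqr_ge0 //.
by rewrite ler_pXn2r ?nnegrE ?normc_ge0 ?hM // (le_trans (normc_ge0 (f z))) ?hM.
Qed.

End polynomial_bergman.

(** * Blocks of coordinates *)

Lemma mul_mxdiag_submxcol (K : pzSemiRingType) m (k : 'I_m -> nat) p
    (B : forall l, 'M[K]_(k l)) (A : 'M[K]_(\sum_l k l, p)) :
  \mxdiag_l B l *m A = \mxcol_l (B l *m submxcol A l).
Proof. by rewrite -{1}[A]submxcolK mul_mxdiag_mxcol. Qed.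

Lemma invmx_mxdiag_mul (K : comUnitRingType) m (k : 'I_m -> nat) p
    (B B' : forall l, 'M[K]_(k l)) (A : 'M[K]_(\sum_l k l, p)) :
  (forall l, B l *m B' l = 1%:M) ->
  invmx (\mxdiag_l B l) *m A = \mxcol_l (B' l *m submxcol A l).
Proof.
move=> BB'; have BA q (A' : 'M[K]_(\sum_l k l, q)) :
    \mxdiag_l B l *m (\mxcol_l (B' l *m submxcol A' l)) = A'.
  rewrite mul_mxdiag_mxcol -[RHS]submxcolK; apply/eq_mxcol => l.
  by rewrite mulmxA BB' mul1mx.
have [Bu _] := mulmx1_unit (BA _ 1%:M).
by rewrite -{1}[A]BA mulKmx.
Qed.

Section hadamard.
Context {K : comPzRingType}.

Definition hadamard n (w z : 'cV[K]_n) : 'cV[K]_n := \col_i (w i 0 * z i 0).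

Lemma hadamardZ n c (w z : 'cV[K]_n) : hadamard w (c *: z) = c *: hadamard w z.
Proof. by apply/matrixP => i o; rewrite !mxE mulrCA. Qed.

End hadamard.

Section big_blocks.
Context {m : nat} (k : 'I_m -> nat).

Lemma submxcolE X (z : 'cV[X]_(\sum_l k l)) l i o :
  submxcol z l i o = z (tagnat.Rank l i) o.
Proof. by rewrite mxE. Qed.

Lemma big_blocks (T : Type) (idx : T) (op : Monoid.com_law idx)
    (F : 'I_(\sum_l k l) -> T) :
  \big[op/idx]_i F i = \big[op/idx]_l \big[op/idx]_(i < k l) F (tagnat.Rank l i).
Proof.
rewrite sig_big_dep /= (reindex _ tagnat.sig_bij_on) /=; apply: eq_bigr => i _.
by rewrite tagnat.sig2K.
Qed.

Lemma monomial_blocks {R : realType} (b : 'cV[nat]_(\sum_l k l))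
    (z : 'cV[R[i]]_(\sum_l k l)) :
  monomial b z = \prod_l monomial (submxcol b l) (submxcol z l).
Proof.
rewrite /monomial big_blocks; apply: eq_bigr => l _; apply: eq_bigr => i _.
by rewrite !submxcolE.
Qed.

Lemma sqnorm_blocks {R : realType} (z : 'cV[R[i]]_(\sum_l k l)) :
  sqnorm z = \sum_l sqnorm (submxcol z l).
Proof.
rewrite /sqnorm big_blocks; apply: eq_bigr => l _; apply: eq_bigr => i _.
by rewrite submxcolE.
Qed.

End big_blocks.

Section blocks.
Context {R : realType} {m : nat} (k : 'I_m -> nat) (j : 'I_m).
Local Notation C := (R[i]).
Local Notation n := (\sum_l k l)%N.
Local Notation n' := (\sum_(l < m.-1) k (lift j l))%N.

Lemma submxcol_hat X (z : 'cV[X]_n) l : submxcol (hat j z) l = submxcol z (lift j l).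
Proof. by rewrite /hat mxcolK. Qed.

(** In each case the block has the right size only up to a propositional equality of indices, which
    [conform_mx] bridges; its default value is never taken. *)
Definition merge X (x0 : X) (a : 'cV[X]_n') (b : 'cV[X]_(k j)) : 'cV[X]_n :=
  \mxcol_l (if unlift j l is Some l' then conform_mx (const_mx x0) (submxcol a l')
            else conform_mx (const_mx x0) b).

Lemma hat_merge X (x0 : X) a b : hat j (merge x0 a b) = a.
Proof.
rewrite -[RHS]submxcolK; apply: eq_mxcol => l.
by rewrite mxcolK liftK conform_mx_id.
Qed.

Lemma submxcol_merge X (x0 : X) a b : submxcol (merge x0 a b) j = b.
Proof. by rewrite mxcolK unlift_none conform_mx_id. Qed.

Lemma merge_eq X (x0 : X) (z v : 'cV[X]_n) :
  hat j z = hat j v -> submxcol z j = submxcol v j -> z = v.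
Proof.
move=> hzv jzv; apply/mxcolP => l; case: (unliftP j l) => [l' ->|-> //].
by rewrite -!submxcol_hat hzv.
Qed.

Lemma mergeK X (x0 : X) (z : 'cV[X]_n) : merge x0 (hat j z) (submxcol z j) = z.
Proof. by apply: (merge_eq x0); rewrite ?hat_merge ?submxcol_merge. Qed.

Lemma monomial_hat (b : 'cV[nat]_n) (z : 'cV[C]_n) :
  monomial b z = monomial (hat j b) (hat j z) * monomial (submxcol b j) (submxcol z j).
Proof.
rewrite monomial_blocks (bigD1_ord j) //= mulrC; congr (_ * _).
by rewrite [RHS]monomial_blocks; apply: eq_bigr => l _; rewrite !submxcol_hat.
Qed.

Lemma sqnorm_hat (z : 'cV[C]_n) : sqnorm z = sqnorm (hat j z) + sqnorm (submxcol z j).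
Proof.
rewrite sqnorm_blocks (bigD1_ord j) //= addrC; congr (_ + _).
by rewrite [RHS]sqnorm_blocks; apply: eq_bigr => l _; rewrite submxcol_hat.
Qed.

Lemma multideg_hatP kappa (b : 'cV[nat]_n) : multideg k kappa b <->
  multideg_hat k j kappa (hat j b) /\ mdegree (submxcol b j) = kappa j.
Proof.
split=> [hb|[hb bj] l]; first by split=> [l|]; rewrite ?submxcol_hat hb.
by case: (unliftP j l) => [l' ->|->]; rewrite // -submxcol_hat hb.
Qed.

Lemma hat_mul_monomial a b :
  hat_mul a (monomial b) = ball_monomial (merge 0%N a b) :> cfun R n.
Proof.
apply/funext => z; rewrite /hat_mul /ball_monomial /ball_restrict.
by case: ifP => // _; rewrite monomial_hat hat_merge submxcol_merge.
Qed.

Lemma ball_monomial_hat b :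
  ball_monomial b = hat_mul (hat j b) (monomial (submxcol b j)) :> cfun R n.
Proof. by rewrite hat_mul_monomial mergeK. Qed.

Definition hat_index (d : nat) a : set 'cV[nat]_n :=
  [set b | hat j b = a /\ mdegree (submxcol b j) = d].

Lemma hat_term_monomials d a :
  hat_term R k j d a = lspan [set ball_monomial b | b in hat_index d a].
Proof.
rewrite /hat_term; congr lspan; apply/seteqP; split=> f [b hb <-].
  exists (merge 0%N a b); last by rewrite hat_mul_monomial.
  by split; rewrite ?hat_merge ?submxcol_merge.
by case: hb => <- bd; exists (submxcol b j) => //; rewrite ball_monomial_hat.
Qed.

Lemma monomial_hadamard N (b : 'cV[nat]_N) (w z : 'cV[C]_N) :
  monomial b (hadamard w z) = monomial b w * monomial b z.
Proof.
by rewrite /monomial -big_split /=; apply: eq_bigr => i _; rewrite mxE exprMn.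
Qed.

Definition phases N (w : 'cV[C]_N) := forall i, normc (w i 0) = 1.

Lemma sqnorm_hadamard N (w z : 'cV[C]_N) : phases w -> sqnorm (hadamard w z) = sqnorm z.
Proof.
by move=> w1; apply: eq_bigr => i _; rewrite mxE !normc2_normc normcM w1 mul1r.
Qed.

Lemma normc1_conj (t : C) : normc t = 1 -> t * t^* = 1.
Proof. by move=> t1; rewrite -normCK normrE_normc t1 expr1n. Qed.

(** The group element is the diagonal matrix of the conjugates of [w], because [unitary_rep]
    composes with the inverse. *)
Lemma unitary_rep_hadamard (w : 'cV[C]_n) t : phases w -> submxcol w j = const_mx t ->
  exists2 A, block_unitary k j A & forall f : cfun R n, unitary_rep A f = f \o hadamard w.
Proof.
move=> w1 wj; pose B l : 'M[C]_(k l) := diag_mx (map_mx Num.conj (submxcol w l))^T.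
pose B' l : 'M[C]_(k l) := diag_mx (submxcol w l)^T.
have BB' l : B l *m B' l = 1%:M.
  apply/matrixP => i i'; rewrite mul_diag_mx !mxE.
  by case: eqVneq => [->|_]; rewrite ?mulr1n ?mulr0n ?mulr0 // mulrC normc1_conj.
exists (\mxdiag_l B l).
  exists B; split=> // [l lj|].
    apply/unitarymxP; apply/matrixP => i i'; rewrite mul_diag_mx !mxE.
    case: eqVneq => [->|_]; rewrite ?mulr1n ?mulr0n ?conjC0 ?mulr0 //.
    by rewrite conjCK mulrC normc1_conj.
  (* If block [j] is empty, nothing forces |t| = 1, and the scalar 1 is taken instead. *)
  have [kj|kj] := posnP (k j).
    exists 1; first by rewrite normr1.
    by apply/matrixP => i; have := ltn_ord i; rewrite {2}kj.
  have tE : t = w (tagnat.Rank j (Ordinal kj)) 0.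
    by rewrite -submxcolE wj mxE.
  exists t^*; first by rewrite norm_conjC; apply/normr1_normc; rewrite tE.
  by rewrite /B wj map_const_mx trmx_const diag_const_mx.
move=> f; apply/funext => z; rewrite /unitary_rep /= (invmx_mxdiag_mul _ BB').
congr f; apply/mxcolP => l; rewrite mxcolK mul_diag_mx.
by apply/matrixP => i o; rewrite !mxE (ord1 o).
Qed.

End blocks.

(** * Torus equivariance *)

Section ball_spans.
Context {R : realType} (n : nat).
Local Notation C := (R[i]).
Implicit Types (f g : cfun R n) (S : set 'cV[nat]_n).

Lemma ball_restrictD f g : ball_restrict (f + g) = ball_restrict f + ball_restrict g.
Proof.
by apply/funext => z; rewrite /ball_restrict !fctE; case: ifP => // _; rewrite addr0.
Qed.

Lemma ball_restrictZ (c : C) f : ball_restrict (c *: f) = c *: ball_restrict f.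
Proof.
by apply/funext => z; rewrite /ball_restrict !fctE; case: ifP => // _; rewrite scaler0.
Qed.

Lemma ball_restrict0 : ball_restrict 0 = 0 :> cfun R n.
Proof. by apply/funext => z; rewrite /ball_restrict; case: ifP. Qed.

Lemma lspan_ball S f : lspan [set ball_monomial a | a in S] f <->
  exists2 F, lspan [set monomial a | a in S] F & f = ball_restrict F.
Proof.
split=> [|[F + ->]].
  apply: (lspan_ind (P := fun f => exists2 F, lspan [set monomial a | a in S] F &
    f = ball_restrict F)) => [|c _ g [a Sa <-] [F hF ->]].
    by exists 0; [exact: lspan0|rewrite ball_restrict0].
  exists (c *: (monomial a : cfun R n) + F); last by rewrite ball_restrictD ball_restrictZ.
  by apply: lspanD => //; apply/lspanZ/lspan_sub; exists a.
apply: (lspan_ind (P := fun F => lspan _ (ball_restrict F))).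
  by rewrite ball_restrict0; exact: lspan0.
move=> c _ g [a Sa <-] hg; rewrite ball_restrictD ball_restrictZ.
by apply: lspanD => //; apply/lspanZ/lspan_sub; exists a.
Qed.

Lemma lspan_monomial_polynomial S f : lspan [set monomial a | a in S] f -> polynomial_fun f.
Proof.
by move=> hf; apply: lspan_min hf => _ [a _ <-]; apply: lspan_sub; exists a.
Qed.

End ball_spans.

Section torus_equivariance.
Context {R : realType} (lambda : R) {m : nat} (k : 'I_m -> nat) (j : 'I_m).
Local Notation C := (R[i]).
Local Notation n := (\sum_l k l)%N.
Local Notation n' := (\sum_(l < m.-1) k (lift j l))%N.
Variable T : cfun R n -> cfun R n.
Hypothesis l1 : - 1 < lambda.
Hypothesis HT : bergman_End lambda (block_unitary k j) T.

Lemma End_stable f : bergman lambda f -> bergman lambda (T f).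
Proof. by case: HT => [[H _ _] _]; exact: H. Qed.

Lemma End_linear (a : C) f g : bergman lambda f -> bergman lambda g ->
  T (a *: f + g) = a *: T f + T g.
Proof. by case: HT => [[_ H _] _]; exact: H. Qed.

Lemma End_equivariant A f : block_unitary k j A -> bergman lambda f ->
  T (unitary_rep A f) = unitary_rep A (T f).
Proof. by case: HT => _; exact. Qed.

Lemma bergman0 : bergman lambda (0 : cfun R n).
Proof.
by rewrite -(ball_restrict0 n); apply: bergman_polynomial => //; exact: lspan0.
Qed.

Lemma End0 : T 0 = 0.
Proof.
have := End_linear 1 bergman0 bergman0; rewrite !scale1r addr0 => H.
by apply: (addrI (T 0)); rewrite addr0.
Qed.

Lemma EndZ (a : C) f : bergman lambda f -> T (a *: f) = a *: T f.
Proof.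
by move=> hf; have := End_linear a hf bergman0; rewrite End0 !addr0.
Qed.

Lemma bergman_ball_monomial a : bergman lambda (ball_monomial a : cfun R n).
Proof.
by apply: bergman_polynomial => //; apply: lspan_sub; exists a.
Qed.

Lemma ball_monomial_hadamard a (w z : 'cV[C]_n) : phases w ->
  ball_monomial a (hadamard w z) = monomial a w * ball_monomial a z.
Proof.
move=> w1; rewrite /ball_monomial /ball_restrict sqnorm_hadamard //.
by case: ifP => _; rewrite ?mulr0 // monomial_hadamard.
Qed.

Lemma End_monomial_hadamard a (w z : 'cV[C]_n) t : phases w -> submxcol w j = const_mx t ->
  T (ball_monomial a) (hadamard w z) = monomial a w * T (ball_monomial a) z.
Proof.
move=> w1 wj; have [A hA AE] := unitary_rep_hadamard w1 wj.
have ba := bergman_ball_monomial a.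
have := End_equivariant hA ba; rewrite !AE => /(congr1 (fun f => f z)) /= <-.
rewrite [_ \o _](_ : _ = monomial a w *: ball_monomial a); first by rewrite EndZ.
by apply/funext => v /=; rewrite ball_monomial_hadamard.
Qed.

Lemma monomial_const N (a : 'cV[nat]_N) (t : C) : monomial a (const_mx t) = t ^+ mdegree a.
Proof.
by rewrite /monomial /mdegree -prodrXr; apply: eq_bigr => i _; rewrite mxE.
Qed.

Lemma phases_const N (t : C) : normc t = 1 -> phases (const_mx t : 'cV[C]_N).
Proof. by move=> t1 i; rewrite mxE. Qed.

Lemma hadamard_const N (t : C) (z : 'cV[C]_N) : hadamard (const_mx t) z = t *: z.
Proof. by apply/matrixP => i o; rewrite !mxE (ord1 o). Qed.

Definition hat_torus := {p : 'cV[C]_n' * C | phases p.1 /\ normc p.2 = 1}.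

Definition torus_vector (p : hat_torus) : 'cV[C]_n :=
  merge 0 (sval p).1 (const_mx (sval p).2).

Definition torus_char (e : 'cV[nat]_n' * nat) (p : hat_torus) : C :=
  monomial e.1 (sval p).1 * (sval p).2 ^+ e.2.

Lemma phases_torus_vector p : phases (torus_vector p).
Proof.
case: p => [[th t] [th1 t1]] i; rewrite /torus_vector /=.
rewrite -(tagnat.sig2K i) -submxcolE.
case: (unliftP j (tagnat.sig1 i)) => [l' E|E].
  move: (tagnat.sig2 i); rewrite E => i'.
  by rewrite -submxcol_hat hat_merge submxcolE th1.
by move: (tagnat.sig2 i); rewrite E => i'; rewrite submxcol_merge mxE.
Qed.

Lemma monomial_torus_vector b p :
  monomial b (torus_vector p) = torus_char (hat j b, mdegree (submxcol b j)) p.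
Proof.
by rewrite (monomial_hat j) /torus_vector hat_merge submxcol_merge monomial_const.
Qed.

(** Different hat exponents are separated by a phase at one coordinate where they differ; if they
    agree, the common phase on block [j] separates the degrees. *)
Lemma torus_char_separate e e' : e != e' -> exists p, torus_char e p != torus_char e' p.
Proof.
case: e e' => [h d] [h' d'] ee'.
have one1 : normc (1 : C) = 1 by exact: normc1.
have [hh|hh] := eqVneq h h'.
  have dd : d != d' by apply: contra ee' => /eqP ->; rewrite hh.
  have [t [t1 td]] := @circle_injective_power R _ _ dd.
  exists (exist _ (const_mx 1, t) (conj (@phases_const n' 1 one1) t1)).
  by rewrite /torus_char /= !monomial_const !expr1n !mul1r.
have /existsP[i hi] : [exists i, h i 0 != h' i 0].
  apply: contraR hh; rewrite negb_exists => /forallP H.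
  apply/eqP/matrixP => i o; rewrite (ord1 o); apply/eqP.
  by have := H i; rewrite negbK.
have [t [t1 td]] := @circle_injective_power R _ _ hi.
pose th : 'cV[C]_n' := \col_l (if l == i then t else 1).
have th1 : phases th by move=> l; rewrite mxE; case: ifP.
have thE (b : 'cV[nat]_n') : monomial b th = t ^+ b i 0.
  rewrite /monomial (bigD1 i) //= mxE eqxx [X in _ * X]big1 ?mulr1 // => l /negbTE li.
  by rewrite mxE li expr1n.
exists (exist _ (th, 1) (conj th1 one1)).
by rewrite /torus_char /= !thE !expr1n !mulr1.
Qed.

Lemma End_ball_monomial (a : 'cV[nat]_n) : exists2 F,
  lspan [set monomial b | b in hat_index (mdegree (submxcol a j)) (hat j a)] F &
  T (ball_monomial a) = ball_restrict F.
Proof.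
set f := T (ball_monomial a).
have [fB holf _] : bergman lambda f := End_stable (bergman_ball_monomial a).
have fK t z : normc t = 1 -> f (t *: z) = t ^+ mdegree a * f z.
  move=> t1; rewrite -hadamard_const -monomial_const.
  apply: (@End_monomial_hadamard _ _ _ t); first exact: phases_const.
  by apply/matrixP => i o; rewrite !mxE.
pose F := homogeneous_extension f (mdegree a).
have pF : polynomial_fun F := homogeneous_extension_polynomial holf fK.
exists F; last first.
  rewrite -fB; apply/funext => z; rewrite /ball_restrict; case: ifP => // zB.
  by rewrite /F (homogeneous_extension_ball holf fK).
have := @lspan_weight C _ _ hat_torus _ (fun p z => hadamard (torus_vector p) z) torus_char
  (@monomial R n) (fun b => (hat j b, mdegree (submxcol b j))) setT
  (hat j a, mdegree (submxcol a j)) F torus_char_separate.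
have hm b p z : monomial b (hadamard (torus_vector p) z) =
    torus_char (hat j b, mdegree (submxcol b j)) p * monomial b z :> C.
  by rewrite monomial_hadamard monomial_torus_vector.
have hF p z : F (hadamard (torus_vector p) z) =
    torus_char (hat j a, mdegree (submxcol a j)) p * F z.
  (* The scaling factor in the extension depends only on the norm, so it is unchanged by the torus,
     and [F] inherits the weight of [f]. *)
  rewrite /F /homogeneous_extension sqnorm_hadamard; last exact: phases_torus_vector.
  rewrite -hadamardZ /f (@End_monomial_hadamard _ _ _ (sval p).2); last 2 first.
  - exact: phases_torus_vector.
  - by rewrite submxcol_merge.
  by rewrite monomial_torus_vector mulrCA.
move=> /(_ hm hF pF) hF'; apply: lspan_min hF' => _ [b [_ hb] <-].
by apply: lspan_sub; exists b => //; case: hb => <- <-.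
Qed.

End torus_equivariance.

(** * The direct sum decomposition *)

Lemma fsbig_uniq_seq (V : nmodType) (I : choiceType) (D : set I) (r : seq I) (v : I -> V) :
  uniq r -> [set` r] `<=` D -> (forall i, i \notin r -> v i = 0) ->
  \sum_(i \in D) v i = \sum_(i <- r) v i.
Proof.
move=> ur rD v0; rewrite (fsbigE r) //; last by move=> i _; exact: v0.
rewrite big_mkcond; apply: eq_big_seq => i ir.
by rewrite (_ : i \in D) // inE; exact: rD.
Qed.

Lemma finite_set_uniq_seq (I : choiceType) (A : set I) : finite_set A ->
  exists2 r : seq I, uniq r & forall i, (i \in r) = (i \in A).
Proof.
move=> /finite_seqP[r ->]; exists (undup r); first exact: undup_uniq.
by move=> i; rewrite mem_undup; apply/idP/idP; rewrite inE.
Qed.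

Lemma sum_fibers (V : nmodType) (I : finType) (E : eqType) (wt : I -> E) (r : seq E)
    (F : I -> V) : uniq r -> (forall i, wt i \in r) ->
  \sum_(e <- r) \sum_(i | wt i == e) F i = \sum_i F i.
Proof.
move=> ur wtr; rewrite (exchange_big_dep xpredT) //=; apply: eq_bigr => i _.
rewrite -big_filter (_ : [seq _ <- r | _] = [:: wt i]) ?big_seq1 //.
rewrite (eq_filter (a2 := pred1 (wt i))) ?filter_pred1_uniq //.
by move=> e /=; rewrite eq_sym.
Qed.

Section decomposition.
Context {R : realType} {m : nat} (k : 'I_m -> nat) (j : 'I_m).
Local Notation C := (R[i]).
Local Notation n := (\sum_l k l)%N.
Local Notation n' := (\sum_(l < m.-1) k (lift j l))%N.
Implicit Types (f g : cfun R n) (c : 'cV[nat]_n').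

Lemma hat_term_torus d c f (p : hat_torus k j) z : hat_term R k j d c f ->
  f (hadamard (torus_vector p) z) = torus_char (c, d) p * f z.
Proof.
rewrite hat_term_monomials => hf.
apply: (lspan_ind (P := fun f => f (hadamard (torus_vector p) z) =
  torus_char (c, d) p * f z)) hf => [|a _ g [b [hb bd] <-] IH].
  exact/esym/mulr0.
rewrite !fctE IH /GRing.scale /= ball_monomial_hadamard; last exact: phases_torus_vector.
by rewrite monomial_torus_vector hb bd; ring.
Qed.

Lemma hat_term_sub_multihomog kappa c f : multideg_hat k j kappa c ->
  hat_term R k j (kappa j) c f -> multihomog_poly R k kappa f.
Proof.
rewrite hat_term_monomials => hc; apply: lspan_min => _ [b [hb bd] <-].
by apply: lspan_sub; exists b => //; apply/(multideg_hatP j); rewrite hb.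
Qed.

(** Existence groups monomials by their hat exponent. For uniqueness, terms with different hat
    exponents have different torus characters, so differences of components that add up to 0 vanish
    one by one. *)
Lemma multihomog_direct_sum kappa :
  is_direct_sum (multideg_hat k j kappa) (hat_term R k j (kappa j))
    (multihomog_poly R k kappa).
Proof.
split.
  apply/seteqP; split=> [f [N [e [s [hs fE]]]]|_ [w [w1 w2 w3] <-]].
    have /choice[a ha] i : exists a, multideg k kappa a /\ ball_monomial a = s i.
      by have [a] := hs i; exists a.
    pose w c : cfun R n := \sum_(i | hat j (a i) == c) e i *: ball_monomial (a i).
    pose r := undup [seq hat j (a i) | i <- enum 'I_N].
    have air i : hat j (a i) \in r.
      by rewrite mem_undup; apply/mapP; exists i; rewrite ?mem_enum.
    have rD : [set` r] `<=` multideg_hat k j kappa.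
      move=> c /=; rewrite mem_undup => /mapP[i _ ->].
      by have [/(multideg_hatP j)[]] := ha i.
    have w0 c : c \notin r -> w c = 0.
      move=> cr; apply: big1 => i /eqP ic; move: cr.
      by rewrite -ic air.
    exists w.
      split.
      - move=> c hc; rewrite hat_term_monomials; apply: lspan_sum => i /eqP ic.
        apply/lspanZ/lspan_sub; exists (a i) => //.
        by have [/(multideg_hatP j)[]] := ha i.
      - by move=> c hc; apply: w0; apply: contra_notN hc => cr; exact: rD.
      - apply: sub_finite_set (finite_seq r) => c /= wc.
        by apply: contrapT => /negP /w0.
    rewrite (fsbig_uniq_seq (undup_uniq _) rD w0).
    rewrite /w sum_fibers ?undup_uniq // fE; apply: eq_bigr => i _.
    by have [_ ->] := ha i.
  have [r ur rE] := finite_set_uniq_seq w3.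
  have w0 c : c \notin r -> w c = 0 by rewrite rE notin_setE /= => /contrapT.
  have rD : [set` r] `<=` multideg_hat k j kappa.
    by move=> c /=; rewrite rE inE /= => wc; apply: contrapT => /w2.
  rewrite (fsbig_uniq_seq ur rD w0) big_seq; apply: lspan_sum => c /rD cD.
  by apply: (hat_term_sub_multihomog cD); exact: w1.
move=> w w' /set_mem[w1 w2 w3] /set_mem[w'1 w'2 w'3] ww'.
have [|r ur rE] := @finite_set_uniq_seq _ ([set c | w c <> 0] `|` [set c | w' c <> 0]).
  by rewrite finite_setU.
have rP c : c \notin r -> w c = 0 /\ w' c = 0.
  by rewrite rE notin_setE /= => /not_orP[/contrapT ? /contrapT ?].
have rD : [set` r] `<=` multideg_hat k j kappa.
  move=> c /=; rewrite rE inE /= => wc; apply: contrapT => cD.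
  by case: wc; rewrite ?w2 ?w'2.
have H c z : c \in r -> w c z - w' c z = 0.
  apply: (@characters_independent C _ (hat_torus k j) _
    (fun p z => hadamard (torus_vector p) z) (fun c p => torus_char (c, kappa j) p) r
    (fun c z => w c z - w' c z)) => //.
  - move=> e e' ee'; apply: torus_char_separate.
    by apply: contra ee' => /eqP[->].
  - move=> e p v er; have eD : multideg_hat k j kappa e by exact: rD.
    rewrite (hat_term_torus p v (w1 _ eD)) (hat_term_torus p v (w'1 _ eD)).
    by rewrite mulrBr.
  - move=> v; rewrite sumrB; move: ww' => /=.
    rewrite (fsbig_uniq_seq ur rD (fun e er => (rP e er).1)).
    rewrite (fsbig_uniq_seq ur rD (fun e er => (rP e er).2)).
    by move=> /(congr1 (fun f => f v)); rewrite !fct_sumE => ->; rewrite subrr.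
apply/funext => c; have [cr|/rP[-> ->]//] := boolP (c \in r).
by apply/funext => z; apply/eqP; rewrite -subr_eq0 H.
Qed.

End decomposition.

(** * Orthogonality *)

Section orthogonality.
Context {R : realType} (lambda : R) {m : nat} (k : 'I_m -> nat) (j : 'I_m).
Local Notation C := (R[i]).
Local Notation n := (\sum_l k l)%N.
Local Notation n' := (\sum_(l < m.-1) k (lift j l))%N.
Local Notation tup N := (N.-tuple (measurableTypeR R)).
Variable T : cfun R n -> cfun R n.
Hypothesis l1 : - 1 < lambda.
Hypothesis HT : bergman_End lambda (block_unitary k j) T.

Lemma bergman_hat_term d c f : hat_term R k j d c f -> bergman lambda f.
Proof.
rewrite hat_term_monomials => /lspan_ball[F hF ->].
apply: bergman_polynomial => //; exact: lspan_monomial_polynomial hF.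
Qed.

Lemma End_hat_term d c f : hat_term R k j d c f -> hat_term R k j d c (T f).
Proof.
(* The membership of [f] itself is carried along: it puts the partial sums in the Bergman space,
   where [T] is linear. *)
move=> hf; suff [] : hat_term R k j d c f /\ hat_term R k j d c (T f) by [].
move: hf; rewrite {1}hat_term_monomials.
apply: (lspan_ind (P := fun f => hat_term R k j d c f /\ hat_term R k j d c (T f))).
  by rewrite (End0 l1 HT); split; exact: lspan0.
move=> a _ g [b hb <-] [hg hTg].
have hbm : hat_term R k j d c (ball_monomial b).
  by rewrite hat_term_monomials; apply: lspan_sub; exists b.
split; first by apply: lspanD => //; exact: lspanZ.
rewrite (End_linear HT) //; [|exact: bergman_hat_term hbm|exact: bergman_hat_term hg].
suff H : hat_term R k j d c (T (ball_monomial b)) by apply: lspanD => //; exact: lspanZ.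
have [F hF ->] := End_ball_monomial l1 HT b.
case: hb => hb bd; move: hF; rewrite hb bd => hF.
by rewrite hat_term_monomials; apply/lspan_ball; exists F.
Qed.

Lemma bergman_int_eq (h1 h2 : 'cV[C]_n -> R) : (forall z, sqnorm z < 1 -> h1 z = h2 z) ->
  bergman_int lambda h1 = bergman_int lambda h2.
Proof.
move=> h12; apply: eq_Rintegral => x; rewrite inE => xB.
by rewrite h12.
Qed.

Lemma bergman_int_linear (a b : R) (h1 h2 : 'cV[C]_n -> R) (M1 M2 : R) :
  measurable_fun setT (fun x : tup n.*2 => h1 (cvec_of x)) ->
  measurable_fun setT (fun x : tup n.*2 => h2 (cvec_of x)) ->
  (forall z, sqnorm z < 1 -> `|h1 z| <= M1) -> (forall z, sqnorm z < 1 -> `|h2 z| <= M2) ->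
  bergman_int lambda (fun z => a * h1 z + b * h2 z) =
  a * bergman_int lambda h1 + b * bergman_int lambda h2.
Proof.
move=> mh1 mh2 hM1 hM2.
have i1 := integrable_ball_bounded l1 mh1 hM1.
have i2 := integrable_ball_bounded l1 mh2 hM2.
have mB := @measurable_unit_ball R n.
rewrite /bergman_int -(RintegralZl _ mB i1) -(RintegralZl _ mB i2) -RintegralD //.
- by apply: eq_Rintegral => x _; ring.
- by have := integrableZl mB a i1; apply: eq_integrable.
- by have := integrableZl mB b i2; apply: eq_integrable.
Qed.

(** Rotating one coordinate multiplies the integrand by [t ^+ a s * (t ^+ b s)^*]. *)
Lemma End_monomial_orthogonal (a b : 'cV[nat]_n) : hat j a != hat j b ->
  bergman_inner lambda (T (ball_monomial a)) (ball_monomial b) = 0.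
Proof.
move=> ab.
have [i hi] : exists i, hat j a i 0 != hat j b i 0.
  apply/existsP; apply: contraR ab; rewrite negb_exists => /forallP H.
  apply/eqP/matrixP => i o; rewrite (ord1 o); apply/eqP.
  by have := H i; rewrite negbK.
(* The coordinate of C^n that [hat] lists at position [i]. *)
pose s := tagnat.Rank (lift j (tagnat.sig1 i)) (tagnat.sig2 i).
have hatE X (z : 'cV[X]_n) : hat j z i 0 = z s 0 by rewrite !mxE.
rewrite !hatE in hi.
have [t [t1 tab]] := @circle_injective_power R _ _ hi.
have tn0 e : t ^+ e != 0 by rewrite expf_neq0 // -normc_gt0 t1.
pose w : 'cV[C]_n := \col_l (if l == s then t else 1).
have w1 : phases w by move=> l; rewrite mxE; case: ifP => _ //; exact: normc1.
have wE (e : 'cV[nat]_n) : monomial e w = t ^+ e s 0.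
  rewrite /monomial (bigD1 s) //= mxE eqxx [X in _ * X]big1 ?mulr1 // => l /negbTE ls.
  by rewrite mxE ls expr1n.
have rotE z : coord_rot s t z = hadamard w z.
  by apply/matrixP => l o; rewrite !mxE; case: ifP; rewrite ?mul1r.
have [F hF TF] := End_ball_monomial l1 HT a.
have Frot z : F (coord_rot s t z) = t ^+ a s 0 * F z.
  rewrite rotE; apply: (lspan_ind (P := fun F => F (hadamard w z) = t ^+ a s 0 * F z)) hF.
    exact/esym/mulr0.
  move=> c _ g [e [he _] <-] IH.
  rewrite !fctE IH /GRing.scale /= monomial_hadamard wE.
  have -> : e s 0 = a s 0 by rewrite -!hatE he.
  by rewrite mulrDr mulrCA.
have pF := lspan_monomial_polynomial hF.
have pM : polynomial_fun (monomial b : cfun R n) by apply: lspan_sub; exists b.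
pose G z := F z * (monomial b z)^*.
pose tau := t ^+ a s 0 * (t ^+ b s 0)^*.
have Grot z : G (coord_rot s t z) = tau * G z.
  rewrite /G Frot rotE monomial_hadamard wE rmorphM /tau /=; exact: mulrACA.
(* As |t| = 1, conjugation inverts [t ^+ b s 0], so [tau = 1] would equate the two powers of [t]. *)
have tau1 : tau != 1.
  apply: contra tab => /eqP H; apply/eqP.
  have tb1 : normc (t ^+ b s 0) = 1.
    by elim: (b s 0) => [|e IH]; rewrite ?normc1 // exprS normcM t1 IH mul1r.
  have := congr1 (fun x => x * t ^+ b s 0) H.
  by rewrite /tau /= mul1r -mulrA (mulrC _ (t ^+ b s 0)) normc1_conj // mulr1.
have [mF1 mF2] := measurable_polynomial_fun pF.
have [mM1 mM2] := measurable_polynomial_fun pM.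
have [B1 hB1] := bounded_polynomial_fun pF.
have [B2 hB2] := bounded_polynomial_fun pM.
have GB z : sqnorm z < 1 -> normc (G z) <= B1 * B2.
  move=> zB; rewrite /G normcM ler_pM ?normc_ge0 ?hB1 //.
  by rewrite conjE /= sqrrN; have := hB2 z zB; case: (monomial b z).
pose u z := complex.Re (G z); pose v z := complex.Im (G z).
have mu : measurable_fun setT (fun x : tup n.*2 => u (cvec_of x)).
  rewrite (_ : (fun _ => _) = fun x : tup n.*2 =>
    complex.Re (F (cvec_of x)) * complex.Re (monomial b (cvec_of x)) +
    complex.Im (F (cvec_of x)) * complex.Im (monomial b (cvec_of x))).
    by apply: measurable_funD; exact: measurable_funM.
  apply/funext => x; rewrite /u /G conjE.
  by case: (F _) (monomial _ _) => [? ?] [? ?] /=; rewrite mulrN opprK.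
have mv : measurable_fun setT (fun x : tup n.*2 => v (cvec_of x)).
  rewrite (_ : (fun _ => _) = fun x : tup n.*2 =>
    complex.Im (F (cvec_of x)) * complex.Re (monomial b (cvec_of x)) -
    complex.Re (F (cvec_of x)) * complex.Im (monomial b (cvec_of x))).
    by apply: measurable_funB; exact: measurable_funM.
  apply/funext => x; rewrite /v /G conjE.
  by case: (F _) (monomial _ _) => [? ?] [? ?] /=; rewrite mulrN addrC.
have uB z : sqnorm z < 1 -> `|u z| <= B1 * B2.
  by move=> /GB; apply: le_trans; exact: ler_Re_normc.
have vB z : sqnorm z < 1 -> `|v z| <= B1 * B2.
  by move=> /GB; apply: le_trans; exact: ler_Im_normc.
have E z : sqnorm z < 1 -> T (ball_monomial a) z * (ball_monomial b z)^* = G z.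
  by move=> zB; rewrite TF /ball_monomial /ball_restrict zB.
set X := bergman_int lambda u; set Y := bergman_int lambda v.
have -> : bergman_inner lambda (T (ball_monomial a)) (ball_monomial b) = (X +i* Y)%C.
  rewrite /bergman_inner; congr (_ +i* _)%C; apply: bergman_int_eq => z zB.
    by rewrite (E z zB).
  by rewrite (E z zB).
have tt1 : complex.Re t ^+ 2 + complex.Im t ^+ 2 = 1.
  by have := normc2_normc t; rewrite t1 expr1n.
(* [HX] and [HY] are the real and imaginary parts of X + i Y = tau (X + i Y), which rotation
   invariance gives. *)
have HX : X = complex.Re tau * X + (- complex.Im tau) * Y.
  rewrite -(bergman_int_linear _ _ mu mv uB vB) -[LHS](bergman_int_rot lambda s tt1 mu).
  congr (bergman_int lambda _); apply/funext => z /=; rewrite /u /v Grot.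
  by case: (tau) (G z) => [? ?] [? ?] /=; rewrite mulNr.
have HY : Y = complex.Im tau * X + complex.Re tau * Y.
  rewrite -(bergman_int_linear _ _ mu mv uB vB) -[LHS](bergman_int_rot lambda s tt1 mv).
  congr (bergman_int lambda _); apply/funext => z /=; rewrite /u /v Grot.
  by case: (tau) (G z) => [? ?] [? ?] /=; rewrite addrC.
have : (tau - 1) * (X +i* Y)%C = 0.
  move: HX HY; case: (tau) => p q /= HX HY.
  apply/eqP; rewrite eq_complex /=; apply/andP; split; apply/eqP.
    by move: HX; clear; lra.
  by move: HY; clear; lra.
by move=> /eqP; rewrite mulf_eq0 subr_eq0 (negbTE tau1) => /eqP.
Qed.

End orthogonality.

(** * Reflections and block substitutions *)

Section reflection.
Context {R : realType} (N : nat).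
Local Notation C := (R[i]).

Definition first_unit : 'cV[C]_N := \col_i (i == 0%N :> nat)%:R.

(** The entries of the normal vector are chosen such that the reflection maps
    [first_unit] to a vector without zero coordinates. *)
Definition normal_weight (i : 'I_N) : nat := if i == 0%N :> nat then N else 1%N.

Definition normal : 'cV[C]_N := \col_i (normal_weight i)%:R.

Definition normal_sqnorm : nat := (\sum_i normal_weight i ^ 2)%N.

Definition reflection : 'M[C]_N :=
  1%:M - (2 / normal_sqnorm%:R) *: (normal *m normal^T).

Lemma mul_normal : normal^T *m normal = normal_sqnorm%:R%:M.
Proof.
apply/matrixP => o o'; rewrite !ord1 !mxE eqxx mulr1n /normal_sqnorm natr_sum.
by apply: eq_bigr => i _; rewrite !mxE natrX.
Qed.

Lemma normal_sqnorm_gt0 : (0 < N)%N -> (0 < normal_sqnorm)%N.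
Proof.
move=> N0; rewrite /normal_sqnorm (bigD1 (Ordinal N0)) //= addn_gt0.
by rewrite /normal_weight eqxx expn_gt0 N0.
Qed.

Lemma reflectionK : reflection *m reflection = 1%:M.
Proof.
have [N0|N0] := posnP N.
  by apply/matrixP => i; have := ltn_ord i; rewrite {2}N0.
have q0 : normal_sqnorm%:R != 0 :> C by rewrite pnatr_eq0 -lt0n normal_sqnorm_gt0.
rewrite /reflection; set u := _ *: _.
have uu : u *m u = u + u.
  rewrite /u -scalemxAl -scalemxAr scalerA mulmxA -(mulmxA normal) mul_normal.
  rewrite mul_mx_scalar -scalemxAl scalerA -mulrA divfK // -scalerDl.
  by congr (_ *: _); rewrite mulr_natr mulr2n.
by rewrite mulmxBl mul1mx mulmxBr mulmx1 uu opprB addrK subrK.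
Qed.

Lemma reflection_adjoint : map_mx Num.conj reflection^T = reflection.
Proof.
apply/matrixP => i l; rewrite !mxE !big_ord1 !mxE.
rewrite rmorphB !rmorphM fmorphV !rmorph_nat eq_sym; congr (_ - _ * _).
exact: mulrC.
Qed.

Lemma reflection_unitary : reflection \is unitarymx.
Proof.
apply/unitarymxP; rewrite (_ : map_mx _ _ = reflection) ?reflectionK //.
exact: reflection_adjoint.
Qed.

(** With q = N^2 + N - 1 the squared norm of the normal, the image has entries 1 - 2 N^2 / q and - 2
    N / q. The first vanishes only if N - 1 = N^2, which is impossible. With all weights equal to 1
    it would vanish for N = 2. *)
Lemma reflection_first_unit i : (reflection *m first_unit) i 0 != 0.
Proof.
have N0 : (0 < N)%N by apply: leq_ltn_trans (ltn_ord i).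
have E : normal^T *m first_unit = N%:R%:M.
  apply/matrixP => o o'; rewrite !ord1 !mxE eqxx mulr1n (bigD1 (Ordinal N0)) //=.
  rewrite !mxE /normal_weight eqxx mulr1 [X in _ + X]big1 ?addr0 // => l l0.
  by rewrite !mxE (_ : (l == 0%N :> nat) = false) ?mulr0 //; apply/negbTE.
have q0 : normal_sqnorm%:R != 0 :> C by rewrite pnatr_eq0 -lt0n normal_sqnorm_gt0.
rewrite /reflection mulmxBl mul1mx -scalemxAl -mulmxA E mul_mx_scalar scalerA !mxE.
rewrite /normal_weight; have [i0|i0] := eqVneq (i : nat) 0%N; last first.
  by rewrite sub0r mulr1 oppr_eq0 !mulf_neq0 ?invr_eq0 // pnatr_eq0 -lt0n.
have qE : normal_sqnorm = (N ^ 2 + N.-1)%N.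
  rewrite /normal_sqnorm (bigD1 (Ordinal N0)) //= {1}/normal_weight eqxx; congr addn.
  rewrite (eq_bigr (fun=> 1%N)) ?sum1_card ?cardC1 ?card_ord // => l l0.
  by rewrite /normal_weight (_ : (l == 0%N :> nat) = false) //; apply/negbTE.
rewrite subr_eq0; apply/eqP => H.
have : normal_sqnorm%:R = (2 * N * N)%:R :> C.
  rewrite !natrM -[LHS](mulr1) {2}(_ : 1 = true%:R) // H.
  by move: q0; set q := _%:R => q0; field.
move=> /eqP; rewrite eqr_nat qE -mulnA mulnn mul2n -addnn => /eqP /addnI NE.
by move: (leq_pmull N N0); rewrite mulnn -NE leqNgt prednK ?leqnn.
Qed.

End reflection.

Section unitary.
Context {R : realType}.
Local Notation C := (R[i]).

Lemma sqnorm_adjoint n (z : 'cV[C]_n) :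
  (map_mx Num.conj z^T *m z) 0 0 = (sqnorm z)%:C%C.
Proof.
rewrite mxE /sqnorm rmorph_sum /=; apply: eq_bigr => i _; rewrite !mxE conjE.
case: (z i 0) => x y; apply/eqP; rewrite eq_complex /normc2 /=.
by apply/andP; split; apply/eqP; ring.
Qed.

Lemma sqnorm_unitary n (B : 'M[C]_n) (z : 'cV[C]_n) :
  map_mx Num.conj B^T *m B = 1%:M -> sqnorm (B *m z) = sqnorm z.
Proof.
move=> BB; apply: (@complexI R); rewrite -!sqnorm_adjoint.
by rewrite trmx_mul map_mxM mulmxA -(mulmxA _ _ B) BB mulmx1.
Qed.

End unitary.

Section block_substitution.
Context {R : realType} {m : nat} (k : 'I_m -> nat).
Local Notation C := (R[i]).
Local Notation n := (\sum_l k l)%N.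

Definition block_scale (t : 'I_m -> C) (z : 'cV[C]_n) : 'cV[C]_n :=
  \mxcol_l (t l *: submxcol z l).

Lemma monomial_block_scale (a : 'cV[nat]_n) t z :
  monomial a (block_scale t z) =
  (\prod_l t l ^+ mdegree (submxcol a l)) * monomial a z.
Proof.
rewrite !monomial_blocks -big_split /=; apply: eq_bigr => l _.
by rewrite mxcolK monomialZ.
Qed.

(** A block diagonal substitution commutes with scaling each block separately, so the block degrees,
    which are the weights of this scaling, are preserved. Scaling one block by 2 separates the
    weights. *)
Lemma lspan_monomial_mxdiag (B : forall l, 'M[C]_(k l)) (a : 'cV[nat]_n) :
  lspan [set monomial b | b in multideg k (fun l => mdegree (submxcol a l))]
    (fun z => monomial a (\mxdiag_l B l *m z)).
Proof.
pose wt (b : 'cV[nat]_n) := [ffun l => mdegree (submxcol b l)].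
pose chi (e : {ffun 'I_m -> nat}) (t : 'I_m -> C) := \prod_l t l ^+ e l.
have sep e e' : e != e' -> exists t, chi e t != chi e' t.
  move=> ee'; have /existsP[l el] : [exists l, e l != e' l].
    apply: contraR ee'; rewrite negb_exists => /forallP H.
    by apply/eqP/ffunP => l; apply/eqP; have := H l; rewrite negbK.
  have chiE (d : {ffun 'I_m -> nat}) :
      chi d (fun l' => if l' == l then 2 else 1) = 2 ^+ d l.
    rewrite /chi (bigD1 l) //= eqxx big1 ?mulr1 // => l' /negbTE ->.
    by rewrite expr1n.
  exists (fun l' => if l' == l then 2 else 1); rewrite !chiE -!natrX eqr_nat.
  by rewrite eqn_exp2l.
have hm b t z : monomial b (block_scale t z) = chi (wt b) t * monomial b z.
  by rewrite monomial_block_scale; congr (_ * _); apply: eq_bigr => l _; rewrite ffunE.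
have := @lspan_weight C _ _ _ _ block_scale chi (@monomial R n) wt setT (wt a)
  (fun z => monomial a (\mxdiag_l B l *m z)) sep hm.
set H := (X in (X -> _) -> _); have hH : H.
  move=> t z; rewrite -hm; congr monomial.
  rewrite !mul_mxdiag_submxcol /block_scale; apply: eq_mxcol => l.
  by rewrite !mxcolK scalemxAr.
move=> /(_ hH) hF; have {}hF := hF _.
suff pF : polynomial_fun (fun z => monomial a (\mxdiag_l B l *m z)).
  apply: lspan_min (hF pF) => _ [b [_ hb] <-]; apply: lspan_sub; exists b => // l.
  by have /ffunP/(_ l) := hb; rewrite !ffunE.
apply: polynomial_fun_prod => i _; apply: polynomial_fun_exp.
rewrite (_ : (fun _ => _) =
    fun z : 'cV[C]_n => \sum_l (\mxdiag_l B l) i l * z l 0); last first.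
  by apply/funext => z; rewrite mxE.
apply: polynomial_fun_sum => l _; apply: polynomial_funM.
  exact: polynomial_fun1.
exact: polynomial_fun_coord.
Qed.

Definition first_units : 'cV[C]_n := \mxcol_l first_unit (k l).

Definition pure_power (d : 'I_m -> nat) : 'cV[nat]_n :=
  \mxcol_l \col_i (if i == 0%N :> nat then d l else 0%N).

(** Only the first coordinate of each block is nonzero at this point, so a monomial that survives
    has no other exponents, and the block degrees determine it. *)
Lemma monomial_first_units d (a : 'cV[nat]_n) (c : C) : multideg k d a ->
  a != pure_power d -> monomial a (c *: first_units) = 0.
Proof.
move=> ad; apply: contraNeq => a0; apply/eqP/mxcolP => l; rewrite mxcolK.
have H (i : 'I_(k l)) : (i != 0%N :> nat) -> submxcol a l i 0 = 0%N.
  move=> i0; apply: contraNeq a0 => ai.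
  rewrite /monomial (bigD1 (tagnat.Rank l i)) //= mxE -submxcolE mxcolK mxE.
  by rewrite (negbTE i0) mulr0 -submxcolE expr0n (negbTE ai) mul0r.
apply/matrixP => i o; rewrite (ord1 o) [RHS]mxE; case: ifPn => [/eqP i0|/H //].
rewrite -(ad l) /mdegree (bigD1 i) //= -[LHS]addn0; congr (_ + _)%N.
by apply/esym/big1 => i' ii'; apply: H; apply: contra ii' => /eqP i'0; apply/eqP/val_inj; rewrite /= i0.
Qed.

Lemma monomial_neq0 N (a : 'cV[nat]_N) (z : 'cV[C]_N) :
  (forall i, z i 0 != 0) -> monomial a z != 0.
Proof. by move=> z0; apply/prodf_neq0 => i _; rewrite expf_neq0. Qed.

End block_substitution.

(** * Independence of the hat exponent *)

Section independence.
Context {R : realType} (lambda : R) {m : nat} (k : 'I_m -> nat) (j : 'I_m).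
Local Notation C := (R[i]).
Local Notation n := (\sum_l k l)%N.
Local Notation n' := (\sum_(l < m.-1) k (lift j l))%N.
Variable T : cfun R n -> cfun R n.
Hypothesis l1 : - 1 < lambda.
Hypothesis HT : bergman_End lambda (block_unitary k j) T.

Lemma hat_term_hat_mul d (c : 'cV[nat]_n') p : homog_poly d p ->
  hat_term R k j d c (hat_mul c p).
Proof.
apply: (lspan_ind (P := fun p => hat_term R k j d c (hat_mul c p))).
  rewrite (_ : hat_mul _ _ = 0); first exact: lspan0.
  by apply/funext => z; rewrite /hat_mul /ball_restrict mulr0; case: ifP.
move=> x _ g [b hb <-] IH.
rewrite (_ : hat_mul _ _ = x *: hat_mul c (monomial b) + hat_mul c g).
  by apply: lspanD => //; apply/lspanZ/lspan_sub; exists b.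
apply/funext => z; rewrite !fctE /hat_mul /ball_restrict; case: ifP => _.
  by rewrite mulrDr scalerAr.
by rewrite scaler0 addr0.
Qed.

Lemma hat_termP d (c : 'cV[nat]_n') f : hat_term R k j d c f ->
  exists2 p, homog_poly d p & f = hat_mul c p.
Proof.
apply: (lspan_ind (P := fun f => exists2 p, homog_poly d p & f = hat_mul c p)).
  exists 0; first exact: lspan0.
  by apply/funext => z; rewrite /hat_mul /ball_restrict mulr0; case: ifP.
move=> x _ g [b hb <-] [p hp ->]; exists (x *: (monomial b : cfun R (k j)) + p).
  by apply: lspanD => //; apply/lspanZ/lspan_sub; exists b.
apply/funext => z; rewrite !fctE /hat_mul /ball_restrict; case: ifP => _.
  by rewrite mulrDr scalerAr.
by rewrite scaler0 addr0.
Qed.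

Lemma End_hat_mul d (c : 'cV[nat]_n') p : homog_poly d p ->
  exists2 q, homog_poly d q & T (hat_mul c p) = hat_mul c q.
Proof.
by move=> hp; apply: hat_termP; apply: (End_hat_term l1 HT); exact: hat_term_hat_mul.
Qed.

Definition block_reflection l : 'M[C]_(k l) := if l == j then 1%:M else reflection (k l).

Lemma block_reflectionK l : block_reflection l *m block_reflection l = 1%:M.
Proof. by rewrite /block_reflection; case: ifP => _; rewrite ?mulmx1 ?reflectionK. Qed.

Lemma block_reflection_adjoint l :
  map_mx Num.conj (block_reflection l)^T = block_reflection l.
Proof.
rewrite /block_reflection; case: ifP => _; last exact: reflection_adjoint.
by rewrite trmx1 map_mx1.
Qed.

Local Notation A := (\mxdiag_l block_reflection l).
Local Notation A' := (\mxdiag_(l < m.-1) block_reflection (lift j l)).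

Lemma block_unitary_reflection : block_unitary k j A.
Proof.
exists block_reflection; split=> // [l lj|].
  by rewrite /block_reflection (negbTE lj); exact: reflection_unitary.
by exists 1; rewrite ?normr1 // /block_reflection eqxx.
Qed.

Lemma invmx_block_reflection (z : 'cV[C]_n) : invmx A *m z = A *m z.
Proof. by rewrite (invmx_mxdiag_mul _ block_reflectionK) mul_mxdiag_submxcol. Qed.

Lemma sqnorm_block_reflection (z : 'cV[C]_n) : sqnorm (A *m z) = sqnorm z.
Proof.
rewrite mul_mxdiag_submxcol !sqnorm_blocks; apply: eq_bigr => l _.
by rewrite mxcolK sqnorm_unitary // block_reflection_adjoint block_reflectionK.
Qed.

Lemma hat_block_reflection (z : 'cV[C]_n) : hat j (A *m z) = A' *m hat j z.
Proof.
rewrite !mul_mxdiag_submxcol; apply: eq_mxcol => l.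
by rewrite mxcolK submxcol_hat.
Qed.

Lemma submxcol_block_reflection (z : 'cV[C]_n) : submxcol (A *m z) j = submxcol z j.
Proof. by rewrite mul_mxdiag_submxcol mxcolK /block_reflection eqxx mul1mx. Qed.

Local Notation e := (@first_units R m.-1 (fun l => k (lift j l))).

Lemma monomial_block_reflection (c : 'cV[nat]_n') (r : C) : r != 0 ->
  monomial c (A' *m (r *: e)) != 0.
Proof.
move=> r0; apply: monomial_neq0 => i.
rewrite -scalemxAr mxE mulf_neq0 // mul_mxdiag_submxcol -(tagnat.sig2K i) -submxcolE.
rewrite !mxcolK /block_reflection [_ == j]eq_sym (negbTE (neq_lift _ _)).
exact: reflection_first_unit.
Qed.

Lemma first_units_ball (w : 'cV[C]_(k j)) : sqnorm w < 1 ->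
  exists2 r : C, r != 0 & sqnorm (merge 0 (r *: e) w) < 1.
Proof.
move=> w1; have w0 := sqnorm_ge0 w; have e0 := sqnorm_ge0 e.
have e1 : 0 < 1 + sqnorm e by rewrite ltr_wpDr.
(* Since [r <= 1], r^2 |e|^2 <= r |e|^2 < r (1 + |e|^2) = 1 - |w|^2. *)
pose r := (1 - sqnorm w) / (1 + sqnorm e).
have r0 : 0 < r by rewrite divr_gt0 // subr_gt0.
have rE : r * (1 + sqnorm e) = 1 - sqnorm w by rewrite divfK // gt_eqF.
exists r%:C%C.
  by rewrite -(rmorph0 (real_complex R)) (inj_eq (@complexI R)) gt_eqF.
rewrite (sqnorm_hat j) hat_merge submxcol_merge sqnormZ.
move: (sqnorm e) (sqnorm w) r w0 w1 e0 r0 rE; clear => S W r w0 w1 e0 r0 rE.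
have rS : 0 <= r * S by rewrite mulr_ge0 // ltW.
have : r * (r * S) <= r * S by rewrite ler_piMl //; lra.
by rewrite expr2 -mulrA; lra.
Qed.

(** Evaluating [T (F \o A) = T F \o A] at a point whose hat part is a multiple of [e]:
    of the monomials in the expansion of [monomial c (A' *m _)], only [pure_power d']
    does not vanish there. *)
Lemma End_hat_mul_pure_power (d : nat) (d' : 'I_m.-1 -> nat) (S : 'cV[nat]_n' -> cfun R (k j))
    p (c : 'cV[nat]_n') (w : 'cV[C]_(k j)) : homog_poly d p ->
  (forall c, T (hat_mul c p) = hat_mul c (S c)) ->
  multideg (fun l => k (lift j l)) d' c -> sqnorm w < 1 ->
  S c w = S (pure_power (fun l => k (lift j l)) d') w.
Proof.
move=> hp hS hc w1; have [r r0 zB] := first_units_ball w1.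
set z := merge _ _ _ in zB; set a0 := pure_power _ _.
pose V : set (cfun R n) := lspan [set ball_monomial a | a in setT].
have VB f : V f -> bergman lambda f.
  by move=> /lspan_ball[G hG ->]; exact: bergman_polynomial.
have hV b : V (hat_mul b p).
  have := hat_term_hat_mul b hp; rewrite hat_term_monomials.
  by apply: lspan_min => _ [b' _ <-]; apply: lspan_sub; exists b'.
have hz : hat j z = r *: e by rewrite hat_merge.
have jz : submxcol z j = w by rewrite submxcol_merge.
pose ext (f : cfun R n') : cfun R n :=
  ball_restrict (fun z => f (hat j z) * p (submxcol z j)).
(* By linearity, [T] at the point [z] sees only the coefficient of [a0] in [f], and f (r e) is that
   coefficient times the value of the monomial [a0]. *)
have key (f : cfun R n') :
    lspan [set monomial b | b in multideg (fun l => k (lift j l)) d'] f ->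
    V (ext f) /\ T (ext f) z = f (r *: e) * S a0 w.
  apply: (lspan_ind (P := fun f => V (ext f) /\ T (ext f) z = f (r *: e) * S a0 w)).
    rewrite (_ : ext 0 = 0); first by rewrite (End0 l1 HT) mul0r; split=> //; exact: lspan0.
    by apply/funext => v; rewrite /ext /ball_restrict mul0r; case: ifP.
  move=> x _ g [b hb <-] [gB gT].
  rewrite (_ : ext _ = x *: hat_mul b p + ext g); last first.
    apply/funext => v; rewrite !fctE /ext /hat_mul /ball_restrict; case: ifP => _.
      by rewrite mulrDl scalerAl.
    by rewrite scaler0 addr0.
  split; first by apply: lspanD => //; exact: (lspanZ _ (hV b)).
  rewrite (End_linear HT); [|exact: VB (hV b)|exact: VB gB].
  rewrite !fctE gT hS /hat_mul /ball_restrict zB hz jz mulrDl; congr (_ + _).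
  have [->|ba] := eqVneq b a0; first by rewrite scalerAl.
  by rewrite (monomial_first_units r hb ba) mul0r !scaler0 mul0r.
have cE : (fun l => mdegree (submxcol c l)) = d' by apply/funext.
have := lspan_monomial_mxdiag (fun l => block_reflection (lift j l)) c.
rewrite cE => /key[_].
have -> : ext (fun y => monomial c (A' *m y)) = unitary_rep A (hat_mul c p).
  apply/funext => v; rewrite /unitary_rep /= invmx_block_reflection /hat_mul /ext.
  rewrite /ball_restrict sqnorm_block_reflection.
  by rewrite hat_block_reflection submxcol_block_reflection.
rewrite (End_equivariant HT block_unitary_reflection (VB _ (hV c))) hS.
rewrite /unitary_rep /= invmx_block_reflection /hat_mul /ball_restrict.
rewrite sqnorm_block_reflection zB hat_block_reflection submxcol_block_reflection hz jz.
(* Both sides carry the factor [monomial c (A' *m (r *: e))]. It is nonzero because the reflections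
   leave no zero coordinate. *)
by apply: mulfI; exact: monomial_block_reflection.
Qed.

(** [S c] is the factor in z_(j) that [T] produces from z_hat^c p(z_(j)). For [a] and [b] it agrees
    on the ball with the factor of the same pure power. *)
Lemma End_hat_iso d d' (a b : 'cV[nat]_n') f :
  multideg (fun l => k (lift j l)) d' a -> multideg (fun l => k (lift j l)) d' b ->
  hat_term R k j d a f -> T (hat_iso d a b f) = hat_iso d a b (T f).
Proof.
move=> ha hb /hat_termP[p hp ->].
have /choice[S hS] c : exists q, homog_poly d q /\ T (hat_mul c p) = hat_mul c q.
  by have [q hq] := End_hat_mul c hp; exists q.
rewrite (hat_isoE _ _ hp) (hS a).2 (hat_isoE _ _ (hS a).1) (hS b).2.
apply/funext => z; rewrite /hat_mul /ball_restrict; case: ifP => // zB.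
have wB : sqnorm (submxcol z j) < 1.
  by apply: le_lt_trans zB; rewrite (sqnorm_hat j) lerDr sqnorm_ge0.
have SE c hc := End_hat_mul_pure_power (c := c) hp (fun c => (hS c).2) hc wB.
by rewrite (SE _ _ ha) (SE _ _ hb).
Qed.

End independence.

Theorem proposition7p1 (R : realType) (lambda : R) (m : nat)
    (k : 'I_m -> nat) (j : 'I_m)
    (T : cfun R (\sum_l k l) -> cfun R (\sum_l k l)) :
  -1 < lambda -> (2 <= m)%N -> (forall l, (0 < k l)%N) ->
  bergman_End lambda (block_unitary k j) T ->
  forall kappa : 'I_m -> nat,
  [/\ is_direct_sum (multideg_hat k j kappa) (hat_term R k j (kappa j))
        (multihomog_poly R k kappa) /\
      (forall c, multideg_hat k j kappa c ->
        T @` hat_term R k j (kappa j) c `<=` hat_term R k j (kappa j) c),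
      forall a b : 'cV[nat]_(\sum_l k l),
        multideg k kappa a -> multideg k kappa b -> hat j a != hat j b ->
        bergman_inner lambda (T (ball_monomial a)) (ball_monomial b) = 0 &
      forall a b : 'cV[nat]_(\sum_(l < m.-1) k (lift j l)),
        multideg_hat k j kappa a -> multideg_hat k j kappa b ->
        {in hat_term R k j (kappa j) a,
          T \o hat_iso (kappa j) a b =1 hat_iso (kappa j) a b \o T}].
Proof.
move=> l1 _ _ HT kappa; split.
- split; first exact: multihomog_direct_sum.
  by move=> c _ _ [f hf <-]; exact: (End_hat_term l1 HT).
- by move=> a b _ _; exact: (End_monomial_orthogonal l1 HT).
- move=> a b ha hb f /set_mem hf /=.
  exact: (@End_hat_iso R lambda m k j T l1 HT _ (fun l => kappa (lift j l))).
Qed.
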